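(* The Lie superalgebra $\mathfrak g=SKO(n,n+1;\lambda,\underline t)$ is generated (as a Lie superalgebra) by $T\cup S\cup\{D_{KO}(1)\}$, where $$T=\{E(k_i\varepsilon_i,0,2n+1,q): 1\le i\le n,\ 0\le k_i\le p^{t_i}-1,\ q\in\widetilde I(k_i\varepsilon_i,0)\},$$ $$S=\{E(0,\langle i'\rangle,2n+1,q): 1\le i\le n,\ q\in\widetilde I(0,\langle i'\rangle)\}.$$
   Context: Setting. $\mathbb F$ is a field of characteristic $p>3$, $n\ge 3$ is an integer, $\underline t=(t_1,\dots,t_n)$ is a tuple of positive integers, $\lambda\in\mathbb F$. Put $\pi_i=p^{t_i}-1$, $\mathbb A=\{\alpha\in\mathbb N_0^n:\alpha_i\le\pi_i\ \forall i\}$, $|\alpha|=\sum_i\alpha_i$, and let $\varepsilon_i$ be the $i$-th unit vector. $\mathcal O(n;\underline t)$ is the divided power algebra with basis $x^{(\alpha)}$, $\alpha\in\mathbb A$, and product $x^{(\alpha)}x^{(\beta)}=\binom{\alpha+\beta}{\alpha}x^{(\alpha+\beta)}$ (with $x^{(\gamma)}=0$ if $\gamma\notin\mathbb A$); $x_i:=x^{(\varepsilon_i)}$. $\mathcal O=\mathcal O(n;\underline t)\otimes\Lambda$, where $\Lambda$ is the exterior superalgebra in odd variables $x_{n+1},\dots,x_{2n+1}$; $\mathrm p(a)\in\mathbb Z_2$ is the parity, and formulas involving $\mathrm p(a)$ are stated for homogeneous $a$ and extended linearly. $\partial_r$ ($1\le r\le 2n+1$) is the superderivation of $\mathcal O$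 (even for $r\le n$, odd for $r>n$) with $\partial_r(x^{(\alpha)})=x^{(\alpha-\varepsilon_r)}$ for $r\le n$ and $\partial_r(x_s)=\delta_{rs}$. Put $i'=i+n$ for $1\le i\le n$, $i'=i-n$ for $n+1\le i\le 2n$; $\mu(i)=0$ for $i\le n$ and $\mu(i)=1$ for $n+1\le i\le 2n+1$; $\mathfrak D=\sum_{i=1}^{2n}x_i\partial_i$; $\Delta=\sum_{i=1}^n\partial_i\partial_{i'}$. For $a\in\mathcal O$ let $T_H(a)=\sum_{i=1}^{2n}(-1)^{\mu(i')\mathrm p(a)}\partial_{i'}(a)\partial_i$, $D_{KO}(a)=T_H(a)+(-1)^{\mathrm p(a)}\partial_{2n+1}(a)\mathfrak D+(\mathfrak D(a)-2a)\partial_{2n+1}$, and $\mathrm{div}_\lambda(a)=(-1)^{\mathrm p(a)}2\big(\Delta(a)+(\mathfrak D-n\lambda\,\mathrm{id})\partial_{2n+1}(a)\big)$. Then $KO(n,n+1;\underline t)=\{D_{KO}(a):a\in\mathcal O\}$ is a Lie superalgebra of superderivations of $\mathcal O$, and $\mathfrak g''=SKO''(n,n+1;\lambda,\underline t)=\{D_{KO}(a):a\in\mathcal O,\ \mathrm{div}_\lambda(a)=0\}$ is a subalgebra. Put $\mathfrak g'=[\mathfrak g'',\mathfrak g'']$ and $\mathfrak g=SKO(n,n+1;\lambda,\underline t)=[\mathfrak g',\mathfrak g']$. Monomial notation. For $\alpha\in\mathbb A$ and $u=\langle i_1,\dots,i_k\rangle$ with $n+1\le i_1<\dots<i_k\le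 2n$, put $x^u=x_{i_1}\cdots x_{i_k}$, $|u|=k$ ($u=0$ is the empty sequence), $\mathrm{zd}(x^{(\alpha)}x^u)=|\alpha|+|u|$, $\nabla_i(x^{(\alpha)}x^u)=x^{(\alpha+\varepsilon_i)}x_{i'}x^u$ for $1\le i\le n$ (zero if $\alpha_i=\pi_i$), $\widetilde I(\alpha,u)=\{1\le i\le n:\nabla_i(x^{(\alpha)}x^u)\ne0\}$, and for $q\in\widetilde I(\alpha,u)$ $$E(\alpha,u,2n+1,q)=D_{KO}\big(x^{(\alpha)}x^ux_{2n+1}+(-1)^{|u|}(n\lambda-\mathrm{zd}(x^{(\alpha)}x^u))\nabla_q(x^{(\alpha)}x^u)\big).$$ *)

(* Defs.v *)
From HB Require Import structures.
From mathcomp Require Import all_boot all_order all_algebra.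

Set Implicit Arguments.
Unset Strict Implicit.
Unset Printing Implicit Defensive.

Import GRing.Theory.
Local Open Scope ring_scope.

Section Basis.

Variables (p n : nat) (t : 'I_n -> nat).

(* The pair (alpha, u) stands for x^(alpha) x^u: the bound alpha_i < p ^ t_i
   says alpha \in A, and j : 'I_n.+1 numbers the odd variable x_{n+1+j}, so that
   ord_max numbers x_{2n+1}; the factors of x^u are in increasing order.      *)
Definition basis : finType :=
  ({dffun forall i : 'I_n, 'I_(p ^ t i)} * {set 'I_n.+1})%type.

End Basis.

(* Number of transpositions needed to sort x^u x^v. *)
Definition inversions (m : nat) (u v : {set 'I_m}) : nat :=
  (\sum_(j in u) #|[set k in v | (k < j)%N]|)%N.

Section SKO.

Variables (F : fieldType) (p n : nat) (t : 'I_n -> nat).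

Local Notation basis := (basis p t).
Local Notation O := {ffun basis -> F^o}.
Local Notation odd_index := 'I_n.+1.

(* x^(al) x^u, which is 0 when al is not in A. *)
Definition mon (al : 'I_n -> nat) (u : {set odd_index}) : O :=
  [ffun m : basis => ([forall i, m.1 i == al i :> nat] && (m.2 == u))%:R].

Definition mulmon (m1 m2 : basis) : O :=
  if [disjoint m1.2 & m2.2] then
    ((-1) ^+ inversions m1.2 m2.2 * (\prod_i 'C(m1.1 i + m2.1 i, m1.1 i))%:R)
      *: mon (fun i => m1.1 i + m2.1 i)%N (m1.2 :|: m2.2)
  else 0.

Definition mul (a b : O) : O :=
  \sum_(m1 : basis) \sum_(m2 : basis) (a m1 * b m2) *: mulmon m1 m2.

(* (-1)^(k p(a)) a for homogeneous a, extended linearly. *)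
Definition sgnp (k : nat) (a : O) : O :=
  [ffun m : basis => (-1) ^+ (k * #|m.2|) * a m].

Definition opart (b : bool) (a : O) : O :=
  [ffun m : basis => if odd #|m.2| == b then a m else 0].

Definition epartial (r : 'I_n) (a : O) : O :=
  \sum_(m : basis | (0 < m.1 r)%N)
     a m *: mon (fun i => m.1 i - (i == r))%N m.2.

(* The sign comes from moving x_j to the front of x^u. *)
Definition opartial (j : odd_index) (a : O) : O :=
  \sum_(m : basis | j \in m.2)
     (a m * (-1) ^+ #|[set k in m.2 | (k < j)%N]|)
       *: mon (fun i => m.1 i) (m.2 :\ j).

(* The indices 1, ..., 2n: inl i is i and inr i is i' = n + i, for i <= n. *)
Definition prime_idx (i : 'I_n + 'I_n) : 'I_n + 'I_n :=
  match i with inl j => inr j | inr j => inl j end.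

Definition mu (i : 'I_n + 'I_n) : nat :=
  match i with inl _ => 0%N | inr _ => 1%N end.

Definition odd_of (j : 'I_n) : odd_index := widen_ord (leqnSn n) j.

Definition eps (i : 'I_n) : 'I_n -> nat := fun j => (j == i) : nat.
Definition zero_exp : 'I_n -> nat := fun=> 0%N.

Definition var (i : 'I_n + 'I_n) : O :=
  match i with
  | inl j => mon (eps j) set0
  | inr j => mon zero_exp [set odd_of j]
  end.

Definition partial (i : 'I_n + 'I_n) : O -> O :=
  match i with inl j => epartial j | inr j => opartial (odd_of j) end.

Definition lastvar : O := mon zero_exp [set ord_max].
Definition dlast : O -> O := opartial ord_max.

Definition euler (a : O) : O :=
  \sum_(i : 'I_n + 'I_n) mul (var i) (partial i a).

Definition laplace (a : O) : O :=
  \sum_(i < n) partial (inl i) (partial (prime_idx (inl i)) a).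

Definition lmul (a : O) : 'End(O) := linfun (mul a).

Definition TH (a : O) : 'End(O) :=
  \sum_(i : 'I_n + 'I_n)
    (lmul (partial (prime_idx i) (sgnp (mu (prime_idx i)) a))
       \o linfun (partial i))%VF.

Definition DKO (a : O) : 'End(O) :=
  TH a + (lmul (dlast (sgnp 1 a)) \o linfun euler)%VF
       + (lmul (euler a - a *+ 2) \o linfun dlast)%VF.

Definition divl (lam : F) (a : O) : O :=
  let b := sgnp 1 a in
  2%:R *: (laplace b + (euler (dlast b) - (n%:R * lam) *: dlast b)).

Definition hpart (b : bool) (D : 'End(O)) : 'End(O) :=
  \sum_(c : bool) (linfun (opart (c (+) b)) \o D \o linfun (opart c))%VF.

(* The supercommutator D E - (-1)^(p(D)p(E)) E D, extended bilinearly. *)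
Definition sbracket (D E : 'End(O)) : 'End(O) :=
  \sum_(b : bool) \sum_(c : bool)
    ((hpart b D \o hpart c E)%VF
       - (-1) ^+ (b && c) *: (hpart c E \o hpart b D)%VF).

(* The span of all brackets [D, E] with D in U and E in V. *)
Definition sbracketv (U V : {vspace 'End(O)}) : {vspace 'End(O)} :=
  <<[seq sbracket D E | D <- vbasis U, E <- vbasis V]>>%VS.

Definition is_subsuperalgebra (h : {vspace 'End(O)}) : Prop :=
  (forall b D, D \in h -> hpart b D \in h) /\
  (forall D E, D \in h -> E \in h -> sbracket D E \in h).

Definition lie_generated (X : 'End(O) -> Prop) (D : 'End(O)) : Prop :=
  forall h : {vspace 'End(O)},
    is_subsuperalgebra h -> (forall E, X E -> E \in h) -> D \in h.

(* SKO2, SKO1 and SKO are SKO'', SKO' and SKO; memSKO2P unfolds the first. *)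
Definition SKO2 (lam : F) : {vspace 'End(O)} :=
  (linfun DKO @: lker (linfun (divl lam)))%VS.

Definition SKO1 (lam : F) : {vspace 'End(O)} :=
  sbracketv (SKO2 lam) (SKO2 lam).

Definition SKO (lam : F) : {vspace 'End(O)} :=
  sbracketv (SKO1 lam) (SKO1 lam).

(* From here on, u : {set 'I_n} is the increasing sequence of the i', i \in u. *)

Definition xmon (al : 'I_n -> nat) (u : {set 'I_n}) : O :=
  mon al (odd_of @: u).

Definition zd (al : 'I_n -> nat) (u : {set 'I_n}) : nat :=
  (\sum_i al i + #|u|)%N.

Definition nabla (i : 'I_n) (al : 'I_n -> nat) (u : {set 'I_n}) : O :=
  mul (mul (mon (fun j => al j + eps i j)%N set0) (var (prime_idx (inl i))))
      (xmon zero_exp u).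

Definition Itilde (al : 'I_n -> nat) (u : {set 'I_n}) : {set 'I_n} :=
  [set i | nabla i al u != 0].

Definition Egen (lam : F) (al : 'I_n -> nat) (u : {set 'I_n}) (q : 'I_n)
    : 'End(O) :=
  DKO (mul (xmon al u) lastvar
       + ((-1) ^+ #|u| * (n%:R * lam - (zd al u)%:R)) *: nabla q al u).

Definition Tset (lam : F) (D : 'End(O)) : Prop :=
  exists (i : 'I_n) (k : nat) (q : 'I_n),
    [/\ (k <= p ^ t i - 1)%N,
        q \in Itilde (fun j => k * eps i j)%N set0
      & D = Egen lam (fun j => k * eps i j)%N set0 q].

Definition Sset (lam : F) (D : 'End(O)) : Prop :=
  exists i q : 'I_n,
    q \in Itilde zero_exp [set i] /\ D = Egen lam zero_exp [set i] q.

Definition DKO_one : 'End(O) := DKO (mon zero_exp set0).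

(* linfun f agrees with f only when f is linear, which is checked below for the
   operators it is applied to. *)

Lemma mul_linear (a : O) : linear (mul a).
Proof.
move=> c x y; rewrite /mul scaler_sumr -big_split; apply: eq_bigr => m1 _ /=.
rewrite scaler_sumr -big_split; apply: eq_bigr => m2 _ /=.
by rewrite !ffunE mulrDr scalerDl scalerA [c *: _ in LHS]/GRing.scale /= mulrCA.
Qed.

Lemma mul_linearl (b : O) : linear (mul^~ b).
Proof.
move=> c x y; rewrite /mul scaler_sumr -big_split; apply: eq_bigr => m1 _ /=.
rewrite scaler_sumr -big_split; apply: eq_bigr => m2 _ /=.
by rewrite !ffunE mulrDl scalerDl scalerA [c *: _ in LHS]/GRing.scale /= mulrA.
Qed.

Lemma sgnp_linear k : linear (sgnp k).
Proof.
move=> c x y; apply/ffunP=> m.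
by rewrite !ffunE mulrDr /GRing.scale /= mulrCA.
Qed.

Lemma opart_linear b : linear (opart b).
Proof.
move=> c x y; apply/ffunP=> m; rewrite !ffunE.
by case: ifP => // _; rewrite scaler0 addr0.
Qed.

Lemma epartial_linear r : linear (epartial r).
Proof.
move=> c x y; rewrite /epartial scaler_sumr -big_split.
by apply: eq_bigr => m _ /=; rewrite !ffunE scalerDl scalerA.
Qed.

Lemma opartial_linear j : linear (opartial j).
Proof.
move=> c x y; rewrite /opartial scaler_sumr -big_split.
apply: eq_bigr => m _ /=.
by rewrite !ffunE mulrDl scalerDl scalerA [c *: _ in LHS]/GRing.scale /= mulrA.
Qed.

Lemma partial_linear i : linear (partial i).
Proof. by case: i => j; [apply: epartial_linear | apply: opartial_linear]. Qed.

HB.instance Definition _ a := GRing.isLinear.Build F O O _ (mul a)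
  (mul_linear a).
HB.instance Definition _ k := GRing.isLinear.Build F O O _ (sgnp k)
  (sgnp_linear k).
HB.instance Definition _ b := GRing.isLinear.Build F O O _ (opart b)
  (opart_linear b).
HB.instance Definition _ j := GRing.isLinear.Build F O O _ (opartial j)
  (opartial_linear j).
HB.instance Definition _ i := GRing.isLinear.Build F O O _ (partial i)
  (partial_linear i).
HB.instance Definition _ := GRing.isLinear.Build F O O _ dlast
  (opartial_linear ord_max).

Lemma euler_linear : linear euler.
Proof.
move=> c x y; rewrite /euler scaler_sumr -big_split.
by apply: eq_bigr => i _ /=; rewrite !linearP.
Qed.

HB.instance Definition _ := GRing.isLinear.Build F O O _ euler euler_linear.

Lemma laplace_linear : linear laplace.
Proof.
move=> c x y; rewrite /laplace scaler_sumr -big_split.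
by apply: eq_bigr => i _; rewrite (linearP (partial _)) (linearP (partial _)).
Qed.

HB.instance Definition _ := GRing.isLinear.Build F O O _ laplace laplace_linear.

Lemma lmul_linear : linear lmul.
Proof.
move=> c x y; apply/lfunP=> z.
by rewrite add_lfunE scale_lfunE !lfunE /= mul_linearl.
Qed.

HB.instance Definition _ := GRing.isLinear.Build F O 'End(O) _ lmul lmul_linear.

Lemma DKO_linear : linear DKO.
Proof.
have compP (c : F) (f g h : 'End(O)) :
  ((c *: f + g) \o h = c *: (f \o h) + (g \o h))%VF.
  by rewrite comp_lfunDl comp_lfunZl.
move=> c x y; rewrite /DKO.
have -> : TH (c *: x + y) = c *: TH x + TH y.
  rewrite /TH scaler_sumr -big_split; apply: eq_bigr => i _.
  by rewrite (linearP (sgnp _)) (linearP (partial _)) linearP compP.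
rewrite (linearP (sgnp _)) (linearP dlast) linearP compP (linearP euler).
have -> : c *: euler x + euler y - (c *: x + y) *+ 2 =
          c *: (euler x - x *+ 2) + (euler y - y *+ 2).
  by rewrite scalerBr -scalerMnr mulrnDl opprD addrACA.
rewrite linearP compP !scalerDr.
by rewrite [X in X + _ = _]addrACA [LHS]addrACA.
Qed.

HB.instance Definition _ := GRing.isLinear.Build F O 'End(O) _ DKO DKO_linear.

Lemma divl_linear lam : linear (divl lam).
Proof.
move=> c x y; rewrite /divl (linearP (sgnp _)) /=.
move: (sgnp 1 x) (sgnp 1 y) => {}x {}y.
rewrite (linearP laplace) (linearP dlast) (linearP euler).
set k := n%:R * lam.
have scalerCA (d e : F) (z : O) : d *: (e *: z) = e *: (d *: z).
  by rewrite !scalerA mulrC.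
rewrite [in RHS]scalerCA -scalerDr; congr (_ *: _).
rewrite !scalerDr scalerN [k *: (c *: _)]scalerCA opprD.
by rewrite [X in _ + X = _]addrACA [LHS]addrACA.
Qed.

HB.instance Definition _ lam := GRing.isLinear.Build F O O _ (divl lam)
  (divl_linear lam).

Lemma memSKO2P lam (D : 'End(O)) :
  reflect (exists2 a : O, divl lam a = 0 & D = DKO a) (D \in SKO2 lam).
Proof.
apply: (iffP memv_imgP) => [[a] | [a a0 ->]].
  by rewrite memv_ker !lfunE => /eqP a0 ->; exists a.
exists a; last by rewrite lfunE.
by rewrite memv_ker lfunE /= a0.
Qed.

Lemma hpart_linear b : linear (hpart b).
Proof.
move=> c D E; rewrite /hpart scaler_sumr -big_split.
apply: eq_bigr => e _ /=.
by rewrite comp_lfunDr -comp_lfunZr comp_lfunDl -comp_lfunZl.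
Qed.

HB.instance Definition _ b := GRing.isLinear.Build F 'End(O) 'End(O) _ (hpart b)
  (hpart_linear b).

Lemma sbracket_linear D : linear (sbracket D).
Proof.
move=> c x y; rewrite /sbracket scaler_sumr -big_split.
apply: eq_bigr => e _ /=; rewrite scaler_sumr -big_split.
apply: eq_bigr => f _ /=; rewrite (linearP (hpart f)).
rewrite comp_lfunDr -comp_lfunZr comp_lfunDl -comp_lfunZl.
rewrite !scalerDr opprD addrACA scalerN !scalerA; congr (_ - _ + _).
by rewrite mulrC.
Qed.

Lemma sbracket_linearl E : linear (sbracket^~ E).
Proof.
move=> c x y; rewrite /sbracket scaler_sumr -big_split.
apply: eq_bigr => e _ /=; rewrite scaler_sumr -big_split.
apply: eq_bigr => f _ /=; rewrite (linearP (hpart e)).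
rewrite comp_lfunDr -comp_lfunZr comp_lfunDl -comp_lfunZl.
rewrite !scalerDr opprD addrACA scalerN !scalerA; congr (_ - _ + _).
by rewrite mulrC.
Qed.

(* sbracketv U V does not depend on the bases used to define it. *)
Lemma sbracketvP (U V W : {vspace 'End(O)}) :
  (forall D E, D \in U -> E \in V -> sbracket D E \in W)
  <-> (sbracketv U V <= W)%VS.
Proof.
split=> [UVW | /subvP sUVW D E UD VE].
  apply/span_subvP => _ /allpairsP[[D E] /= [UD VE ->]].
  by rewrite UVW // vbasis_mem.
apply: sUVW; rewrite /sbracketv.
have lr X : linear (sbracket X) := sbracket_linear X.
have ll Y : linear (sbracket^~ Y) := sbracket_linearl Y.
pose fr X := HB.pack_for {linear 'End(O) -> 'End(O)} (sbracket X)
  (GRing.isLinear.Build F 'End(O) 'End(O) _ _ (lr X)).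
pose fl Y := HB.pack_for {linear 'End(O) -> 'End(O)} (sbracket^~ Y)
  (GRing.isLinear.Build F 'End(O) 'End(O) _ _ (ll Y)).
rewrite (coord_vbasis VE) -[sbracket _ _]/(fr D _) linear_sum memv_suml // => j _.
rewrite linearZ memvZ //= (coord_vbasis UD).
rewrite -[sbracket _ _]/(fl _ _) linear_sum memv_suml // => i _.
rewrite linearZ memvZ //= memv_span //; apply/allpairsP.
by exists ((vbasis U)`_i, (vbasis V)`_j); rewrite !mem_nth ?size_tuple.
Qed.

End SKO.

(* Main.v *)
Require Import Defs.
From HB Require Import structures.
From mathcomp Require Import all_boot all_order all_algebra.
From mathcomp Require Import ring zify.
Import GRing.Theory.
Import Defs.

Set Implicit Arguments.
Unset Strict Implicit.
Unset Printing Implicit Defensive.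

Local Open Scope ring_scope.

(* Write c = n lambda and xi_i = x_{i'}, tau = x_{2n+1}. The superderivation D_KO(a)
   is the BV-type expression
     D_KO(a) b = Del_(w+2)(s(a) b) - Del_(w+2)(s(a)) b - a Del_w(b),
   where s is the parity automorphism and Del_w = Delta + (D - w) d_tau satisfies
   Del_w Del_(w+2) = 0. Hence the functions of SKO'' form ker Del_c, on which the bracket
   is {a, b} = Del_(c+2)(s(a) b), and so SKO' lies in the image W of Del_(c+2).
   Integration by parts shows that for c = -1 the bracket of two elements of W has no
   component along Del_(c+2)(top tau), where top = x^(pi) xi_1 ... xi_n. It remains to
   generate W (without that component if c = -1) from the given elements, which are
   Del_(c+2)(m tau) for monomials m of low odd degree: first all x^(al) with al <> pi
   and xi^u with u not full are obtained, then their brackets give the image of Delta,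
   and bracketing with elements of degree one gives Del_(c+2)(m tau) for all m <> top.
   Finally the generators are themselves brackets of elements of W, so that W is
   contained in SKO' and therefore in SKO. *)

(** * The superalgebra of divided powers *)

(** The weight of Del_w is left free because several weights meet: generating functions have weight
    2, the functions acted on have weight 0, the divergence has weight c, and a bracket of weights u
    and v has weight u + v - 2. The value c = -1 is exceptional because the Berezin integral makes
    Del_(-w) the adjoint of Del_w up to sign: elements of W are killed by Del_c, and this is the
    adjoint of Del_(c+2) exactly when -(c + 2) = c. The obstacle is the characteristic. Multiplying
    f by g through a bracket costs a factor df - 2 - (dg - c) r, with df and dg the degrees, which
    may vanish in F; every induction on the degree needs a detour around the exponents where it
    does. Generation is used for two algebras. The generators are brackets of elements of W, hence
    lie in SKO'; generation inside SKO' puts W there; so the same brackets already lie in SKO.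
    Generation inside an arbitrary subsuperalgebra gives the other inclusion. *)

Section Monomials.
Variables (F : fieldType) (p n : nat) (t : 'I_n -> nat).
Local Notation basis := (basis p t).
Local Notation O := {ffun basis -> F^o}.

Definition bmon (m : basis) : O := mon F p t (fun i => m.1 i) m.2.

Lemma bmonE (m k : basis) : bmon m k = (k == m)%:R.
Proof.
rewrite ffunE; congr (_ %:R); congr nat_of_bool.
apply/andP/eqP => [[/forallP h /eqP h2]|->]; last by split=> //; apply/forallP.
case: k m h h2 => k1 k2 [m1 m2] /= h ->; congr pair.
by apply/ffunP=> i; apply/val_inj/eqP/h.
Qed.

Lemma O_expand (a : O) : a = \sum_m a m *: bmon m.
Proof.
apply/ffunP=> k; rewrite sum_ffunE (bigD1 k) //= ffunE bmonE eqxx [_ *: _]mulr1.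
rewrite big1 ?addr0 // => m mk; rewrite ffunE bmonE eq_sym (negPf mk).
by rewrite [_ *: _]mulr0.
Qed.

Lemma O_ind (P : O -> Prop) : P 0 ->
  (forall c m a, P a -> P (c *: bmon m + a)) -> forall a, P a.
Proof.
move=> P0 PD a; rewrite (O_expand a).
by elim/big_rec: _ => // m b _ /PD; apply.
Qed.

Definition in_range (al : 'I_n -> nat) := [forall i, (al i < p ^ t i)%N].

Lemma mon_bmon al u : in_range al -> exists m : basis,
  [/\ mon F p t al u = bmon m, forall i, m.1 i = al i :> nat & m.2 = u].
Proof.
move=> /forallP h; exists ([ffun i => Ordinal (h i)], u); split=> [|i|] //=.
  by apply/ffunP=> k; rewrite !ffunE; congr ((_ && _)%:R); apply: eq_forallb => i; rewrite ffunE.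
by rewrite ffunE.
Qed.

Lemma mon_out al u : ~~ in_range al -> mon F p t al u = 0.
Proof.
move=> /forallPn[i hi]; apply/ffunP=> k; rewrite !ffunE.
case: forallP => // /(_ i)/eqP h; move: hi; by rewrite -h ltn_ord.
Qed.

Lemma eq_mon al be u : al =1 be -> mon F p t al u = mon F p t be u.
Proof.
by move=> h; apply/ffunP=> k; rewrite !ffunE; congr ((_ && _)%:R); apply: eq_forallb => i; rewrite h.
Qed.

Lemma in_range_basis (m : basis) : in_range (fun i => m.1 i).
Proof. by apply/forallP=> i; apply: ltn_ord. Qed.

Lemma opartial_mon j al u : opartial j (mon F p t al u) =
  if j \in u then (-1) ^+ #|[set k in u | (k < j)%N]| *: mon F p t al (u :\ j)
  else 0.
Proof.
have [h|h] := boolP (in_range al); last first.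
  by rewrite !mon_out // linear0 scaler0 if_same.
have [m [-> hm <-]] := mon_bmon u h.
rewrite /opartial; case: ifP => jm.
  rewrite (bigD1 m) //= bmonE eqxx mul1r big1 ?addr0.
    by rewrite (@eq_mon (fun i => m.1 i) al).
  by move=> k /andP[_ km]; rewrite bmonE (negPf km) mul0r scale0r.
rewrite big1 // => k jk; rewrite bmonE; case: eqP => [kE|_]; last by rewrite mul0r scale0r.
by rewrite kE jm in jk.
Qed.

Lemma epartial_mon r al u : in_range al -> epartial r (mon F p t al u) =
  if (0 < al r)%N then mon F p t (fun i => al i - (i == r))%N u else 0.
Proof.
move=> h; have [m [-> hm <-]] := mon_bmon u h.
rewrite /epartial -hm; case: ifP => jm.
  rewrite (bigD1 m) //= bmonE eqxx scale1r big1 ?addr0.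
    by apply: eq_mon => i; rewrite hm.
  by move=> k /andP[_ km]; rewrite bmonE (negPf km) scale0r.
rewrite big1 // => k jk; rewrite bmonE; case: eqP => [kE|_]; last by rewrite scale0r.
by rewrite kE jm in jk.
Qed.

Local Notation "a ** b" := (@mul F p n t a b) (at level 40, left associativity).

Lemma mulDl (a b c : O) : (a + b) ** c = a ** c + b ** c.
Proof. by have := mul_linearl c 1 a b; rewrite !scale1r. Qed.
Lemma mulZl k (a b : O) : (k *: a) ** b = k *: (a ** b).
Proof.
have h0 : (0 : O) ** b = 0.
  have := mulDl 0 0 b; rewrite addr0 => /(congr1 (fun x => x - 0 ** b)).
  by rewrite addrK subrr.
by have := mul_linearl b k a 0; rewrite !addr0 h0 addr0.
Qed.
Lemma mulDr (a b c : O) : a ** (b + c) = a ** b + a ** c.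
Proof. exact: linearD. Qed.
Lemma mulZr k (a b : O) : a ** (k *: b) = k *: (a ** b).
Proof. exact: linearZ. Qed.
Lemma mulNl (a b : O) : (- a) ** b = - (a ** b).
Proof. by rewrite -scaleN1r mulZl scaleN1r. Qed.
Lemma mulNr (a b : O) : a ** (- b) = - (a ** b).
Proof. exact: linearN. Qed.
Lemma mul0x (b : O) : 0 ** b = 0.
Proof. by have := mulZl 0 0 b; rewrite !scale0r. Qed.
Lemma mulx0 (b : O) : b ** 0 = 0.
Proof. exact: linear0. Qed.
Lemma mulBl (a b c : O) : (a - b) ** c = a ** c - b ** c.
Proof. by rewrite mulDl mulNl. Qed.
Lemma mulBr (a b c : O) : a ** (b - c) = a ** b - a ** c.
Proof. exact: linearB. Qed.
Lemma mul_suml I (r : seq I) (P : pred I) (f : I -> O) b :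
  (\sum_(i <- r | P i) f i) ** b = \sum_(i <- r | P i) (f i ** b).
Proof.
apply: (big_ind2 (fun x y => x ** b = y)); rewrite ?mul0x //.
by move=> x1 _ x2 _ <- <-; rewrite mulDl.
Qed.
Lemma mul_sumr I (r : seq I) (P : pred I) (f : I -> O) b :
  b ** (\sum_(i <- r | P i) f i) = \sum_(i <- r | P i) (b ** f i).
Proof. exact: linear_sum. Qed.

Lemma mul_bmon (m1 m2 : basis) : bmon m1 ** bmon m2 = mulmon F m1 m2.
Proof.
rewrite /mul (bigD1 m1) //= (bigD1 m2) //= !bmonE !eqxx mulr1 scale1r.
rewrite !big1 ?addr0 // => m mE; last by rewrite !bmonE (negPf mE) mulr0 scale0r.
by rewrite big1 // => k _; rewrite !bmonE (negPf mE) mul0r scale0r.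
Qed.

Lemma mul_mon al u be v : mon F p t al u ** mon F p t be v =
  if [disjoint u & v] then
    ((-1) ^+ inversions u v * (\prod_i 'C(al i + be i, al i))%:R)
      *: mon F p t (fun i => al i + be i)%N (u :|: v)
  else 0.
Proof.
have [h|h] := boolP (in_range al); last first.
  rewrite (mon_out _ h) (@mon_out (fun i => al i + be i)%N) ?mul0x ?scaler0 ?if_same //.
  move: h; apply: contra => /forallP h; apply/forallP => i.
  exact: leq_ltn_trans (leq_addr _ _) (h i).
have [h'|h'] := boolP (in_range be); last first.
  rewrite (mon_out _ h') (@mon_out (fun i => al i + be i)%N) ?mulx0 ?scaler0 ?if_same //.
  move: h'; apply: contra => /forallP h'; apply/forallP => i.
  exact: leq_ltn_trans (leq_addl _ _) (h' i).
have [m1 [-> hm <-]] := mon_bmon u h.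
have [m2 [-> hm' <-]] := mon_bmon v h'.
rewrite mul_bmon /mulmon; case: ifP => // _; congr (_ * _%:R *: _).
  by apply: eq_bigr => i _; rewrite hm hm'.
by apply: eq_mon => i; rewrite hm hm'.
Qed.

End Monomials.

(** * Signs of products of odd variables *)

Section Inversions.
Variable m : nat.
Implicit Types u v w : {set 'I_m}.

Lemma inversionsE u v :
  inversions u v = (\sum_(j in u) \sum_(k in v | (k < j)%N) 1)%N.
Proof.
by apply: eq_bigr => j _; rewrite -sum1_card; apply: eq_bigl => k; rewrite !inE.
Qed.

Lemma inversionsUl u v w : [disjoint u & v] ->
  inversions (u :|: v) w = (inversions u w + inversions v w)%N.
Proof.
move=> d; rewrite /inversions (bigID (mem u)) /=.
congr (_ + _)%N; apply: eq_bigl => j; rewrite inE.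
  by case: (j \in u); rewrite ?andbF.
case: (boolP (j \in u)) => [ju|]; last by rewrite andbT.
by rewrite andbF (disjointFr d ju).
Qed.

Lemma inversionsUr u v w : [disjoint v & w] ->
  inversions u (v :|: w) = (inversions u v + inversions u w)%N.
Proof.
move=> d; rewrite /inversions -big_split; apply: eq_bigr => j _ /=.
rewrite -cardsUI (_ : _ :&: _ = set0) ?cards0 ?addn0.
  by apply: eq_card => k; rewrite !inE andb_orl.
apply/setP => k; rewrite !inE; case: (boolP (k \in v)) => // kv.
by rewrite (disjointFr d kv) andbF.
Qed.

Lemma disjointUl u v w :
  [disjoint u :|: v & w] = [disjoint u & w] && [disjoint v & w].
Proof. by rewrite -!setI_eq0 setIUl setU_eq0. Qed.

Lemma disjointUr u v w :
  [disjoint w & u :|: v] = [disjoint w & u] && [disjoint w & v].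
Proof. by rewrite -!setI_eq0 setIUr setU_eq0. Qed.

Lemma inversions1l j v : inversions [set j] v = #|[set k in v | (k < j)%N]|.
Proof. by rewrite /inversions big_set1. Qed.

(** As [u] and [v] are disjoint, each pair in their product is counted by exactly one of the two
    summands. *)
Lemma inversions_sym u v : [disjoint u & v] ->
  (inversions u v + inversions v u = #|u| * #|v|)%N.
Proof.
move=> d; rewrite !inversionsE [X in (_ + X)%N](exchange_big_dep (mem u)) /=; last by move=> ? ? _ /andP[].
rewrite -big_split /= -sum_nat_const; apply: eq_bigr => j ju.
rewrite -sum1_card [RHS](bigID (fun k : 'I_m => (k < j)%N)) /=; congr (_ + _)%N.
apply: eq_bigl => k; rewrite ju /= -leqNgt [in RHS]leq_eqVlt.
case: eqP => [/ord_inj kj|//]; by rewrite -kj (disjointFr d ju).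
Qed.

End Inversions.

(** * Associativity of the product *)

Section Associativity.
Variables (F : fieldType) (p n : nat) (t : 'I_n -> nat).
Local Notation basis := (basis p t).
Local Notation O := {ffun basis -> F^o}.
Local Notation "a ** b" := (@mul F p n t a b) (at level 40, left associativity).
Implicit Types (a b c f g : O) (m : basis).

(** Both sides are the trinomial coefficient: multiplied by a! b! c!, each becomes (a + b + c)!. *)
Lemma bin_trinomial (a b c : nat) : ('C(a + b, a) * 'C(a + b + c, a + b) =
  'C(b + c, b) * 'C(a + (b + c), a))%N.
Proof.
have f x : (0 < x`!)%N by apply: fact_gt0.
apply/eqP; rewrite -(eqn_pmul2r (f a)) -(eqn_pmul2r (f b)) -(eqn_pmul2r (f c)).
have e1 := @bin_fact (a + b) a (leq_addr _ _).
have e2 := @bin_fact (a + b + c) (a + b) (leq_addr _ _).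
have e3 := @bin_fact (b + c) b (leq_addr _ _).
have e4 := @bin_fact (a + (b + c)) a (leq_addr _ _).
rewrite !addKn -?addnA ?addKn in e1 e2 e3 e4.
apply/eqP; rewrite -!addnA.
set C2 := 'C(a + (b + c), a + b) in e2 *; set C4 := 'C(a + (b + c), a) in e4 *.
set C1 := 'C(a + b, a) in e1 *; set C3 := 'C(b + c, b) in e3 *.
have -> : (C1 * C2 * a`! * b`! * c`! = C2 * (C1 * (a`! * b`!) * c`!))%N by ring.
have -> : (C3 * C4 * a`! * b`! * c`! = C4 * (a`! * (C3 * (b`! * c`!))))%N by ring.
by rewrite e1 e2 e3 e4.
Qed.

Lemma mulA a b c : a ** (b ** c) = a ** b ** c.
Proof.
elim/O_ind: a => [|x m1 a IH]; first by rewrite !mul0x.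
rewrite !mulDl !mulZl {}IH; congr (_ *: _ + _).
elim/O_ind: b => [|y m2 b IH]; first by rewrite !(mul0x, mulx0).
rewrite !(mulDl, mulDr, mulZl, mulZr) {}IH; congr (_ *: _ + _).
elim/O_ind: c => [|z m3 c IH]; first by rewrite !(mul0x, mulx0).
rewrite !(mulDr, mulZr) {}IH; congr (_ *: _ + _).
rewrite /bmon !mul_mon.
have [d12|d12] := boolP [disjoint m1.2 & m2.2]; last first.
  rewrite mul0x; case: ifP => _; last by rewrite mulx0.
  by rewrite mulZr mul_mon disjointUr (negPf d12) scaler0.
have [d23|d23] := boolP [disjoint m2.2 & m3.2]; last first.
  by rewrite mulx0 mulZl mul_mon disjointUl (negPf d23) andbF scaler0.
rewrite mulZr mulZl !mul_mon disjointUr disjointUl d12 d23 andbT /=.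
case: ifP => d13; last by rewrite !scaler0.
rewrite !scalerA inversionsUr // inversionsUl // !exprD setUA.
rewrite (@eq_mon _ _ _ _ (fun i => m1.1 i + (m2.1 i + m3.1 i))%N
  (fun i => m1.1 i + m2.1 i + m3.1 i)%N) => [|i]; last exact: addnA.
congr (_ *: _); rewrite mulrACA [RHS]mulrACA -!natrM -!big_split /=.
congr (_ * _%:R); first by ring.
by apply: eq_bigr => i _; rewrite [RHS]bin_trinomial.
Qed.

End Associativity.

Lemma card_setU (T : finType) (u v : {set T}) :
  [disjoint u & v] -> #|u :|: v| = (#|u| + #|v|)%N.
Proof. by rewrite -setI_eq0 -cardsUI => /eqP ->; rewrite cards0 addn0. Qed.

(** * Parity and supercommutativity *)

Section Parity.
Variables (F : fieldType) (p n : nat) (t : 'I_n -> nat).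
Local Notation basis := (basis p t).
Local Notation O := {ffun basis -> F^o}.
Local Notation "a ** b" := (@mul F p n t a b) (at level 40, left associativity).
Local Notation mn := (mon F p t).
Implicit Types (a b c f g : O) (m : basis).

Definition one : O := mn (@zero_exp n) set0.

Lemma mul1x a : one ** a = a.
Proof.
elim/O_ind: a => [|c m a IH]; first by rewrite mulx0.
rewrite mulDr mulZr {}IH; congr (_ *: _ + _).
rewrite /one /bmon mul_mon -setI_eq0 set0I eqxx set0U /inversions big_set0 expr0.
rewrite big1 ?mulr1 ?scale1r => [|i _]; last by rewrite bin0.
exact: eq_mon.
Qed.

Lemma sgnpD k a b : sgnp k (a + b) = sgnp k a + sgnp k b.
Proof. exact: linearD. Qed.
Lemma sgnpN k a : sgnp k (- a) = - sgnp k a.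
Proof. exact: linearN. Qed.
Lemma sgnpZ k x a : sgnp k (x *: a) = x *: sgnp k a.
Proof. exact: linearZ. Qed.
Lemma sgnp_zero k : sgnp k (0 : O) = 0.
Proof. exact: linear0. Qed.

Lemma sgnp0 a : sgnp 0 a = a.
Proof. by apply/ffunP=> m; rewrite ffunE mul0n expr0 mul1r. Qed.

Lemma sgnp_sgnp k l a : sgnp k (sgnp l a) = sgnp (k + l) a.
Proof. by apply/ffunP=> m; rewrite !ffunE mulrA -exprD mulnDl. Qed.

Lemma sgnpE k a m : sgnp k a m = (-1) ^+ (k * #|m.2|) * a m.
Proof. by rewrite ffunE. Qed.

Lemma sgnp_odd k a : sgnp k a = sgnp (odd k) a.
Proof.
by apply/ffunP=> m; rewrite !sgnpE -signr_odd oddM -[in RHS]signr_odd oddM oddb.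
Qed.

Lemma sgnpK k a : sgnp k (sgnp k a) = a.
Proof. by rewrite sgnp_sgnp sgnp_odd addnn odd_double sgnp0. Qed.

Lemma sgnp_mon k al u : sgnp k (mn al u) = (-1) ^+ (k * #|u|) *: mn al u.
Proof.
apply/ffunP=> m; rewrite !ffunE [_ *: _]/GRing.scale /=.
by case: andP => [[_ /eqP ->]|_]; rewrite ?mulr0.
Qed.

Lemma sgnp_mul k a b : sgnp k (a ** b) = sgnp k a ** sgnp k b.
Proof.
elim/O_ind: a => [|x m1 a IH]; first by rewrite !(mul0x, sgnp_zero).
rewrite !(mulDl, mulZl, sgnpD, sgnpZ) {}IH; congr (_ *: _ + _).
elim/O_ind: b => [|y m2 b IH]; first by rewrite !(mulx0, sgnp_zero).
rewrite !(mulDr, mulZr, sgnpD, sgnpZ) {}IH; congr (_ *: _ + _).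
rewrite /bmon !sgnp_mon mulZl mulZr !mul_mon.
case: ifP => d; last by rewrite sgnp_zero !scaler0.
rewrite sgnpZ sgnp_mon !scalerA; congr (_ *: _).
by rewrite card_setU // mulnDr exprD; ring.
Qed.

(** Homogeneity as an eigenvector equation, which is convenient for rewriting; by [parP] it means
    being supported in parity [e] once 2 is invertible. *)
Definition par (e : bool) a := sgnp 1 a = (-1) ^+ e *: a.

Lemma parE e a k : par e a -> sgnp k a = (-1) ^+ (k * e) *: a.
Proof.
move=> h; elim: k => [|k IH]; first by rewrite sgnp0 mul0n expr0 scale1r.
by rewrite -add1n -sgnp_sgnp IH sgnpZ h scalerA mulnDl mul1n addnC exprD mulrC.
Qed.

Lemma par_opart e a : par e (opart e a).
Proof.
apply/ffunP=> m; rewrite !ffunE [_ *: _]/GRing.scale /= mul1n.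
by case: eqP => [<-|_]; rewrite ?mulr0 // signr_odd.
Qed.

Lemma opartE a : a = opart false a + opart true a.
Proof. by apply/ffunP=> m; rewrite !ffunE; case: odd; rewrite ?add0r ?addr0. Qed.

Hypothesis two0 : 2%:R != 0 :> F.

Lemma par_coef e a m : par e a -> odd #|m.2| != e -> a m = 0.
Proof.
move=> /ffunP/(_ m); rewrite sgnpE mul1n ffunE -signr_odd [_ *: _]/GRing.scale /=.
move=> h he; have {h} : (-1) ^+ (~~ e) * a m = (-1) ^+ e * a m :> F.
  by rewrite -h; move: he; case: odd; case: (e).
case: (e) => /=; rewrite !expr0 !expr1 !mulN1r !mul1r.
  by move=> /eqP; rewrite eq_sym eqr_oppLR -subr_eq0 opprK -mulr2n -mulr_natl mulf_eq0 (negPf two0) => /eqP.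
by move=> /eqP; rewrite eqr_oppLR -subr_eq0 opprK -mulr2n -mulr_natl mulf_eq0 (negPf two0) => /eqP.
Qed.

Lemma parP e a : par e a <-> opart e a = a.
Proof.
split=> [h|<-]; last exact: par_opart.
apply/ffunP=> m; rewrite ffunE; case: ifP => // /negbT he.
by rewrite (par_coef h he).
Qed.

Lemma opart_par e d a : par e a -> opart d a = if d == e then a else 0.
Proof.
move=> h; case: eqVneq => [->|de]; first exact/parP.
apply/ffunP=> m; rewrite !ffunE; case: eqP => // hd.
by rewrite (par_coef h) // hd.
Qed.

(** The sign is carried by [sgnp e f], so that [f] need not be homogeneous. On monomials it comes
    from [inversions_sym]. *)
Lemma supercomm e a f : par e a -> a ** f = sgnp e f ** a.
Proof.
move=> h; elim/O_ind: f => [|x m f IH]; first by rewrite sgnp_zero mul0x mulx0.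
rewrite mulDr mulZr sgnpD sgnpZ mulDl mulZl {}IH; congr (_ *: _ + _).
rewrite (O_expand a) mul_suml mul_sumr; apply: eq_bigr => k _.
rewrite mulZl mulZr; have [ke|/(par_coef h) ->] := eqVneq (odd #|k.2|) e; last by rewrite !scale0r.
congr (_ *: _); rewrite /bmon sgnp_mon mulZl !mul_mon disjoint_sym.
case: ifP => d; last by rewrite scaler0.
rewrite scalerA.
rewrite (@eq_mon _ _ _ _ (fun i => k.1 i + m.1 i)%N (fun i => m.1 i + k.1 i)%N) => [|i]; last exact: addnC.
rewrite setUC; congr (_ *: _); rewrite mulrA; congr (_ * _%:R).
  rewrite -[in RHS]signr_odd -ke oddM oddb -oddM signr_odd.
  rewrite mulnC -(inversions_sym d) exprD mulrAC -expr2 sqrr_sign mul1r //.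
by apply: eq_bigr => i _; rewrite addnC -[LHS]bin_sub ?leq_addl // addnK.
Qed.

End Parity.

(** * Partial derivatives and their Leibniz rules *)

Section Derivations.
Variables (F : fieldType) (p n : nat) (t : 'I_n -> nat).
Hypothesis charFp : p \in [pchar F].
Local Notation basis := (basis p t).
Local Notation O := {ffun basis -> F^o}.
Local Notation "a ** b" := (@mul F p n t a b) (at level 40, left associativity).
Local Notation mn := (mon F p t).
Implicit Types (a b c f g : O) (m : basis).

HB.instance Definition _ r := GRing.isLinear.Build F O O _
  (@epartial F p n t r) (epartial_linear r).

Lemma epartialD r a b : epartial r (a + b) = epartial r a + epartial r b.
Proof. exact: linearD. Qed.
Lemma epartialZ r x a : epartial r (x *: a) = x *: epartial r a.
Proof. exact: linearZ. Qed.
Lemma epartial0 r : epartial r (0 : O) = 0.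
Proof. exact: linear0. Qed.
Lemma opartialD r a b : opartial r (a + b) = opartial r a + opartial r b.
Proof. exact: linearD. Qed.
Lemma opartialZ r x a : opartial r (x *: a) = x *: opartial r a.
Proof. exact: linearZ. Qed.
Lemma opartial0 r : opartial r (0 : O) = 0.
Proof. exact: linear0. Qed.

(** Since e C(p^k, e) = p^k C(p^k - 1, e - 1), a binomial coefficient prime to p would force p^k to
    divide e. *)
Lemma bin_pchar k e : (0 < e < p ^ k)%N -> 'C(p ^ k, e)%:R = 0 :> F.
Proof.
have pp := pcharf_prime charFp; case: e => // e /= he.
apply/eqP; rewrite -(dvdn_pcharf charFp); apply: contraLR (he) => pC.
have : (p ^ k %| e.+1 * 'C(p ^ k, e.+1))%N.
  by rewrite -mul_bin_diag dvdn_mulr ?dvdnn.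
rewrite Gauss_dvdl; first by rewrite -leqNgt => /dvdn_leq; apply.
by rewrite coprimeXl // prime_coprime.
Qed.

(** Pascal's rule and [bin_pchar]. Hence complementary powers of x_j multiply to the top power up to
    a sign, never to 0. *)
Lemma bin_pred_pchar k e : (e < p ^ k)%N -> 'C((p ^ k).-1, e)%:R = (-1) ^+ e :> F.
Proof.
have pk : (0 < p ^ k)%N by rewrite expn_gt0 prime_gt0 // (pcharf_prime charFp).
elim: e => [|e IH] he; first by rewrite bin0.
have := bin_pchar (k := k) (e := e.+1); rewrite he => /(_ isT).
rewrite -{1}(prednK pk) binS natrD IH 1?ltnW // exprS mulN1r => /eqP.
by rewrite addr_eq0 => /eqP.
Qed.

Lemma sgnp_epartial k r a : sgnp k (epartial r a) = epartial r (sgnp k a).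
Proof.
elim/O_ind: a => [|x m a IH]; first by rewrite epartial0 !sgnp_zero epartial0.
rewrite !(sgnpD, sgnpZ, epartialD, epartialZ) {}IH; congr (_ *: _ + _).
rewrite /bmon sgnp_mon epartialZ epartial_mon ?in_range_basis //.
by case: ifP => _; rewrite ?sgnp_mon ?sgnp_zero ?scaler0.
Qed.

Lemma sgnp_opartial k j a : sgnp k (opartial j a) = (-1) ^+ k *: opartial j (sgnp k a).
Proof.
elim/O_ind: a => [|x m a IH]; first by rewrite opartial0 !sgnp_zero opartial0 scaler0.
rewrite !(sgnpD, sgnpZ, opartialD, opartialZ) {}IH scalerDr [in RHS]scalerA mulrC -scalerA.
congr (_ *: _ + _).
rewrite /bmon sgnp_mon opartialZ opartial_mon.
case: ifP => jm; last by rewrite sgnp_zero !scaler0.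
rewrite sgnpZ sgnp_mon !scalerA; congr (_ *: _).
rewrite (cardsD1 j m.2) jm add1n mulnS !exprD.
rewrite !mulrA -expr2 sqrr_sign mul1r mulrC //.
Qed.

(** On monomials there are four cases, according to whether x_j occurs in [u] and in [v]. Writing
    these as [j |: u'] and [j |: v'] reduces the signs to additivity of [inversions]; if x_j occurs
    in both, the product is 0 and the two terms on the right cancel. *)
Lemma opartial_mul j a b :
  opartial j (a ** b) = opartial j a ** b + sgnp 1 a ** opartial j b.
Proof.
elim/O_ind: a => [|x m1 a IH]; first by rewrite sgnp_zero opartial0 !mul0x opartial0 addr0.
rewrite !(mulDl, mulZl, sgnpD, sgnpZ, opartialD, opartialZ) {}IH [RHS]addrACA -scalerDr.
congr (_ *: _ + _).
elim/O_ind: b => [|x2 m2 b IH]; first by rewrite opartial0 !mulx0 opartial0 addr0.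
rewrite !(mulDr, mulZr, opartialD, opartialZ) {}IH [RHS]addrACA -scalerDr.
congr (_ *: _ + _); move: m1 m2 => [al u] [be v]; rewrite /bmon /=.
rewrite !sgnp_mon !opartial_mon mul1n mulZl -!inversions1l.
have sq k : ((-1) ^+ k * (-1) ^+ k = 1 :> F) by rewrite -expr2 sqrr_sign.
have i11 (w : {set 'I_n.+1}) : inversions [set j] (j |: w) = inversions [set j] w.
  rewrite !inversions1l; apply: eq_card => k; rewrite !inE.
  by case: eqVneq => // ->; rewrite ltnn !andbF.
have isym (w : {set 'I_n.+1}) : j \notin w ->
    (inversions [set j] w + inversions w [set j] = #|w|)%N.
  by move=> jw; rewrite inversions_sym ?disjoints1 // cards1 mul1n.
have dju (w : {set 'I_n.+1}) : j \notin w -> [disjoint [set j] & w].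
  by rewrite disjoints1.
have djv (w : {set 'I_n.+1}) : j \notin w -> [disjoint w & [set j]].
  by rewrite disjoint_sym disjoints1.
case: (boolP (j \in u)) => ju; case: (boolP (j \in v)) => jv.
- have := setD1K ju; have := setD1K jv.
  have : j \notin u :\ j by rewrite setD11.
  have : j \notin v :\ j by rewrite setD11.
  move: (u :\ j) (v :\ j) => u' v' jv' ju' <- <-.
  rewrite mulZl mulZr !mul_mon !disjointUl !disjointUr !disjoints1 !inE eqxx /= opartial0.
  rewrite djv // jv' /=; case: ifP => d; last by rewrite !scaler0 addr0.
  rewrite setUA [u' :|: [set j]]setUC !scalerA -scalerDl; apply/esym.
  rewrite !i11 inversionsUr ?dju // inversionsUl ?dju // !exprD.
  rewrite cardsU1 ju' exprD -(isym u') // exprD expr1.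
  rewrite [X in X *: _](_ : _ = 0) ?scale0r //.
  by ring: (sq (inversions [set j] v')).
- have := setD1K ju.
  have : j \notin u :\ j by rewrite setD11.
  move: (u :\ j) => u' ju' <-.
  rewrite mulZl mulx0 scaler0 addr0 !mul_mon !disjointUl disjoints1 jv /=.
  case: ifP => d; last by rewrite opartial0 scaler0.
  rewrite opartialZ opartial_mon !inE eqxx /= -inversions1l.
  rewrite -setUA setU1K ?inE ?negb_or ?ju' // !scalerA; congr (_ *: _).
  rewrite i11 inversionsUr // inversionsUl ?dju // i11 !exprD.
  by ring: (sq (inversions [set j] v)).
- have := setD1K jv.
  have : j \notin v :\ j by rewrite setD11.
  move: (v :\ j) => v' jv' <-.
  rewrite mul0x add0r mulZr !mul_mon !disjointUr djv //=.
  case: ifP => d; last by rewrite opartial0 !scaler0.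
  rewrite opartialZ opartial_mon !inE eqxx orbT /= -inversions1l.
  rewrite setUCA setU1K ?inE ?negb_or ?ju // !scalerA; congr (_ *: _).
  rewrite !i11 inversionsUr // inversionsUr ?dju // -(isym u) // !exprD.
  by ring: (sq (inversions u [set j])).
rewrite mul0x mulx0 scaler0 addr0 mul_mon; case: ifP => d; last by rewrite opartial0.
by rewrite opartialZ opartial_mon inE (negPf ju) (negPf jv) scaler0.
Qed.

Lemma opartialC i j a : opartial i (opartial j a) = - opartial j (opartial i a).
Proof.
elim/O_ind: a => [|x m a IH]; first by rewrite !opartial0 oppr0.
rewrite !(opartialD, opartialZ) {}IH opprD -scalerN; congr (_ *: _ + _).
rewrite /bmon !opartial_mon; have [<-|ij] := eqVneq i j.
  by case: ifP => _; rewrite ?opartialZ ?opartial0 ?opartial_mon ?setD11 ?scaler0; apply/esym/oppr0.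
wlog ltij : i j ij / (i < j)%N.
  move=> hw; have := ij; rewrite neq_ltn => /orP[] ltij; first exact: hw.
  by rewrite (hw j i) ?opprK // eq_sym.
case: ifP => jm; case: ifP => im; rewrite ?opartialZ ?opartial0 ?opartial_mon ?in_setD1 ?im ?jm ?andbF ?scaler0 ?oppr0 //.
rewrite ij eq_sym ij /= !scalerA -scaleNr setDDl setUC -setDDl; congr (_ *: _).
(* Removing the smaller index i shifts the position of j by one, while removing j leaves the
   position of i unchanged: this is the single sign. *)
have -> : #|[set k in m.2 | (k < j)%N]| = #|[set k in m.2 :\ i | (k < j)%N]|.+1.
  rewrite (cardsD1 i) inE im ltij add1n; congr _.+1; apply: eq_card => k.
  rewrite !inE. by rewrite andbA.
have -> : #|[set k in m.2 :\ j | (k < i)%N]| = #|[set k in m.2 | (k < i)%N]|.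
  apply: eq_card => k; rewrite !inE; case: eqVneq => [->|_] //=.
  by rewrite ltnNge (ltnW ltij) andbF.
by rewrite exprS; ring.
Qed.

Lemma epartial_opartial r j a : epartial r (opartial j a) = opartial j (epartial r a).
Proof.
elim/O_ind: a => [|x m a IH]; first by rewrite !(epartial0, opartial0).
rewrite !(epartialD, opartialD, epartialZ, opartialZ) {}IH; congr (_ *: _ + _).
rewrite /bmon opartial_mon epartial_mon ?in_range_basis //.
case: ifP => jm; case: ifP => im; rewrite ?epartialZ ?epartial0 ?opartial0 ?opartial_mon ?jm ?epartial_mon ?im ?in_range_basis ?scaler0 //.
Qed.

Lemma in_range_sub r al : in_range p t al -> in_range p t (fun i => al i - (i == r))%N.
Proof.
by move=> /forallP h; apply/forallP=> i; apply: leq_ltn_trans (leq_subr _ _) (h i).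
Qed.

Lemma epartialC r s a : epartial r (epartial s a) = epartial s (epartial r a).
Proof.
elim/O_ind: a => [|x m a IH]; first by rewrite !epartial0.
rewrite !(epartialD, epartialZ) {}IH; congr (_ *: _ + _).
have [->//|rs] := eqVneq r s.
rewrite /bmon !epartial_mon ?in_range_basis //.
have h k := in_range_sub k (in_range_basis m).
case: ifP => jm; case: ifP => im; rewrite ?epartial0 ?epartial_mon ?h ?jm ?im //= ?(negPf rs) ?[s == r]eq_sym ?(negPf rs) ?subn0 ?im ?jm //.
by apply: eq_mon => i; rewrite subnAC.
Qed.

Lemma epartial_mul r a b :
  epartial r (a ** b) = epartial r a ** b + a ** epartial r b.
Proof.
elim/O_ind: a => [|x m1 a IH]; first by rewrite epartial0 !mul0x epartial0 addr0.
rewrite !(mulDl, mulZl, epartialD, epartialZ) {}IH [RHS]addrACA -scalerDr.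
congr (_ *: _ + _).
elim/O_ind: b => [|x2 m2 b IH]; first by rewrite epartial0 !mulx0 epartial0 addr0.
rewrite !(mulDr, mulZr, epartialD, epartialZ) {}IH [RHS]addrACA -scalerDr.
congr (_ *: _ + _); rewrite mul_mon.
have [r1 r2] := (in_range_basis m1, in_range_basis m2).
move: m1 m2 r1 r2 => [al u] [be v]; rewrite /bmon /= => r1 r2.
rewrite !epartial_mon //.
have [d|d] := boolP [disjoint u & v]; last first.
  by rewrite epartial0; case: ifP => _; case: ifP => _;
    rewrite ?mul_mon ?(negPf d) ?mul0x ?mulx0 addr0.
set g := fun i => (al i + be i - (i == r))%N.
set s := (-1) ^+ inversions u v; set P := (\prod_(i | i != r) 'C(al i + be i, al i))%N.
rewrite (bigD1 r) //= -/P epartialZ.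
have e1 : (if (0 < al r)%N then mn (fun i => al i - (i == r))%N u else 0) ** mn (fun i => be i) v
    = (s * (('C((al r).-1 + be r, (al r).-1) * (0 < al r) * P)%N)%:R) *: mn g (u :|: v).
  case: ifP => a0; last by rewrite mul0x muln0 mul0n mulr0 scale0r.
  rewrite mul_mon d muln1 (bigD1 r) //= eqxx subn1.
  rewrite (eq_bigr (fun i => 'C(al i + be i, al i))) => [|i /negPf ir]; last by rewrite ir subn0.
  congr (_ *: _); apply: eq_mon => i; rewrite /g; case: eqP => [->|_]; last by rewrite !subn0.
  by rewrite addnBAC.
have e2 : mn (fun i => al i) u ** (if (0 < be r)%N then mn (fun i => be i - (i == r))%N v else 0)
    = (s * (('C(al r + (be r).-1, al r) * (0 < be r) * P)%N)%:R) *: mn g (u :|: v).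
  case: ifP => a0; last by rewrite mulx0 muln0 mul0n mulr0 scale0r.
  rewrite mul_mon d muln1 (bigD1 r) //= eqxx subn1.
  rewrite (eq_bigr (fun i => 'C(al i + be i, al i))) => [|i /negPf ir]; last by rewrite ir subn0.
  congr (_ *: _); apply: eq_mon => i; rewrite /g; case: eqP => [->|_]; last by rewrite !subn0.
  by rewrite addnBA.
rewrite e1 e2 -scalerDl -mulrDr -natrD -mulnDl.
have [gr|gr] := boolP (in_range p t g); last first.
  rewrite (@mon_out _ _ _ _ g) // scaler0 (@mon_out _ _ _ _ (fun i => al i + be i)%N) ?epartial0 ?scaler0 //.
  apply: contra gr => gr; exact: in_range_sub gr.
have [ab0|ab0] := posnP (al r + be r)%N.
  move/eqP: ab0; rewrite addn_eq0 => /andP[/eqP a0 /eqP b0].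
  rewrite a0 b0 /= muln0 mul0n mulr0 scale0r.
  have [h|h] := boolP (in_range p t (fun i => al i + be i)%N).
    by rewrite epartial_mon // a0 b0 scaler0.
  by rewrite mon_out // epartial0 scaler0.
have pascal : 'C(al r + be r, al r) = ('C((al r).-1 + be r, (al r).-1) * (0 < al r) +
                  'C(al r + (be r).-1, al r) * (0 < be r))%N.
  case: (nat_of_ord (al r)) (nat_of_ord (be r)) ab0 => [|a'] [|b'] //= _; rewrite ?addn0 ?muln1 ?muln0 ?bin0 ?binn //.
  by rewrite addSn addnS binS addSn addnC.
have [lt|ge] := ltnP (al r + be r) (p ^ t r).
  have h : in_range p t (fun i => al i + be i)%N.
    apply/forallP=> i; have [->//|ir] := eqVneq i r.
    by move/forallP: gr => /(_ i); rewrite /g (negPf ir) subn0.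
  by rewrite epartial_mon // ab0 pascal.
(* The boundary case: the product is already truncated to 0, but both terms of the Leibniz rule may
   survive. Their coefficients add up to C(p^(t r), al r), which is 0 in F. *)
have abN : (al r + be r = p ^ t r)%N.
  apply/eqP; rewrite eqn_leq ge andbT.
  by move/forallP: gr => /(_ r); rewrite /g eqxx subn1 -ltnS prednK.
rewrite (@mon_out _ _ _ _ (fun i => al i + be i)%N) ?epartial0 ?scaler0; last first.
  by apply/forallPn; exists r; rewrite -leqNgt.
rewrite -pascal natrM abN bin_pchar ?mul0r ?mulr0 ?scale0r //.
move/forallP: r2 => /(_ r); move/forallP: r1 => /(_ r); move: abN.
move: (p ^ t r)%N (nat_of_ord (al r)) (nat_of_ord (be r)) => N y z /= <-.
by lia.
Qed.

End Derivations.

Section OddIndex.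
Variable n : nat.

Lemma odd_of_inj : injective (@odd_of n).
Proof. by move=> i j /(congr1 val) /= h; apply: val_inj. Qed.

Lemma odd_of_neq_max (j : 'I_n) : odd_of j != ord_max.
Proof. by rewrite -val_eqE /= neq_ltn ltn_ord. Qed.

Lemma odd_of_surj (i : 'I_n.+1) : i != ord_max -> exists j, i = odd_of j.
Proof.
rewrite -val_eqE /= => h; have hi : (i < n)%N by rewrite ltn_neqAle h -ltnS ltn_ord.
by exists (Ordinal hi); apply: val_inj.
Qed.

Lemma card_odd_of (u : {set 'I_n.+1}) :
  #|u :\ ord_max| = (\sum_j (odd_of j \in u))%N.
Proof.
rewrite -[RHS]big_mkcond /= sum1_card -(card_image odd_of_inj).
apply: eq_card => i; rewrite !inE; apply/andP/imageP => [[im iu]|[j ju ->]].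
  by have [j ij] := odd_of_surj im; exists j; rewrite // unfold_in -ij.
by rewrite odd_of_neq_max.
Qed.

End OddIndex.

(** * The degree operator D *)

Section Euler.
Variables (F : fieldType) (p n : nat) (t : 'I_n -> nat).
Hypothesis charFp : p \in [pchar F].
Hypothesis two0 : 2%:R != 0 :> F.
Local Notation basis := (basis p t).
Local Notation O := {ffun basis -> F^o}.
Local Notation "a ** b" := (@mul F p n t a b) (at level 40, left associativity).
Local Notation mn := (mon F p t).
Local Notation "'d_ j" := (epartial j) (at level 10, j at level 8, format "''d_' j").
Local Notation "'x_ j" := (opartial (odd_of j)) (at level 10, j at level 8, format "''x_' j").
Local Notation dl := (@dlast F p n t).
Implicit Types (a b c f g : O) (m : basis).

(** The eigenvalue of D on a monomial. The index [ord_max] is dropped since D involves the first 2n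
    variables only, so that tau has degree 0. *)
Definition deg (al : 'I_n -> nat) (u : {set 'I_n.+1}) : nat :=
  (\sum_i al i + #|u :\ ord_max|)%N.

Lemma euler_mon al u : euler (mn al u) = (deg al u)%:R *: mn al u.
Proof.
have [h|h] := boolP (in_range p t al); last by rewrite !mon_out // linear0 scaler0.
rewrite /euler big_sumType /= natrD !natr_sum scalerDl !scaler_suml.
congr (_ + _).
  apply: eq_bigr => j _; rewrite epartial_mon //; case: ifP => aj; last first.
    by rewrite mulx0; move/negbT: aj; rewrite -eqn0Ngt => /eqP ->; rewrite scale0r.
  rewrite mul_mon -setI_eq0 set0I eqxx /inversions big_set0 expr0 mul1r set0U.
  rewrite (bigD1 j) //= big1 /eps ?muln1 ?eqxx => [|i /negPf ->]; last by rewrite bin0.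
  rewrite subn1 add1n prednK // bin1; congr (_ *: _); apply: eq_mon => i.
  by case: eqP => [->|_]; rewrite ?subn0 // subn1 add1n prednK.
rewrite card_odd_of natr_sum scaler_suml; apply: eq_bigr => j _.
rewrite opartial_mon; case: ifP => ju; last by rewrite mulx0 scale0r.
rewrite mulZr mul_mon disjoints1 setD11 /= setD1K // inversions1l.
rewrite big1 ?mulr1 => [|i _]; last by rewrite bin0.
rewrite scalerA; rewrite [X in _ * X](_ : _ = (-1) ^+ #|[set k in u | (k < odd_of j)%N]|).
  by rewrite -expr2 sqrr_sign; congr (_ *: _); apply: eq_mon.
congr (_ ^+ _); apply: eq_card => k; rewrite !inE.
by case: eqVneq => // ->; rewrite ltnn !andbF.
Qed.

Lemma eulerD a b : euler (a + b) = euler a + euler b.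
Proof. exact: linearD. Qed.
Lemma eulerZ x a : euler (x *: a) = x *: euler a.
Proof. exact: linearZ. Qed.
Lemma euler0 : euler (0 : O) = 0.
Proof. exact: linear0. Qed.

Lemma sgnp_euler k a : sgnp k (euler a) = euler (sgnp k a).
Proof.
elim/O_ind: a => [|x m a IH]; first by rewrite !(sgnp_zero, euler0).
rewrite !(eulerD, sgnpD, eulerZ, sgnpZ) IH; congr (_ *: _ + _).
by rewrite /bmon sgnp_mon eulerZ euler_mon sgnpZ sgnp_mon !scalerA mulrC.
Qed.

Lemma euler_mul a b : euler (a ** b) = euler a ** b + a ** euler b.
Proof.
elim/O_ind: a => [|x m1 a IH]; first by rewrite !(mul0x, euler0) addr0.
rewrite !(mulDl, mulZl, eulerD, eulerZ) {}IH [RHS]addrACA -scalerDr.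
congr (_ *: _ + _).
elim/O_ind: b => [|x2 m2 b IH]; first by rewrite euler0 !mulx0 euler0 addr0.
rewrite !(mulDr, mulZr, eulerD, eulerZ) {}IH [RHS]addrACA -scalerDr.
congr (_ *: _ + _); rewrite /bmon !euler_mon mulZl mulZr mul_mon.
case: ifP => d; last by rewrite euler0 !scaler0 addr0.
rewrite eulerZ euler_mon -scalerDl !scalerA -natrD mulrC; congr (_%:R * _ *: _).
rewrite /deg setDUl card_setU; last first.
  by rewrite -setI_eq0 -subset0; apply: subset_trans (setISS (subsetDl _ _) (subsetDl _ _)) _; rewrite subset0 setI_eq0.
by rewrite big_split /= addnACA.
Qed.

Lemma epartial_euler r a : 'd_r (euler a) = euler ('d_r a) + 'd_r a.
Proof.
elim/O_ind: a => [|x m a IH]; first by rewrite !(epartial0, euler0) addr0.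
rewrite !(eulerD, epartialD, eulerZ, epartialZ) {}IH [RHS]addrACA -scalerDr.
congr (_ *: _ + _); rewrite /bmon euler_mon epartialZ epartial_mon ?in_range_basis //.
case: ifP => m0; last by rewrite scaler0 euler0 addr0.
rewrite euler_mon -[X in _ + X]scale1r -scalerDl natr1; congr (_%:R *: _); rewrite /deg -addSn; congr (_ + _)%N.
rewrite (bigD1 r) //= [in RHS](bigD1 r) //= eqxx -addSn subn1 prednK //; congr (_ + _)%N.
by apply: eq_bigr => i /negPf ->; rewrite subn0.
Qed.

Lemma opartial_euler j a : 'x_j (euler a) = euler ('x_j a) + 'x_j a.
Proof.
elim/O_ind: a => [|x m a IH]; first by rewrite !(opartial0, euler0) addr0.
rewrite !(eulerD, opartialD, eulerZ, opartialZ) {}IH [RHS]addrACA -scalerDr.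
congr (_ *: _ + _); rewrite /bmon euler_mon opartialZ opartial_mon.
case: ifP => m0; last by rewrite scaler0 euler0 addr0.
rewrite eulerZ euler_mon -scalerDr -[X in _ + X]scale1r -scalerDl natr1 !scalerA mulrC.
congr (_ * _%:R *: _).
by rewrite /deg -addnS [in LHS](cardsD1 (odd_of j)) !inE odd_of_neq_max m0 add1n setDDl setUC -setDDl.
Qed.

Lemma dlast_euler a : dl (euler a) = euler (dl a).
Proof.
elim/O_ind: a => [|x m a IH]; first by rewrite /dlast !(opartial0, euler0).
rewrite /dlast in IH *; rewrite !(eulerD, opartialD, eulerZ, opartialZ) {}IH.
congr (_ *: _ + _); rewrite /bmon euler_mon opartialZ opartial_mon.
case: ifP => m0; last by rewrite scaler0 euler0.
rewrite eulerZ euler_mon !scalerA mulrC; congr (_ * _%:R *: _).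
congr (_ + _)%N; apply: eq_card => k; rewrite !inE; case: eqP => //.
Qed.

End Euler.

(** * The contact bracket as a BV bracket *)

Section Contact.
Variables (F : fieldType) (p n : nat) (t : 'I_n -> nat).
Hypothesis charFp : p \in [pchar F].
Hypothesis two0 : 2%:R != 0 :> F.
Local Notation basis := (basis p t).
Local Notation O := {ffun basis -> F^o}.
Local Notation "a ** b" := (@mul F p n t a b) (at level 40, left associativity).
Local Notation "'d_ j" := (epartial j) (at level 10, j at level 8, format "''d_' j").
Local Notation "'x_ j" := (opartial (odd_of j)) (at level 10, j at level 8, format "''x_' j").
Local Notation dl := (@dlast F p n t).
Local Notation sg := (@sgnp F p n t 1).
Local Notation lap := (@laplace F p n t).
Implicit Types (a b c f g h : O) (m : basis) (u v w x : F).

Lemma self_opp0 a : a = - a -> a = 0.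
Proof.
move=> h; have: 2%:R *: a = 0 by rewrite scaler_nat mulr2n {2}h subrr.
by move/eqP; rewrite scaler_eq0 (negPf two0) => /eqP.
Qed.

Lemma dlastD a b : dl (a + b) = dl a + dl b. Proof. exact: linearD. Qed.
Lemma dlastN a : dl (- a) = - dl a. Proof. exact: linearN. Qed.
Lemma dlastB a b : dl (a - b) = dl a - dl b. Proof. exact: linearB. Qed.
Lemma dlastZ x a : dl (x *: a) = x *: dl a. Proof. exact: linearZ. Qed.
Lemma laplaceD a b : lap (a + b) = lap a + lap b. Proof. exact: linearD. Qed.
Lemma laplaceN a : lap (- a) = - lap a. Proof. exact: linearN. Qed.
Lemma laplaceZ x a : lap (x *: a) = x *: lap a. Proof. exact: linearZ. Qed.
Lemma laplace0 : lap 0 = 0. Proof. exact: linear0. Qed.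
Lemma eulerN a : euler (- a) = - euler a. Proof. exact: linearN. Qed.
Lemma opartial_sum j I (r : seq I) (P : pred I) (f : I -> O) :
  opartial j (\sum_(i <- r | P i) f i) = \sum_(i <- r | P i) opartial j (f i).
Proof. exact: linear_sum. Qed.
Lemma epartial_sum j I (r : seq I) (P : pred I) (f : I -> O) :
  epartial j (\sum_(i <- r | P i) f i) = \sum_(i <- r | P i) epartial j (f i).
Proof. exact: linear_sum. Qed.

Lemma laplaceE a : lap a = \sum_j 'd_j ('x_j a). Proof. by []. Qed.

Lemma dlast_dlast a : dl (dl a) = 0.
Proof. by apply: self_opp0; exact: opartialC. Qed.

Lemma dlast_mul a b : dl (a ** b) = dl a ** b + sg a ** dl b.
Proof. exact: opartial_mul. Qed.

Lemma sgnp_dlast k a : sgnp k (dl a) = (-1) ^+ k *: dl (sgnp k a).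
Proof. exact: sgnp_opartial. Qed.

Lemma sgnp_laplace k a : sgnp k (lap a) = (-1) ^+ k *: lap (sgnp k a).
Proof.
rewrite !laplaceE scaler_sumr linear_sum; apply: eq_bigr => j _ /=.
by rewrite sgnp_epartial sgnp_opartial epartialZ.
Qed.

Lemma laplace_dlast a : lap (dl a) = - dl (lap a).
Proof.
rewrite !laplaceE [X in - X]linear_sum -sumrN; apply: eq_bigr => j _ /=.
by rewrite /dlast opartialC -epartial_opartial -!scaleN1r epartialZ.
Qed.

(** Even derivatives commute and odd ones anticommute, so exchanging the two summation indices
    negates the double sum. *)
Lemma laplace_laplace a : lap (lap a) = 0.
Proof.
have e : lap (lap a) = \sum_i \sum_j 'd_i ('d_j ('x_i ('x_j a))).
  rewrite [LHS]laplaceE; apply: eq_bigr => i _.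
  rewrite laplaceE opartial_sum epartial_sum; apply: eq_bigr => j _ /=.
  by rewrite -[in LHS]epartial_opartial.
apply: self_opp0; rewrite e -sumrN [LHS]exchange_big; apply: eq_bigr => i _ /=.
rewrite -sumrN; apply: eq_bigr => j _.
by rewrite epartialC opartialC -!scaleN1r !epartialZ.
Qed.

Lemma laplace_euler a : lap (euler a) = euler (lap a) + lap a *+ 2.
Proof.
rewrite !laplaceE linear_sum -sumrMnl -big_split; apply: eq_bigr => j _ /=.
by rewrite opartial_euler // epartialD epartial_euler // -addrA -mulr2n.
Qed.

(* Del and brk are locked to keep unification from unfolding them in search of
   sums. *)
Fact lock_key : unit. Proof. exact: tt. Qed.

(* div_lambda with n lambda replaced by a free weight w, up to sign and the
   factor 2: the proof rests on Del w (Del (w + 2) a) = 0. *)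
Definition Del : F -> O -> O := locked_with lock_key
  (fun w a => lap a + euler (dl a) + (- w) *: dl a).

Lemma DelE w a : Del w a = lap a + euler (dl a) + (- w) *: dl a.
Proof. by rewrite /Del unlock. Qed.

Lemma DelD w a b : Del w (a + b) = Del w a + Del w b.
Proof.
rewrite !DelE laplaceD !dlastD eulerD scalerDr.
by apply/ffunP=> m; rewrite !ffunE; ring.
Qed.
Lemma DelZ w x a : Del w (x *: a) = x *: Del w a.
Proof.
rewrite !DelE laplaceZ !dlastZ eulerZ.
by apply/ffunP=> m; rewrite !ffunE /GRing.scale /=; ring.
Qed.
Lemma DelN w a : Del w (- a) = - Del w a.
Proof. by rewrite -scaleN1r DelZ scaleN1r. Qed.
Lemma DelB w a b : Del w (a - b) = Del w a - Del w b.
Proof. by rewrite DelD DelN. Qed.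
Lemma Del0 w : Del w 0 = 0.
Proof. by have := DelZ w 0 0; rewrite !scale0r. Qed.

Lemma sgnp_Del w a : sg (Del w a) = - Del w (sg a).
Proof.
rewrite !DelE !(sgnpD, sgnpN, sgnpZ) sgnp_laplace sgnp_euler !sgnp_dlast expr1 !scaleN1r.
rewrite eulerN; by apply/ffunP=> m; rewrite !ffunE /GRing.scale /=; ring.
Qed.

(** The Laplacian lowers the degree by 2, so lap D = D lap + 2 lap; as it anticommutes with d_tau,
    the cross terms cancel exactly for a shift of the weight by 2. *)
Lemma Del_Del w a : Del w (Del (w + 2%:R) a) = 0.
Proof.
rewrite !DelE !(laplaceD, laplaceN, laplaceZ, dlastD, dlastN, dlastZ).
rewrite laplace_laplace laplace_euler !(dlast_euler, dlast_dlast, laplace_dlast).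
rewrite !(eulerD, eulerN, eulerZ, euler0).
by apply/ffunP=> m; rewrite !ffunE /GRing.scale /=; ring.
Qed.

(** [DKO a g] without its term - 2 a d_tau(g): the part of the bracket that sees no weight. *)
Definition ham a g : O :=
  \sum_j ('x_j (sg a) ** 'd_j g + 'd_j a ** 'x_j g) + dl (sg a) ** euler g + euler a ** dl g.

(* The BV bracket of an element of weight u with one of weight w, see brkE;
   brk 2 0 a is DKO a, and brk 2 2 is the bracket of KO(n, n+1) on functions. *)
Definition brk : F -> F -> O -> O -> O := locked_with lock_key
  (fun u w a g => ham a g + (- u) *: (a ** dl g) + (- w) *: (dl (sg a) ** g)).

Lemma brk_ham u w a g :
  brk u w a g = ham a g + (- u) *: (a ** dl g) + (- w) *: (dl (sg a) ** g).
Proof. by rewrite /brk unlock. Qed.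

(** The Laplacian is a second-order operator; the middle sum, its failure to be a derivation, is the
    Buttin (odd Poisson) bracket. *)
Lemma laplace_mul a g : lap (sg a ** g) =
  lap (sg a) ** g + \sum_j ('x_j (sg a) ** 'd_j g + 'd_j a ** 'x_j g) + a ** lap g.
Proof.
rewrite !laplaceE mul_suml mul_sumr -!big_split /=; apply: eq_bigr => j _.
rewrite opartial_mul sgnpK epartialD !epartial_mul //.
by rewrite -!addrA.
Qed.

(** The weights add because D is a derivation: D - (u + w) acts on a product as D - u on one factor
    plus D - w on the other. *)
Lemma brkE u w a g : brk u w a g =
  Del (u + w) (sg a ** g) - Del u (sg a) ** g - a ** Del w g.
Proof.
rewrite brk_ham /ham !DelE laplace_mul dlast_mul sgnpK eulerD !euler_mul.
rewrite !(mulBl, mulBr, mulDl, mulDr, mulZl, mulZr).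
set S := \sum_j _.
apply/ffunP=> m. by rewrite !ffunE /GRing.scale /=; ring.
Qed.

Lemma DKOE a g : DKO a g = brk 2%:R 0 a g.
Proof.
rewrite /DKO /TH !add_lfunE sum_lfunE brk_ham /ham big_sumType /= oppr0 scale0r addr0.
rewrite !comp_lfunE !lfunE /= mulBl -scaler_nat mulZl big_split /=.
rewrite scaleNr -!addrA; congr (_ + _).
  by apply: eq_bigr => j _; rewrite comp_lfunE !lfunE.
congr (_ + _).
by apply: eq_bigr => j _; rewrite comp_lfunE !lfunE /= sgnp0.
Qed.

End Contact.

(** * Leibniz rules and the Jacobi identity *)

Section Jacobi.
Variables (F : fieldType) (p n : nat) (t : 'I_n -> nat).
Hypothesis charFp : p \in [pchar F].
Hypothesis two0 : 2%:R != 0 :> F.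
Local Notation basis := (basis p t).
Local Notation O := {ffun basis -> F^o}.
Local Notation "a ** b" := (@mul F p n t a b) (at level 40, left associativity).
Local Notation "'d_ j" := (epartial j) (at level 10, j at level 8, format "''d_' j").
Local Notation "'x_ j" := (opartial (odd_of j)) (at level 10, j at level 8, format "''x_' j").
Local Notation dl := (@dlast F p n t).
Local Notation sg := (@sgnp F p n t 1).
Local Notation Del := (@Del F p n t).
Local Notation brk := (@brk F p n t).
Implicit Types (a b c f g h : O) (m : basis) (u v w x : F) (e : bool).

Lemma par_opartial e j a : par e a -> par (~~ e) (opartial j a).
Proof.
rewrite /par => h; rewrite sgnp_opartial h opartialZ scalerA expr1.
by case: e {h}; rewrite /= ?expr0 ?expr1 ?mulr1 // mulrNN mulr1.
Qed.
Lemma par_epartial e j a : par e a -> par e ('d_j a).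
Proof. by rewrite /par => h; rewrite sgnp_epartial h epartialZ. Qed.
Lemma par_euler e a : par e a -> par e (euler a).
Proof. by rewrite /par => h; rewrite sgnp_euler h eulerZ. Qed.
Lemma par_sgnp k e a : par e a -> par e (sgnp k a).
Proof. by rewrite /par => h; rewrite sgnp_sgnp addnC -sgnp_sgnp h sgnpZ. Qed.
Lemma parZ e x a : par e a -> par e (x *: a).
Proof. by rewrite /par => h; rewrite sgnpZ h !scalerA mulrC. Qed.
Lemma parD e a b : par e a -> par e b -> par e (a + b).
Proof. by rewrite /par => ha hb; rewrite sgnpD ha hb scalerDr. Qed.
Lemma parN e a : par e a -> par e (- a).
Proof. by rewrite -scaleN1r; exact: parZ. Qed.
Lemma par_Del e w a : par e a -> par (~~ e) (Del w a).
Proof.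
rewrite /par => h; rewrite sgnp_Del h DelZ -scaleNr; congr (_ *: _).
by case: e {h}; rewrite ?opprK.
Qed.
Lemma par_mul e e' a b : par e a -> par e' b -> par (e (+) e') (a ** b).
Proof.
rewrite /par => h h'; rewrite sgnp_mul h h' mulZl mulZr scalerA; congr (_ *: _).
by rewrite signr_addb.
Qed.
Lemma par_brk e e' u w a g : par e a -> par e' g -> par (~~ (e (+) e')) (brk u w a g).
Proof.
move=> ha hg; rewrite brkE //; apply: parD; first apply: parD.
- by apply: par_Del; apply: par_mul => //; apply: par_sgnp.
- apply: parN; rewrite -addNb; apply: par_mul => //.
  by apply: par_Del; apply: par_sgnp.
by apply: parN; rewrite -addbN; apply: par_mul => //; apply: par_Del.
Qed.

(** [ham a] is a superderivation of parity opposite to that of [a], whence the exponent [e.+1]: [f]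
    is moved in front of the coefficients of [ham a]. *)
Lemma ham_leib e a f g : par e a ->
  ham a (f ** g) = ham a f ** g + sgnp e.+1 f ** ham a g.
Proof.
move=> ha; rewrite /ham.
have c1 b : par (~~ e) b -> b ** f = sgnp e.+1 f ** b.
  by move=> hb; rewrite (supercomm two0 _ hb) [in RHS]sgnp_odd /= oddb.
have c0 b : par e b -> b ** sg f = sgnp e.+1 f ** b.
  by move=> hb; rewrite (supercomm two0 _ hb) sgnp_sgnp addn1.
rewrite euler_mul // dlast_mul !mulDr !mulDl !mulA.
rewrite (c1 (dl (sg a))); last by apply: par_opartial; apply: par_sgnp.
rewrite (c0 (euler a)); last exact: par_euler.
set S1 := \sum_j _; set S2 := \sum_j _; set S3 := \sum_j _.
have -> : S1 = S2 ** g + sgnp e.+1 f ** S3.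
  rewrite mul_suml mul_sumr -big_split /=; apply: eq_bigr => j _.
  rewrite epartial_mul // opartial_mul !mulDr !mulDl !mulA.
  rewrite (c1 ('x_j (sg a))); last by apply: par_opartial; apply: par_sgnp.
  rewrite (c0 ('d_j a)); last exact: par_epartial.
  by rewrite addrACA.
by apply/ffunP=> m; rewrite !ffunE; ring.
Qed.

Lemma brk_leib e u v w vw a f g : par e a -> vw = v + w ->
  brk u vw a (f ** g) = brk u v a f ** g + sgnp e.+1 f ** brk u w a g.
Proof.
move=> ha ->; rewrite !brk_ham (ham_leib _ _ ha) dlast_mul !mulDr !mulDl !mulA.
rewrite !(mulZl, mulZr) !mulA.
have -> : a ** sg f = sgnp e.+1 f ** a.
  by rewrite (supercomm two0 _ ha) sgnp_sgnp addn1.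
have -> : sgnp e.+1 f ** dl (sg a) = dl (sg a) ** f.
  rewrite [RHS](@supercomm _ _ _ _ two0 (~~ e)).
    by rewrite [in LHS]sgnp_odd /= oddb.
  by apply: par_opartial; apply: par_sgnp.
by apply/ffunP=> m; rewrite !ffunE /GRing.scale /=; ring.
Qed.

Lemma brkDr u w a f g : brk u w a (f + g) = brk u w a f + brk u w a g.
Proof.
rewrite !brkE // mulDr !DelD !mulDr.
by apply/ffunP=> m; rewrite !ffunE; ring.
Qed.
Lemma brkZr u w a x g : brk u w a (x *: g) = x *: brk u w a g.
Proof.
rewrite !brkE // !(mulZr, DelZ).
by apply/ffunP=> m; rewrite !ffunE /GRing.scale /=; ring.
Qed.
Lemma brkDl u w a b g : brk u w (a + b) g = brk u w a g + brk u w b g.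
Proof.
rewrite !brkE // !sgnpD !(mulDl, DelD).
by apply/ffunP=> m; rewrite !ffunE; ring.
Qed.
Lemma brkZl u w a x g : brk u w (x *: a) g = x *: brk u w a g.
Proof.
rewrite !brkE // !sgnpZ !(mulZl, DelZ).
by apply/ffunP=> m; rewrite !ffunE /GRing.scale /=; ring.
Qed.

Lemma Del_mul e u w uw a g : par e a -> uw = u + w ->
  Del uw (a ** g) = (-1) ^+ e *: brk u w a g + Del u a ** g + (-1) ^+ e *: (a ** Del w g).
Proof.
move=> ha ->; rewrite brkE // ha !DelZ !mulZl !DelZ.
apply/ffunP=> m; rewrite !ffunE /GRing.scale /=.
by case: e {ha} => /=; ring.
Qed.

Lemma DelDel w w' a : w' = w + 2%:R -> Del w (Del w' a) = 0.
Proof. by move=> ->; rewrite Del_Del. Qed.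

(** Apply [Del uw] to [brkE]. As uw + 2 = u + w, the first term dies by [DelDel]; expanding the
    other two by [Del_mul] leaves brackets, since again each double [Del] vanishes. *)
Lemma Del_brk e u w u' w' uw a g : par e a ->
  u = u' + 2%:R -> w = w' + 2%:R -> uw = u' + w ->
  Del uw (brk u w a g) =
    brk u' w (Del u a) g + (- (-1) ^+ e) *: brk u w' a (Del w g).
Proof.
move=> ha eu ew euw.
rewrite {1}brkE // !DelB DelDel; last by rewrite eu euw; ring.
rewrite (Del_mul (e := ~~ e) (u := u') (w := w)) //; last first.
  by apply: par_Del; apply: par_sgnp.
rewrite (Del_mul (e := e) (u := u) (w := w')) //; last by rewrite euw eu ew; ring.
rewrite !DelDel // mul0x mulx0 ha !DelZ brkZl !mulZl.
apply/ffunP=> m; rewrite !ffunE /GRing.scale /=.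
by case: e {ha} => /=; ring.
Qed.

(** Primed weights are smaller by 2, because the bracket of elements of weights u and v has weight u
    + v - 2. The sign uses shifted parities, the bracket being odd. *)
Lemma jacobi e e' u v w u' v' w' a b g : par e a -> par e' b ->
  u = u' + 2%:R -> v = v' + 2%:R -> w = w' + 2%:R ->
  brk u (v' + w) a (brk v w b g) - (-1) ^+ (~~ e && ~~ e') *: brk v (u' + w) b (brk u w a g)
  = brk (u' + v) w (brk u v a b) g.
Proof.
move=> ha hb eu ev ew.
have hc := par_brk u v ha hb.
rewrite [RHS]brkE // hc !DelZ !mulZl !DelZ.
(* After [brkE] the outer [Del] acts on this product; [L] trades it for terms to which [Del_brk] and
   [Del_mul] apply. *)
have L : brk u v a b ** g = brk u (v + w) a (b ** g) - sgnp e.+1 b ** brk u w a g.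
  by rewrite (brk_leib u (v := v) (w := w) b g ha) // addrK.
have hda : par (~~ e) (Del u a) := par_Del u ha.
have hdb : par (~~ e') (Del v b) := par_Del v hb.
have e1 : v + w = v + w' + 2%:R by rewrite ew; ring.
have e2 : u' + v + w = u' + (v + w) by ring.
have e3 : u' + v + w = v + (u' + w) by ring.
have e5 : v + w' = v' + w by rewrite ev ew; ring.
have E1 := Del_brk (b ** g) ha eu e1 e2.
have E2 := Del_mul g hb (erefl (v + w)).
have E3 := Del_mul (brk u w a g) hb e3.
have E4 := Del_brk g ha eu ew (erefl (u' + w)).
have E5 := Del_brk b ha eu ev (erefl (u' + v)).
have E6 := brk_leib u' b g hda (erefl (v + w)).
have E7 := brk_leib u (Del v b) g ha (erefl (v' + w)).
have E8 := brk_leib u b (Del w g) ha (esym e5).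
rewrite {1}L (parE _ hb) mulZl DelB DelZ E1 E2.
rewrite !brkDr !brkZr.
rewrite E3 E4 E5.
rewrite E6 e5 E7 E8.
clear E1 E2 E3 E4 E5 E6 E7 E8 L hc.
rewrite !(parE _ hb) (parE _ hdb) !mulZl.
rewrite !(mulBl, mulBr, mulZl, mulZr, mulDl, mulDr).
clear hda hdb.
apply/ffunP=> m; rewrite !ffunE /GRing.scale /=.
by case: e {ha}; case: e' {hb} => /=; ring.
Qed.

End Jacobi.

(** * From brackets of functions to the derived algebras *)

Section Superbracket.
Variables (F : fieldType) (p n : nat) (t : 'I_n -> nat).
Hypothesis charFp : p \in [pchar F].
Hypothesis two0 : 2%:R != 0 :> F.
Local Notation basis := (basis p t).
Local Notation O := {ffun basis -> F^o}.
Local Notation "a ** b" := (@mul F p n t a b) (at level 40, left associativity).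
Local Notation dl := (@dlast F p n t).
Local Notation sg := (@sgnp F p n t 1).
Local Notation Del := (@Del F p n t).
Local Notation brk := (@brk F p n t).
Local Notation DKO := (@DKO F p n t).
Implicit Types (a b g h : O) (m : basis) (u v w x c lam : F) (e d : bool).
Implicit Types (U V : {vspace 'End(O)}).

Lemma opartD e a b : opart e (a + b) = opart e a + opart e b.
Proof. exact: linearD. Qed.

Lemma opart_Del d w a : opart d (Del w a) = Del w (opart (~~ d) a).
Proof.
rewrite {1}(opartE a) DelD opartD.
rewrite !(opart_par two0 _ (par_Del w (par_opart _ _))).
by case: d; rewrite /= ?addr0 ?add0r.
Qed.

Lemma opart_brk d u w a g : opart d (brk u w a g) =
  \sum_(e : bool) brk u w (opart e a) (opart (~~ (d (+) e)) g).
Proof.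
rewrite {1}(opartE a) {1}(opartE g) brkDl // !brkDr // !opartD big_bool.
rewrite !(opart_par two0 _ (par_brk charFp u w (par_opart _ _) (par_opart _ _))).
by case: d; rewrite /= ?addr0 ?add0r // addrC.
Qed.

(** The bracket is odd ([par_brk]), so the parity of [DKO a] is opposite to that of [a]. *)
Lemma hpart_DKO d a : hpart d (DKO a) = DKO (opart (~~ d) a).
Proof.
apply/lfunP=> g; rewrite /hpart sum_lfunE big_bool !comp_lfunE !DKOE // !lfunE /=.
rewrite !opart_brk !big_bool.
have oo e e' f : opart e (opart e' f : O) = if e == e' then opart e' f else 0.
  by rewrite (opart_par two0 e (par_opart e' f)).
have b0 f : brk 2%:R 0 f 0 = 0 by have := brkZr charFp 2%:R 0 f 0 0; rewrite !scale0r.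
rewrite [in RHS](opartE g) brkDr // [in RHS]addrC.
by case: d; rewrite /= !oo /= ?b0 ?addr0 ?add0r.
Qed.

(** The Jacobi identity with weights 2 and 2 for the generating functions and 0 for the function
    acted on; the bracket of [a] and [b] again has weight 2 + 2 - 2 = 2. *)
Lemma brk_comp e e' a b g : par e a -> par e' b ->
  brk 2%:R 0 a (brk 2%:R 0 b g) - (-1) ^+ (~~ e && ~~ e') *: brk 2%:R 0 b (brk 2%:R 0 a g)
  = brk 2%:R 0 (brk 2%:R 2%:R a b) g.
Proof.
move=> ha hb.
have := jacobi charFp two0 (u := 2%:R) (v := 2%:R) (w := 0) (u' := 0) (v' := 0) (w' := -2%:R) g ha hb.
by rewrite !add0r addNr; apply.
Qed.

Lemma sbracketDl (D E G : 'End(O)) : sbracket (D + E) G = sbracket D G + sbracket E G.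
Proof. by have := sbracket_linearl G 1 D E; rewrite !scale1r. Qed.
Lemma sbracketDr (D E G : 'End(O)) : sbracket G (D + E) = sbracket G D + sbracket G E.
Proof. by have := sbracket_linear G 1 D E; rewrite !scale1r. Qed.

Lemma sbracketDD (D E G H : 'End(O)) : sbracket (D + E) (G + H) =
  sbracket D G + sbracket D H + (sbracket E G + sbracket E H).
Proof. by rewrite sbracketDl !sbracketDr. Qed.

Lemma DKOD a b : DKO (a + b) = DKO a + DKO b.
Proof. exact: linearD. Qed.
Lemma DKOZ x a : DKO (x *: a) = x *: DKO a.
Proof. exact: linearZ. Qed.

Lemma hpart_DKO_par d e a : par e a ->
  hpart d (DKO a) = if d == ~~ e then DKO a else 0.
Proof.
move=> ha; rewrite hpart_DKO (opart_par two0 _ ha) eq_sym -(inj_eq negb_inj) negbK eq_sym.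
by case: eqP => _ //; exact: linear0.
Qed.

Lemma sbracket_DKO_par e e' a b : par e a -> par e' b ->
  sbracket (DKO a) (DKO b) = DKO (brk 2%:R 2%:R a b).
Proof.
move=> ha hb.
have -> : sbracket (DKO a) (DKO b) =
    (DKO a \o DKO b)%VF - (-1) ^+ (~~ e && ~~ e') *: (DKO b \o DKO a)%VF.
  rewrite /sbracket !big_bool /= !(hpart_DKO_par _ ha) !(hpart_DKO_par _ hb).
  move: (DKO a) (DKO b) => A B; move: e e' {ha hb} => [] [] /=;
  by rewrite ?comp_lfun0l ?comp_lfun0r ?scaler0 ?subr0 ?addr0 ?add0r.
apply/lfunP=> g; rewrite add_lfunE opp_lfunE scale_lfunE !comp_lfunE !DKOE //.
exact: brk_comp.
Qed.

Lemma sbracket_DKO a b : sbracket (DKO a) (DKO b) = DKO (brk 2%:R 2%:R a b).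
Proof.
have bP d e := sbracket_DKO_par (par_opart d a) (par_opart e b).
transitivity (sbracket (DKO (opart false a) + DKO (opart true a))
                       (DKO (opart false b) + DKO (opart true b))).
  by rewrite -!DKOD -!opartE.
rewrite sbracketDD.
rewrite !bP.
rewrite [in RHS](opartE a) [in RHS](opartE b).
rewrite brkDl //.
rewrite !brkDr //.
by rewrite !DKOD.
Qed.

(** Replacing weight 2 by c in the left argument and in the divergence of [b] creates the term (c -
    2) a d_tau(b) twice, with opposite signs. So the bracket of KO is controlled by the divergence
    of any weight c. *)
Lemma brk_Del c a b : brk 2%:R 2%:R a b =
  Del (c + 2%:R) (sg a ** b) - Del c (sg a) ** b - a ** Del c b.
Proof.
have -> : brk 2%:R 2%:R a b = brk c 2%:R a b + (c - 2%:R) *: (a ** dl b).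
  by rewrite !brk_ham; apply/ffunP=> m; rewrite !ffunE /GRing.scale /=; ring.
rewrite brkE //.
have -> : Del 2%:R b = Del c b + (c - 2%:R) *: dl b.
  by rewrite !DelE; apply/ffunP=> m; rewrite !ffunE /GRing.scale /=; ring.
by rewrite mulDr mulZr opprD addrA subrK.
Qed.

Lemma brk_ker c a b : Del c a = 0 -> Del c b = 0 ->
  brk 2%:R 2%:R a b = Del (c + 2%:R) (sg a ** b).
Proof.
move=> ha hb; rewrite (brk_Del c) hb mulx0 subr0.
by rewrite -[Del c (sg a)]opprK -sgnp_Del ha sgnp_zero oppr0 mul0x subr0.
Qed.

Lemma divlE lam a : (divl lam a == 0) = (Del (n%:R * lam) a == 0).
Proof.
have -> : divl lam a = (- 2%:R) *: sg (Del (n%:R * lam) a).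
  rewrite sgnp_Del scalerN scaleNr opprK /divl DelE.
  by apply/ffunP=> m; rewrite !ffunE /GRing.scale /=; ring.
rewrite scaler_eq0 oppr_eq0 (negPf two0) /=.
by apply/eqP/eqP=> [h|->]; [rewrite -(sgnpK 1 (Del _ a)) h|]; rewrite sgnp_zero.
Qed.

Lemma memSKO2 lam (D : 'End(O)) :
  reflect (exists2 a : O, Del (n%:R * lam) a = 0 & D = DKO a) (D \in SKO2 p t lam).
Proof.
apply: (iffP (memSKO2P lam D)) => -[a /eqP h ->]; exists a => //; apply/eqP.
  by rewrite -divlE.
by rewrite divlE.
Qed.

Definition graded U := forall d (D : 'End(O)), D \in U -> hpart d D \in U.

Lemma SKO2_graded lam : graded (SKO2 p t lam).
Proof.
move=> d D /memSKO2[a ha ->]; rewrite hpart_DKO; apply/memSKO2.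
by exists (opart (~~ d) a); rewrite // -opart_Del ha linear0.
Qed.

Lemma mem_sbracketv U V (D E : 'End(O)) :
  D \in U -> E \in V -> sbracket D E \in sbracketv U V.
Proof. exact: (proj2 (sbracketvP U V (sbracketv U V))). Qed.

Lemma sbracketvS U V U' V' :
  (U <= U')%VS -> (V <= V')%VS -> (sbracketv U V <= sbracketv U' V')%VS.
Proof.
move=> /subvP hU /subvP hV; apply/sbracketvP => D E hD hE.
by apply: mem_sbracketv; [apply: hU | apply: hV].
Qed.

(** Elements of [U] have the form [DKO a], which lets [sbracket_DKO] and [opart_brk] split a bracket
    into brackets of homogeneous parts. *)
Lemma sbracketv_graded lam U : (U <= SKO2 p t lam)%VS -> graded U ->
  graded (sbracketv U U).
Proof.
move=> /subvP hU gU d.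
suff : (sbracketv U U <= linfun (@hpart F p n t d) @^-1: sbracketv U U)%VS.
  by move=> /subvP h D /h; rewrite -memv_preim lfunE.
apply/sbracketvP => D E hD hE; rewrite -memv_preim lfunE /=.
have [a _ Da] := memSKO2 _ _ (hU _ hD); have [b _ Eb] := memSKO2 _ _ (hU _ hE).
have hA e : DKO (opart e a) \in U by rewrite -[e]negbK -hpart_DKO -Da gU.
have hB e : DKO (opart e b) \in U by rewrite -[e]negbK -hpart_DKO -Eb gU.
rewrite Da Eb sbracket_DKO hpart_DKO opart_brk big_bool DKOD -!sbracket_DKO.
by rewrite memvD // mem_sbracketv.
Qed.

Lemma SKO1_sub lam : (SKO1 p t lam <= SKO2 p t lam)%VS.
Proof.
apply/sbracketvP => D E /memSKO2[a ha ->] /memSKO2[b hb ->].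
rewrite sbracket_DKO; apply/memSKO2; exists (brk 2%:R 2%:R a b) => //.
by rewrite (brk_ker ha hb) DelDel.
Qed.

Lemma SKO_sub lam : (SKO p t lam <= SKO1 p t lam)%VS.
Proof. by apply: sbracketvS; apply: SKO1_sub. Qed.

Lemma SKO1_subsuper lam : is_subsuperalgebra (SKO1 p t lam).
Proof.
split; first by apply: sbracketv_graded (subvv _) (@SKO2_graded lam).
move=> D E hD hE; apply: mem_sbracketv; exact: (subvP (SKO1_sub lam)).
Qed.

Lemma SKO_subsuper lam : is_subsuperalgebra (SKO p t lam).
Proof.
split; first by apply: sbracketv_graded (SKO1_sub lam) (proj1 (SKO1_subsuper lam)).
move=> D E hD hE; apply: mem_sbracketv; exact: (subvP (SKO_sub lam)).
Qed.

End Superbracket.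

(** * Generation *)

Section TauFree.
Variables (F : fieldType) (p n : nat) (t : 'I_n -> nat).
Hypothesis charFp : p \in [pchar F].
Hypothesis two0 : 2%:R != 0 :> F.
Hypothesis t_gt0 : forall i, (0 < t i)%N.
Local Notation basis := (basis p t).
Local Notation O := {ffun basis -> F^o}.
Local Notation "a ** b" := (@mul F p n t a b) (at level 40, left associativity).
Local Notation "'d_ j" := (epartial j) (at level 10, j at level 8, format "''d_' j").
Local Notation "'x_ j" := (opartial (odd_of j)) (at level 10, j at level 8, format "''x_' j").
Local Notation dl := (@dlast F p n t).
Local Notation sg := (@sgnp F p n t 1).
Local Notation lap := (@laplace F p n t).
Local Notation Del := (@Del F p n t).
Local Notation M := (@xmon F p n t).
Local Notation rg := (in_range p t).
Local Notation one := (@one F p n t).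
Implicit Types (a b f g h y z : O) (w x c : F) (i j q : 'I_n).
Implicit Types (al be : 'I_n -> nat) (u v : {set 'I_n}).

Definition addk al k j : 'I_n -> nat := fun i => (al i + k * eps j i)%N.
Definition subk al k j : 'I_n -> nat := fun i => (al i - k * eps j i)%N.
Definition kp k j : 'I_n -> nat := fun i => (k * eps j i)%N.
Definition pim : 'I_n -> nat := fun i => (p ^ t i).-1.
Local Notation z0 := (@zero_exp n).

Lemma M_eq al be u : al =1 be -> M al u = M be u.
Proof. exact: eq_mon. Qed.

Lemma p_gt1 : (1 < p)%N. Proof. exact/prime_gt1/(pcharf_prime charFp). Qed.

Lemma pN_gt1 i : (1 < p ^ t i)%N.
Proof. by rewrite -{1}(expn0 p) ltn_exp2l ?p_gt1 // t_gt0. Qed.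

Lemma rg0 : rg z0.
Proof. by apply/forallP=> i; rewrite (ltn_trans _ (pN_gt1 i)). Qed.

Lemma rg_pim : rg pim.
Proof. by apply/forallP=> i; rewrite /pim prednK // (ltn_trans _ (pN_gt1 i)). Qed.

Lemma rg_le al be : (forall i, al i <= be i)%N -> rg be -> rg al.
Proof. by move=> h /forallP hb; apply/forallP=> i; apply: leq_ltn_trans (h i) (hb i). Qed.

Lemma rg_addk al k j : rg al -> (al j + k < p ^ t j)%N -> rg (addk al k j).
Proof.
move=> /forallP h hj; apply/forallP=> i; rewrite /addk /eps.
by case: eqP => [->|_]; rewrite ?muln1 ?muln0 ?addn0.
Qed.

Lemma rg_kp k j : (k < p ^ t j)%N -> rg (kp k j).
Proof. by move=> h; apply: (@rg_le _ (addk z0 k j)) => //; apply: rg_addk rg0 _. Qed.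

Lemma odd_imset_disj u v : [disjoint (@odd_of n) @: u & (@odd_of n) @: v] = [disjoint u & v].
Proof.
by rewrite -!setI_eq0 -imsetI ?imset_eq0 // => x y _ _; apply: odd_of_inj.
Qed.

Lemma Mmul al u be v : M al u ** M be v = if [disjoint u & v] then
  ((-1) ^+ inversions ((@odd_of n) @: u) ((@odd_of n) @: v) * (\prod_i 'C(al i + be i, al i))%:R)
    *: M (fun i => al i + be i)%N (u :|: v) else 0.
Proof. by rewrite /xmon mul_mon odd_imset_disj imsetU. Qed.

Lemma Mmul0l al be v : M al set0 ** M be v =
  (\prod_i 'C(al i + be i, al i))%:R *: M (fun i => al i + be i)%N v.
Proof.
by rewrite Mmul -setI_eq0 set0I eqxx imset0 /inversions big_set0 expr0 mul1r set0U.
Qed.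

Lemma imset_odd_D1 j u : ((@odd_of n) @: u) :\ odd_of j = (@odd_of n) @: (u :\ j).
Proof.
apply/setP=> k; rewrite !inE; apply/andP/imsetP => [[kj /imsetP[i iu e]]|[i]].
  by exists i => //; rewrite !inE iu andbT; apply: contraNneq kj => <-; rewrite e.
rewrite !inE => /andP[ij iu] ->; split; last by rewrite imset_f.
by apply: contraNneq ij => /odd_of_inj ->.
Qed.

Definition cnt j u : nat := #|[set k in (@odd_of n) @: u | (k < odd_of j)%N]|.

Lemma xM j al u : 'x_j (M al u) = if j \in u then (-1) ^+ cnt j u *: M al (u :\ j) else 0.
Proof.
rewrite /xmon opartial_mon mem_imset; last exact: odd_of_inj.
by rewrite imset_odd_D1.
Qed.

Lemma dM j al u : rg al -> 'd_j (M al u) = if (0 < al j)%N then M (subk al 1 j) u else 0.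
Proof.
move=> h; rewrite /xmon epartial_mon //; case: ifP => // _; apply: eq_mon => i.
by rewrite /subk mul1n.
Qed.

Lemma dM0 j al u : al j = 0%N -> 'd_j (M al u) = 0.
Proof.
move=> aj; have [h|h] := boolP (rg al); first by rewrite dM // aj.
by rewrite /xmon mon_out // epartial0.
Qed.

(** Free of tau: on such elements every [Del w] is the Laplacian. *)
Definition tf a : Prop := dl a = 0.

Lemma tfM al u : tf (M al u).
Proof.
rewrite /tf /dlast /xmon opartial_mon ifF //; apply/negP => /imsetP[j _ /eqP].
by rewrite eq_sym (negPf (odd_of_neq_max j)).
Qed.
Lemma tfZ x a : tf a -> tf (x *: a).
Proof. by rewrite /tf dlastZ => ->; rewrite scaler0. Qed.
Lemma tf_sg a : tf a -> tf (sg a).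
Proof.
move=> h; have := sgnp_dlast 1 a; rewrite h sgnp_zero expr1 scaleN1r => /eqP.
by rewrite eq_sym oppr_eq0 => /eqP.
Qed.
Lemma tf_mul a b : tf a -> tf b -> tf (a ** b).
Proof. by rewrite /tf dlast_mul => -> ->; rewrite mul0x mulx0 addr0. Qed.
Lemma tf_lap a : tf a -> tf (lap a).
Proof.
move=> h; have := laplace_dlast a; rewrite h laplace0 => /eqP.
by rewrite eq_sym oppr_eq0 => /eqP.
Qed.

Lemma Del_tf w a : tf a -> Del w a = lap a.
Proof. by move=> h; rewrite DelE h euler0 scaler0 !addr0. Qed.

Lemma mulx1 a : a ** one = a.
Proof.
have h : par false one by rewrite /par sgnp_mon cards0 muln0.
by have := supercomm two0 a h; rewrite sgnp0 mul1x => <-.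
Qed.

Local Notation tau := (@lastvar F p n t).

Lemma dl_tau : dl tau = one.
Proof.
rewrite /dlast /lastvar opartial_mon inE eqxx setDv.
rewrite (_ : [set _ in _ | _] = set0) ?cards0 ?expr0 ?scale1r //.
by apply/setP=> k; rewrite !inE; case: eqP => // ->; rewrite ltnn.
Qed.

Lemma x_tau j : 'x_j tau = 0.
Proof. by rewrite /lastvar opartial_mon inE (negPf (odd_of_neq_max j)). Qed.

Lemma d_tau j : 'd_j tau = 0.
Proof. by rewrite /lastvar epartial_mon ?rg0. Qed.

Lemma sg_tau : sg tau = - tau.
Proof. by rewrite /lastvar sgnp_mon cards1 expr1 scaleN1r. Qed.

Lemma lap_mul_tau a : lap (a ** tau) = lap a ** tau.
Proof.
rewrite !laplaceE mul_suml; apply: eq_bigr => j _.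
by rewrite opartial_mul x_tau mulx0 addr0 epartial_mul // d_tau mulx0 addr0.
Qed.

Lemma Del_mul_tau w a : tf a ->
  Del w (a ** tau) = lap a ** tau + (euler (sg a) - w *: sg a).
Proof.
move=> h; rewrite DelE lap_mul_tau dlast_mul h mul0x add0r dl_tau mulx1.
by rewrite scaleNr addrA.
Qed.

(** x_q xi_q has Laplacian 1, so multiplying by it inverts the Laplacian, up to sign, on harmonic
    elements free of x_q and xi_q; see [lap_mul_xx0]. *)
Definition xx q : O := M (eps q) [set q].
Definition ev q : O := M (eps q) set0.
Definition xi q : O := M z0 [set q].

Lemma cnt1 j : cnt j [set j] = 0%N.
Proof.
apply/eqP; rewrite cards_eq0; apply/eqP/setP=> k; rewrite imset_set1 !inE.
by case: eqP => // ->; rewrite ltnn.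
Qed.

Lemma rg_eps q : rg (eps q).
Proof. by apply/forallP=> i; rewrite /eps; case: eqP; rewrite ?pN_gt1 // (ltn_trans _ (pN_gt1 i)). Qed.

Lemma x_xx j q : 'x_j (xx q) = if j == q then ev q else 0.
Proof. by rewrite /xx xM inE; case: eqP => // ->; rewrite cnt1 scale1r setDv. Qed.

Lemma d_xx j q : 'd_j (xx q) = if j == q then xi q else 0.
Proof.
rewrite /xx dM ?rg_eps // /eps; case: eqP => //= <-; apply: M_eq => i.
by rewrite /subk /eps mul1n subnn.
Qed.

Lemma d_ev j q : 'd_j (ev q) = if j == q then one else 0.
Proof.
rewrite /ev dM ?rg_eps // /eps; case: eqP => //= <-.
rewrite /xmon imset0; apply: eq_mon => i; by rewrite /subk /eps mul1n subnn.
Qed.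

Lemma lap_xx q : lap (xx q) = one.
Proof.
rewrite laplaceE (bigD1 q) //= x_xx eqxx d_ev eqxx big1 ?addr0 // => j jq.
by rewrite x_xx (negPf jq) epartial0.
Qed.

Lemma lap_mul_xx q y : lap (y ** xx q) =
  lap y ** xx q + ('x_q y ** xi q + sg ('d_q y) ** ev q) + sg y.
Proof.
have := laplace_mul charFp (sg y) (xx q); rewrite sgnpK => ->; rewrite lap_xx mulx1.
rewrite (bigD1 q) //= x_xx d_xx eqxx big1 ?addr0 => [|j jq]; last first.
  by rewrite x_xx d_xx (negPf jq) !mulx0 addr0.
by rewrite sgnp_epartial.
Qed.

Lemma lapM0 al u : (forall j, j \in u -> al j = 0%N) -> lap (M al u) = 0.
Proof.
move=> h; rewrite laplaceE big1 // => j _; rewrite xM; case: ifP => ju; last by rewrite epartial0.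
by rewrite epartialZ dM0 ?scaler0 // h.
Qed.

Lemma dM_ev q al u : 'd_q (M al u) ** ev q = (al q)%:R *: M al u.
Proof.
have [h|h] := boolP (rg al); last by rewrite /xmon mon_out // epartial0 mul0x scaler0.
rewrite dM //; case: posnP => aq; first by rewrite mul0x aq scale0r.
rewrite Mmul disjoint_sym -setI_eq0 set0I eqxx setU0 imset0 /inversions big1 ?expr0 ?mul1r.
  rewrite (bigD1 q) //= big1 ?muln1 => [|i /negPf iq].
    rewrite /subk /eps eqxx muln1 subn1 addn1 prednK //.
    have -> : 'C(al q, (al q).-1) = al q by case: (al q) aq => // b _; rewrite binSn.
    congr (_ *: _).
    apply: M_eq => i; rewrite /subk /eps mul1n; case: eqP => [->|_]; last by rewrite subn0 addn0.
    by rewrite subn1 addn1 prednK.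
  by rewrite /subk /eps iq addn0 muln0 subn0 binn.
by move=> i _; apply: eq_card0 => k; rewrite !inE.
Qed.

Lemma eulerM al u : euler (M al u) = (zd al u)%:R *: M al u.
Proof.
rewrite /xmon euler_mon /deg; congr ((_ + _)%:R *: _).
rewrite -(card_imset _ (@odd_of_inj n)); apply: eq_card => k; rewrite !inE.
case: eqP => //= ->; apply/esym/negbTE/negP => /imsetP[j _ /eqP].
by rewrite eq_sym (negPf (odd_of_neq_max j)).
Qed.

Lemma sgM al u : sg (M al u) = (-1) ^+ #|u| *: M al u.
Proof. by rewrite /xmon sgnp_mon mul1n card_imset //; exact: odd_of_inj. Qed.

Lemma Mout al u : ~~ rg al -> M al u = 0.
Proof. exact: mon_out. Qed.

(** Membership in a subspace is insensitive to this relation, which absorbs reordering signs and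
    invertible binomial coefficients. *)
Definition sim a b : Prop := exists2 x : F, x != 0 & a = x *: b.

Lemma sim_refl a : sim a a.
Proof. by exists 1; rewrite ?oner_neq0 ?scale1r. Qed.
Lemma sim_trans b a f : sim a b -> sim b f -> sim a f.
Proof.
by move=> [x x0 ->] [y y0 ->]; exists (x * y); rewrite ?mulf_neq0 ?scalerA.
Qed.
Lemma sim_sym a b : sim a b -> sim b a.
Proof.
move=> [x x0 ->]; exists x^-1; first by rewrite invr_eq0.
by rewrite scalerA mulVf // scale1r.
Qed.
Lemma sim_lap a b : sim a b -> sim (lap a) (lap b).
Proof. by move=> [x x0 ->]; exists x; rewrite ?laplaceZ. Qed.
Lemma sim_mull a b f : sim a b -> sim (f ** a) (f ** b).
Proof. by move=> [x x0 ->]; exists x; rewrite ?mulZr. Qed.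
Lemma sim_sgM al u : sim (sg (M al u)) (M al u).
Proof. by rewrite sgM; exists ((-1) ^+ #|u|); rewrite ?signr_eq0. Qed.
Lemma sim_Mmul al u be v ga u0 : [disjoint u & v] ->
  (\prod_i 'C(al i + be i, al i))%:R != 0 :> F ->
  (forall i, al i + be i = ga i)%N -> u :|: v = u0 ->
  sim (M al u ** M be v) (M ga u0).
Proof.
move=> d C0 eg <-; exists ((-1) ^+ inversions ((@odd_of n) @: u) ((@odd_of n) @: v) *
  (\prod_i 'C(al i + be i, al i))%:R).
  by rewrite mulf_neq0 ?signr_eq0.
by rewrite Mmul d; congr (_ *: _); apply: M_eq.
Qed.

Lemma prod_bin1 al be : (forall i, al i = 0%N \/ be i = 0%N) ->
  (\prod_i 'C(al i + be i, al i))%N = 1%N.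
Proof.
move=> h; apply: big1 => i _; case: (h i) => ->; first by rewrite bin0.
by rewrite addn0 binn.
Qed.

Lemma prod_bin_at j al be : (forall i, i != j -> al i = 0%N \/ be i = 0%N) ->
  (\prod_i 'C(al i + be i, al i))%N = 'C(al j + be j, al j).
Proof.
move=> h; rewrite (bigD1 j) //= big1 ?muln1 // => i /h[] ->; first by rewrite bin0.
by rewrite addn0 binn.
Qed.

Lemma sim_dxM j al u : rg al -> j \in u -> (0 < al j)%N ->
  sim ('d_j ('x_j (M al u))) (M (subk al 1 j) (u :\ j)).
Proof.
move=> h ju aj; rewrite xM ju epartialZ dM // aj.
by exists ((-1) ^+ cnt j u); rewrite ?signr_eq0.
Qed.

Lemma dxM0 j al u : (j \in u -> al j = 0%N) -> 'd_j ('x_j (M al u)) = 0.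
Proof.
rewrite xM; case: ifP => [_ /(_ isT) aj|_ _]; last by rewrite epartial0.
by rewrite epartialZ dM0 ?scaler0.
Qed.

Lemma sim_lapM1 i al u be v : rg al -> i \in u -> (0 < al i)%N ->
  (forall j, j \in u -> j != i -> al j = 0%N) ->
  subk al 1 i =1 be -> u :\ i = v -> sim (lap (M al u)) (M be v).
Proof.
move=> h iu ai h0 eb <-; rewrite laplaceE (bigD1 i) //= big1 ?addr0 => [|j ji].
  by rewrite -(M_eq _ eb); apply: sim_dxM.
by apply: dxM0 => ju; apply: h0.
Qed.

Definition unodd (u : {set 'I_n.+1}) : {set 'I_n} := [set j | odd_of j \in u].

Lemma odd_unodd (u : {set 'I_n.+1}) : ord_max \notin u -> (@odd_of n) @: unodd u = u.
Proof.
move=> hu; apply/setP=> k; apply/imsetP/idP => [[j]|ku]; first by rewrite inE => ? ->.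
have km : k != ord_max by apply: contraNneq hu => <-.
by have [j kj] := odd_of_surj km; exists j; rewrite // inE -kj.
Qed.

Lemma bmon_M (m : basis) : ord_max \notin m.2 ->
  bmon F m = M (fun i => m.1 i) (unodd m.2).
Proof. by move=> h; rewrite /xmon odd_unodd. Qed.

Lemma bmon_Mtau (m : basis) : ord_max \in m.2 ->
  bmon F m = M (fun i => m.1 i) (unodd m.2) ** tau.
Proof.
move=> h; have -> : unodd m.2 = unodd (m.2 :\ ord_max).
  by apply/setP=> j; rewrite !inE odd_of_neq_max.
rewrite /xmon odd_unodd ?setD11 // /lastvar mul_mon disjoint_sym disjoints1 setD11 /=.
rewrite setUC setD1K // big1 => [|i _]; last by rewrite addn0 binn.
rewrite (_ : inversions _ _ = 0%N).
  by rewrite expr0 mul1r scale1r; apply: eq_mon => i; rewrite addn0.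
rewrite /inversions big1 // => j _; apply: eq_card0 => k; rewrite !inE.
by case: eqP => // ->; rewrite /= ltnNge -ltnS ltn_ord.
Qed.

(** The coefficient of [m] in [a] is, up to sign, that of [m] without tau in [dl a], and no other
    monomial contributes to the latter. *)
Lemma tf_coef a (m : basis) : tf a -> ord_max \in m.2 -> a m = 0.
Proof.
rewrite /tf /dlast => h hm; have := congr1 (fun f : O => f (m.1, m.2 :\ ord_max)) h.
rewrite /opartial sum_ffunE (bigD1 m) //= big1 => [|k /andP[hk km]]; rewrite !ffunE /=.
  rewrite addr0 [_ *: _]/GRing.scale /= eqxx andbT.
  have -> : [forall i, m.1 i == m.1 i] by apply/forallP.
  by rewrite mulr1 => /eqP; rewrite mulf_eq0 signr_eq0 orbF => /eqP.
case: andP => [[/forallP e1 /eqP e2]|_]; last by rewrite scaler0.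
case/eqP: km; case: k m hk hm e1 e2 {h} => [k1 k2] [m1 m2] /= hk hm e1 e2; congr pair.
  by apply/ffunP => i; apply/val_inj/esym/eqP/e1.
by rewrite -(setD1K hk) -e2 setD1K.
Qed.

Lemma tf_ind (R : O -> Prop) : R 0 -> (forall x a b, R a -> R b -> R (x *: a + b)) ->
  (forall al u, R (M al u)) -> forall a, tf a -> R a.
Proof.
move=> R0 RD RM a ta; rewrite (O_expand a); elim/big_rec: _ => // m b _ hb.
have [hm|hm] := boolP (ord_max \in m.2).
  by rewrite tf_coef // scale0r add0r.
by apply: RD => //; rewrite bmon_M.
Qed.

End TauFree.

(** * Closure of the generating functions under the bracket *)

Section Generation.
Variables (F : fieldType) (p n : nat) (t : 'I_n -> nat).
Hypothesis charFp : p \in [pchar F].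
Hypothesis two0 : 2%:R != 0 :> F.
Hypothesis three0 : 3%:R != 0 :> F.
Hypothesis t_gt0 : forall i, (0 < t i)%N.
Hypothesis n_ge3 : (3 <= n)%N.
Local Notation basis := (basis p t).
Local Notation O := {ffun basis -> F^o}.
Local Notation "a ** b" := (@mul F p n t a b) (at level 40, left associativity).
Local Notation "'d_ j" := (epartial j) (at level 10, j at level 8, format "''d_' j").
Local Notation "'x_ j" := (opartial (odd_of j)) (at level 10, j at level 8, format "''x_' j").
Local Notation dl := (@dlast F p n t).
Local Notation sg := (@sgnp F p n t 1).
Local Notation lap := (@laplace F p n t).
Local Notation Del := (@Del F p n t).
Local Notation M := (@xmon F p n t).
Local Notation rg := (in_range p t).
Local Notation one := (@one F p n t).
Local Notation tau := (@lastvar F p n t).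
Local Notation z0 := (@zero_exp n).
Local Notation xx := (@xx F p n t).
Local Notation ev := (@ev F p n t).
Local Notation xi := (@xi F p n t).
Local Notation tf := (@tf F p n t).
Local Notation sim := (@sim F p n t).
Local Notation pim := (@pim p n t).
Implicit Types (a b f g h y z m : O) (w x d : F) (i j q : 'I_n).
Implicit Types (al be : 'I_n -> nat) (u v : {set 'I_n}).

(** [P] abstracts the functions [a] killed by [Del c] with [DKO a] in a fixed subsuperalgebra. By
    [brk_ker], and [Psg] for the sign, [PB] is closure under brackets; [PT] and [PS] supply
    generators whose auxiliary index q differs from the given one. *)
Variables (c : F) (P : O -> Prop).
(* Q (nabla_q x^(al) x^u) = x^(al) x^u tau + ... is the function of E(al, u, 2n+1, q)
   whenever lap (nabla_q x^(al) x^u) = x^(al) x^u. *)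
Definition Q m : O := Del (c + 2%:R) (m ** tau).
Hypothesis PZ : forall x a, P a -> P (x *: a).
Hypothesis PD : forall a b, P a -> P b -> P (a + b).
Hypothesis Psg : forall a, P a -> P (sg a).
Hypothesis PB : forall a b, P a -> P b -> P (Del (c + 2%:R) (a ** b)).
Hypothesis P1 : P one.
Hypothesis PT : forall k i q, (k < p ^ t i)%N -> i != q ->
  P (Q (M (kp k i) set0 ** xx q)).
Hypothesis PS : forall j q, j != q -> P (Q (xi j ** xx q)).

Let Meq al be u : al =1 be -> M al u = M be u.
Proof. exact: M_eq. Qed.

Lemma P0 : P 0. Proof. by have := PZ 0 P1; rewrite scale0r. Qed.
Lemma PN a : P a -> P (- a). Proof. by rewrite -scaleN1r; apply: PZ. Qed.
Lemma PBB a b : P a -> P b -> P (a - b).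
Proof. by move=> ha hb; apply: PD => //; apply: PN. Qed.

Lemma Psim a b : sim a b -> P a -> P b.
Proof. by move=> /sim_sym[x _ ->]; apply: PZ. Qed.

Lemma PZ' x a : x != 0 -> P (x *: a) -> P a.
Proof. by move=> x0; apply: Psim; exists x. Qed.

Lemma Psg' a : P (sg a) -> P a.
Proof. by move/Psg; rewrite sgnpK. Qed.

Lemma PBtf a b : tf a -> tf b -> P a -> P b -> P (lap (a ** b)).
Proof. move=> ta tb ha hb; have := PB ha hb; rewrite Del_tf //; exact: tf_mul. Qed.

Lemma QE m : tf m -> Q m = lap m ** tau + (euler (sg m) - (c + 2%:R) *: sg m).
Proof. exact: Del_mul_tau. Qed.

Lemma QD a b : Q (a + b) = Q a + Q b.
Proof. by rewrite /Q mulDl DelD. Qed.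
Lemma QZ x a : Q (x *: a) = x *: Q a.
Proof. by rewrite /Q mulZl DelZ. Qed.
Lemma QN a : Q (- a) = - Q a.
Proof. by rewrite -scaleN1r QZ scaleN1r. Qed.

Lemma PQsim a b : sim a b -> P (Q a) -> P (Q b).
Proof. by move=> [x x0 ->]; rewrite QZ; apply: PZ'. Qed.

Lemma dl_Q m : tf m -> dl (Q m) = sg (lap m).
Proof.
move=> h; rewrite QE // dlastD dlast_mul (tf_lap h) mul0x add0r dl_tau mulx1 //.
by rewrite dlastB dlast_euler dlastZ (tf_sg h) euler0 scaler0 subrr addr0.
Qed.

(** Bracketing with 1 is - 2 d_tau on the kernel of [Del c], and the tau-coefficient of [Q m] is the
    Laplacian of [m]. *)
Lemma PQlap m : tf m -> P (Q m) -> P (lap m).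
Proof.
move=> h hQ; have := PB P1 hQ; rewrite mul1x.
have -> : Del (c + 2%:R) (Q m) = Del c (Q m) + (- 2%:R) *: dl (Q m).
  by rewrite !DelE; apply/ffunP=> k; rewrite !ffunE /GRing.scale /=; ring.
rewrite {1}/Q DelDel // add0r dl_Q // => /PZ' h2.
by apply: Psg'; apply: h2; rewrite oppr_eq0.
Qed.

(** The tau-part of [Q m] produces another [Q], its tau-free part a Laplacian. *)
Lemma Del_mulQ f m d : tf f -> tf m -> euler m = d *: m ->
  Del (c + 2%:R) (f ** Q m) = Q (f ** lap m) + (d - c - 2%:R) *: lap (f ** sg m).
Proof.
move=> tff tm hd; rewrite (QE tm) -sgnp_euler hd sgnpZ -scalerBl.
rewrite mulDr mulA DelD -/(Q _) mulZr DelZ (Del_tf _ (tf_mul tff (tf_sg tm))).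
by rewrite opprD addrA.
Qed.

Lemma PRA f m d : tf f -> tf m -> P f -> P (Q m) -> euler m = d *: m ->
  P (Q (f ** lap m) + (d - c - 2%:R) *: lap (f ** sg m)).
Proof. by move=> tff tm hf hQ hd; rewrite -Del_mulQ //; apply: PB. Qed.

(** For harmonic [y] the tau-term disappears and [Q y] is tau-free, a possibly zero multiple of
    [sg y]. *)
Lemma Qker y d : tf y -> lap y = 0 -> euler y = d *: y ->
  Q y = (d - c - 2%:R) *: sg y.
Proof.
by move=> ty ly ey; rewrite QE // ly mul0x add0r -sgnp_euler ey sgnpZ -scalerBl opprD addrA.
Qed.

Lemma tf_xx q : tf (xx q). Proof. exact: tfM. Qed.

Lemma euler_xx q : euler (xx q) = 2%:R *: xx q.
Proof.
rewrite /xx eulerM /zd cards1 (bigD1 q) //= big1 ?addn0 => [|i /negPf iq].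
  by rewrite /eps eqxx.
by rewrite /eps iq.
Qed.

Lemma sg_xx q : sg (xx q) = - xx q.
Proof. by rewrite /xx sgM cards1 expr1 scaleN1r. Qed.

Lemma sg_ev q : sg (ev q) = ev q.
Proof. by rewrite /ev sgM cards0 expr0 scale1r. Qed.

(* Bracketing f with Q (g x_q xi_q) multiplies f by g, up to a coefficient that
   depends on the degrees of f and g and on the exponent r of x_q in f. *)
Lemma PmulE q f g df dg r : tf f -> tf g -> P f -> P (Q (g ** xx q)) ->
  euler f = df *: f -> euler g = dg *: g ->
  lap g = 0 -> 'x_q g = 0 -> 'd_q g = 0 ->
  'x_q f = 0 -> 'd_q f ** ev q = r *: f -> lap (f ** sg g) = 0 ->
  df - 2%:R - (dg - c) * r != 0 -> P (f ** sg g).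
Proof.
move=> tff tg hf hQ ef eg lg xg dg0 xf df0 lfg k0.
have tm : tf (g ** xx q) by apply: tf_mul => //; apply: tf_xx.
have em : euler (g ** xx q) = (dg + 2%:R) *: (g ** xx q).
  by rewrite euler_mul // eg euler_xx mulZl mulZr -scalerDl.
have := PRA tff tm hf hQ em.
set yy := f ** sg g.
have ty : tf yy by apply: tf_mul => //; apply: tf_sg.
have ey : euler yy = (df + dg) *: yy.
  by rewrite euler_mul // -sgnp_euler ef eg sgnpZ mulZl mulZr -scalerDl.
have lm : lap (g ** xx q) = sg g.
  by rewrite lap_mul_xx // lg xg dg0 sgnp_zero !mul0x !add0r.
have xy : 'x_q yy = 0.
  have := sgnp_opartial 1 (odd_of q) g; rewrite xg sgnp_zero expr1 scaleN1r => /eqP.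
  by rewrite eq_sym oppr_eq0 => /eqP xsg; rewrite opartial_mul xf mul0x add0r xsg mulx0.
have dy : sg ('d_q yy) ** ev q = r *: sg yy.
  rewrite -[ev q]sg_ev -sgnp_mul -sgnpZ; congr (sg _).
  rewrite epartial_mul // -sgnp_epartial dg0 sgnp_zero mulx0 addr0.
  have /(supercomm two0 (sg g)) : par false (ev q).
    by rewrite /par sg_ev expr0 scale1r.
  by rewrite sgnp0 => e; rewrite -mulA -e mulA df0 mulZl.
have lfm : lap (f ** sg (g ** xx q)) = - ((r + 1) *: sg yy).
  rewrite sgnp_mul sg_xx mulNr mulNr laplaceN mulA -/yy lap_mul_xx // lfg mul0x xy mul0x.
  by rewrite !add0r dy -[X in _ + X]scale1r -scalerDl.
rewrite lm -/yy (Qker ty lfg ey) lfm scalerN scalerA -scalerBl.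
move=> h; apply: Psg'; move: h; rewrite (_ : _ - _ = df - 2%:R - (dg - c) * r); last by ring.
exact: PZ'.
Qed.

(** The main use of n >= 3: a spare index besides any two given ones. *)
Lemma pick_neq2 i j : exists q, [/\ q != i, q != j, i != q & j != q].
Proof.
have : (0 < #|~: [set i; j]|)%N.
  by rewrite cardsCs setCK card_ord subn_gt0 (leq_ltn_trans _ n_ge3) // cards2; case: eqP.
by case/card_gt0P => q; rewrite !inE negb_or => /andP[]; exists q; split; rewrite // eq_sym.
Qed.

Lemma pick_notin u : u != setT -> exists q, q \notin u.
Proof.
move=> h; apply/existsP; apply: contraNT h; rewrite negb_exists => /forallP h.
by apply/eqP/setP=> i; rewrite inE; apply/negbNE/h.
Qed.

Lemma lapX al : lap (M al set0) = 0.
Proof. by apply: lapM0 => j; rewrite inE. Qed.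

Lemma xX j al : 'x_j (M al set0) = 0.
Proof. by rewrite xM inE. Qed.

Lemma sgX al : sg (M al set0) = M al set0.
Proof. by rewrite sgM cards0 expr0 scale1r. Qed.

Lemma kp_neq k i q : q != i -> kp k i q = 0%N.
Proof. by move=> /negPf h; rewrite /kp /eps h muln0. Qed.

Lemma kp_eq k i : kp k i i = k.
Proof. by rewrite /kp /eps eqxx muln1. Qed.

Lemma zdX al : zd al set0 = (\sum_i al i)%N.
Proof. by rewrite /zd cards0 addn0. Qed.

Lemma zd_kp k i : zd (kp k i) set0 = k.
Proof. by rewrite zdX (bigD1 i) //= big1 ?addn0 ?kp_eq // => j; apply: kp_neq. Qed.

Lemma zd_0 u : zd z0 u = #|u|.
Proof. by rewrite /zd big1. Qed.

Lemma lap_mul_xx0 q y : lap y = 0 -> 'x_q y = 0 -> 'd_q y = 0 -> lap (y ** xx q) = sg y.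
Proof. by move=> h1 h2 h3; rewrite lap_mul_xx // h1 h2 h3 sgnp_zero !mul0x !add0r. Qed.

(** * The even monomials x^(al) *)

Lemma PX k i : (k < p ^ t i)%N -> P (M (kp k i) set0).
Proof.
move=> h; have [q [qi _ iq _]] := pick_neq2 i i.
have tm : tf (M (kp k i) set0 ** xx q) by apply: tf_mul => //; apply: tfM.
have := PQlap tm (PT h iq).
by rewrite lap_mul_xx0 ?lapX ?xX ?dM0 ?kp_neq // sgX.
Qed.

Lemma lap_xi j : lap (xi j) = 0.
Proof. exact: lapM0. Qed.

Lemma x_xi q j : q != j -> 'x_q (xi j) = 0.
Proof. by move=> /negPf h; rewrite xM inE h. Qed.

Lemma d_xi q j : 'd_q (xi j) = 0.
Proof. exact: dM0. Qed.

Lemma Pxi j : P (xi j).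
Proof.
have [q [qj _ jq _]] := pick_neq2 j j.
have tm : tf (xi j ** xx q) by apply: tf_mul => //; apply: tfM.
have := PQlap tm (PS jq).
by rewrite lap_mul_xx0 ?lap_xi ?x_xi ?d_xi //; apply: Psg'.
Qed.

(** As x_q and xi_q do not occur in the first factor, r = 0 in [PmulE], and the only obstruction
    left is a degree congruent to 2 modulo p. *)
Lemma PmulX be v k j q : (k < p ^ t j)%N -> q != j -> q \notin v -> be q = 0%N ->
  (forall i, i \in v -> (be i + kp k j i)%N = 0%N) ->
  (zd be v)%:R - 2%:R != 0 :> F ->
  P (M be v) -> P (M be v ** M (kp k j) set0).
Proof.
move=> hk qj qv bq h0 hz hP; have jq : j != q by rewrite eq_sym.
have := PmulE (f := M be v) (g := M (kp k j) set0) (q := q) (df := (zd be v)%:R) (dg := k%:R) (r := 0).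
rewrite sgX; apply.
- exact: tfM.
- exact: tfM.
- by [].
- exact: PT.
- exact: eulerM.
- by rewrite eulerM zd_kp.
- exact: lapX.
- exact: xX.
- by rewrite dM0 // kp_neq.
- by rewrite xM (negPf qv).
- by rewrite dM0 // mul0x scale0r.
- rewrite Mmul; case: ifP => _; rewrite ?laplace0 // laplaceZ lapM0 ?scaler0 // => i.
  by rewrite setU0 => /h0.
by rewrite mulr0 subr0.
Qed.

Lemma Pmulxi be v j q : q != j -> q \notin v -> be q = 0%N ->
  (forall i, i \in j |: v -> be i = 0%N) ->
  (zd be v)%:R - 2%:R != 0 :> F ->
  P (M be v) -> P (M be v ** xi j).
Proof.
move=> qj qv bq h0 hz hP; have jq : j != q by rewrite eq_sym.
have := PmulE (f := M be v) (g := xi j) (q := q) (df := (zd be v)%:R) (dg := 1) (r := 0).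
rewrite /xi sgM cards1 expr1 scaleN1r mulNr => h; rewrite -[_ ** _]opprK; apply: PN; move: h; apply.
- exact: tfM.
- exact: tfM.
- by [].
- exact: PS.
- exact: eulerM.
- by rewrite eulerM zd_0 cards1.
- exact: lap_xi.
- exact: x_xi.
- exact: d_xi.
- by rewrite xM (negPf qv).
- by rewrite dM0 // mul0x scale0r.
- rewrite laplaceN Mmul; case: ifP => _; rewrite ?laplace0 ?oppr0 // laplaceZ lapM0 ?scaler0 ?oppr0 // => i.
  by rewrite setUC addn0 => /h0.
by rewrite mulr0 subr0.
Qed.

Lemma PXxi k (a b : 'I_n) : (k < p ^ t a)%N -> a != b -> P (M (kp k a) [set b]).
Proof.
move=> hk ab; have [q [qa qb _ _]] := pick_neq2 a b.
have h : P (M z0 [set b] ** M (kp k a) set0).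
  apply: (@PmulX _ _ _ _ q) => //.
  - by rewrite inE.
  - by move=> i; rewrite inE => /eqP ->; rewrite add0n kp_neq // eq_sym.
  - by rewrite zd_0 cards1 -[1%:R]/(1 : F) (_ : 1 - 2%:R = -1) ?oppr_eq0 ?oner_eq0 //; ring.
  exact: Pxi.
apply: Psim h; apply: sim_Mmul => //.
- by rewrite -setI_eq0 setI0.
- by rewrite prod_bin1 ?oner_eq0 // => i; left.
by rewrite setU0.
Qed.

(** Bracketing with x_i xi_j acts as x_i d_j, up to sign; al_i + 1 is the coefficient from the
    product with x_i. *)
Lemma Pmove al i j : i != j -> (0 < al j)%N -> (al i).+1%:R != 0 :> F -> rg al ->
  P (M al set0) -> P (M (subk (addk al 1 i) 1 j) set0).
Proof.
move=> ij aj ai ral hP; have Ni := pN_gt1 charFp t_gt0 i.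
have := PBtf (tfM _ _ _ _ _) (tfM _ _ _ _ _) (PXxi Ni ij) hP.
apply: Psim; apply: (@sim_trans _ _ _ _ (lap (M (addk al 1 i) [set j]))).
  apply: sim_lap; apply: sim_Mmul; last exact: setU0.
  - by rewrite -setI_eq0 setI0.
  - rewrite (prod_bin_at (j := i)) ?kp_eq ?add1n ?bin1 // => l li; left; exact: kp_neq.
  by move=> l; rewrite /addk /kp addnC.
apply: (@sim_lapM1 _ _ _ _ j) => //.
- apply: rg_addk => //; rewrite addn1 ltn_neqAle; apply/andP; split; last by move/forallP: ral; apply.
  (* If al_i were maximal, al_i + 1 would be p^(t i), which is 0 in F. *)
  by apply: contraNneq ai => ->; rewrite natrX (pcharf0 charFp) expr0n eqn0Ngt t_gt0.
- by rewrite inE.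
- by rewrite /addk ltn_addr.
- by move=> l; rewrite inE => ->.
by rewrite setDv.
Qed.

Lemma PR2 be k j q : (k < p ^ t j)%N -> q != j ->
  (\sum_i be i)%:R - 2%:R - (k%:R - c) * (be q)%:R != 0 :> F ->
  'C(be j + k, k)%:R != 0 :> F -> P (M be set0) -> P (M (addk be k j) set0).
Proof.
move=> hk qj hz hC hP; have jq : j != q by rewrite eq_sym.
have h : P (M be set0 ** M (kp k j) set0).
  have := PmulE (f := M be set0) (g := M (kp k j) set0) (q := q)
    (df := (\sum_i be i)%N%:R) (dg := k%:R) (r := (be q)%:R).
  rewrite sgX; apply => //.
  - exact: tfM.
  - exact: tfM.
  - exact: PT.
  - by rewrite eulerM zdX.
  - by rewrite eulerM zd_kp.
  - exact: lapX.
  - exact: xX.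
  - by rewrite dM0 // kp_neq.
  - exact: xX.
  - exact: dM_ev.
  by rewrite Mmul0l laplaceZ lapX scaler0.
apply: Psim h; apply: sim_Mmul => //; last exact: setU0.
  by rewrite -setI_eq0 setI0.
rewrite (prod_bin_at (j := j)) => [|i ij]; last by right; exact: kp_neq.
by rewrite kp_eq -bin_sub ?leq_addr // addKn.
Qed.

Lemma one_X : one = M z0 set0.
Proof. by rewrite /xmon imset0. Qed.

(* The obstruction to reaching x^(al) by multiplying x^(al - al_j e_j) by x_j^(al_j). *)
Definition stuck al : bool := [forall j, forall q, ((0 < al j)%N && (q != j)) ==>
  ((\sum_i al i)%:R - 2%:R - (al j)%:R == ((al j)%:R - c) * (al q)%:R)].

Lemma stuckP al j q : stuck al -> (0 < al j)%N -> q != j ->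
  (\sum_i al i)%:R - 2%:R - (al j)%:R = ((al j)%:R - c) * (al q)%:R.
Proof.
by move=> /forallP/(_ j)/forallP/(_ q) h aj qj; move: h; rewrite aj qj => /eqP.
Qed.

(** The induction hypothesis of [PX_all]. *)
Definition below_ok (s : nat) : Prop := forall be, rg be ->
  (\sum_i be i < s)%N -> (exists i, be i != pim i) -> P (M be set0).

Lemma sum_subk al k j : (k <= al j)%N ->
  (\sum_i subk al k j i + k = \sum_i al i)%N.
Proof.
move=> h; rewrite (bigD1 j) //= [in RHS](bigD1 j) //= /subk /eps eqxx muln1 addnAC subnK //.
by congr (_ + _)%N; apply: eq_bigr => i /negPf ->; rewrite muln0 subn0.
Qed.

Lemma sum_addk al k j : (\sum_i addk al k j i = \sum_i al i + k)%N.
Proof.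
rewrite (bigD1 j) //= [in RHS](bigD1 j) //= /addk /eps eqxx muln1 addnAC.
by congr (_ + _ + _)%N; apply: eq_bigr => i /negPf ->; rewrite muln0 addn0.
Qed.

Lemma subkK al k j : (k <= al j)%N -> addk (subk al k j) k j =1 al.
Proof.
move=> h i; rewrite /addk /subk /eps; case: eqP => [->|_]; first by rewrite muln1 subnK.
by rewrite muln0 subn0 addn0.
Qed.

Lemma subk_neq al k j i : i != j -> subk al k j i = al i.
Proof. by move=> /negPf h; rewrite /subk /eps h muln0 subn0. Qed.
Lemma subk_eq al k j : subk al k j j = (al j - k)%N.
Proof. by rewrite /subk /eps eqxx muln1. Qed.
Lemma addk_neq al k j i : i != j -> addk al k j i = al i.
Proof. by move=> /negPf h; rewrite /addk /eps h muln0 addn0. Qed.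
Lemma addk_eq al k j : addk al k j j = (al j + k)%N.
Proof. by rewrite /addk /eps eqxx muln1. Qed.

Lemma rg_subk al k j : rg al -> rg (subk al k j).
Proof. by apply: rg_le => i; apply: leq_subr. Qed.

Lemma rg_lt al j : rg al -> (al j < p ^ t j)%N.
Proof. by move/forallP; apply. Qed.

Lemma subk_not_full al k j : rg al -> (0 < k)%N -> (0 < al j)%N -> exists i, subk al k j i != pim i.
Proof.
move=> ral k0 aj; exists j; rewrite subk_eq /pim neq_ltn; apply/orP; left.
have := rg_lt j ral; have := pN_gt1 charFp t_gt0 j; move: (p ^ t j)%N (al j) aj; lia.
Qed.

(** Strip the whole power of x_j and multiply it back: the exponent of x_j is then 0 beforehand, so
    the binomial coefficient is 1. *)
Lemma PX_unstuck al : rg al -> below_ok (\sum_i al i) -> ~~ stuck al -> P (M al set0).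
Proof.
move=> ral IH; rewrite negb_forall => /existsP[j]; rewrite negb_forall => /existsP[q].
rewrite negb_imply => /andP[/andP[aj qj] hz].
rewrite -(Meq _ (@subkK al _ j (leqnn _))); apply: (@PR2 _ _ _ q) => //.
- exact: rg_lt.
- rewrite subk_neq //; move: hz; apply: contraNneq => /eqP.
  rewrite subr_eq0 => /eqP <-; rewrite -(@sum_subk al _ j (leqnn _)) natrD; apply/eqP; ring.
- by rewrite subk_eq subnn add0n binn oner_eq0.
apply: IH; first exact: rg_subk.
  by rewrite -(@sum_subk al _ j (leqnn _)) -[X in (X < _)%N]addn0 ltn_add2l.
exact: subk_not_full.
Qed.

(* If x^(al) is stuck but x_j x_i^-1 x^(al) is not, then x_i d_j leads to x^(al). *)
Lemma PX_move al i j : rg al -> below_ok (\sum_i al i) -> i != j -> (0 < al i)%N ->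
  (al i)%:R != 0 :> F -> (al j < pim j)%N -> ~~ stuck (subk (addk al 1 j) 1 i) ->
  P (M al set0).
Proof.
move=> ral IH ij ai ai0 aj hs; have ji : j != i by rewrite eq_sym.
set be := subk (addk al 1 j) 1 i in hs *.
have ai' : (0 < addk al 1 j i)%N by rewrite addk_neq.
have rbe : rg be.
  apply: rg_subk; apply: rg_addk => //.
  move: aj; rewrite /pim; have := pN_gt1 charFp t_gt0 j; move: (p ^ t j)%N (al j); lia.
have sbe : (\sum_i be i = \sum_i al i)%N.
  by apply/eqP; rewrite -(eqn_add2r 1) sum_subk // sum_addk.
have hbe : P (M be set0) by apply: PX_unstuck; rewrite ?sbe.
rewrite -(Meq _ (_ : subk (addk be 1 i) 1 j =1 al)).
  apply: Pmove => //; first by rewrite /be subk_neq // addk_eq addn1.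
  by rewrite /be subk_eq addk_neq // subn1 prednK.
move=> l; rewrite /subk (subkK (j := i)) // /addk.
by rewrite addnK.
Qed.

Lemma lt_pim al j : rg al -> (al j < pim j)%N = (al j != pim j).
Proof.
move=> /(rg_lt j); rewrite /pim; have := pN_gt1 charFp t_gt0 j.
move: (p ^ t j)%N (al j) => N x N1 xN; apply/idP/idP; lia.
Qed.

Lemma pred_natr k : (0 < k)%N -> (k - 1)%N%:R = k%:R - 1 :> F.
Proof. by move=> k0; rewrite natrB. Qed.

Lemma pim_natr j : (pim j)%:R = -1 :> F.
Proof.
have N1 := pN_gt1 charFp t_gt0 j.
rewrite /pim -subn1 natrB ?(ltnW N1) // natrX (pcharf0 charFp) expr0n.
by rewrite eqn0Ngt t_gt0 sub0r.
Qed.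

Section Stuck.
Variable al : 'I_n -> nat.
Hypothesis ral : rg al.
Hypothesis al_nf : exists i, al i != pim i.
Hypothesis IH : below_ok (\sum_i al i).
Hypothesis hs : stuck al.
Local Notation s := ((\sum_i al i)%:R - 2%:R : F).
Local Notation a i := ((al i)%:R : F).

Let sum_move i j : i != j -> (0 < al i)%N ->
  (\sum_l subk (addk al 1 j) 1 i l = \sum_l al l)%N.
Proof.
move=> ij ai; apply/eqP; rewrite -(eqn_add2r 1) sum_subk ?sum_addk //.
by rewrite addk_neq.
Qed.

(** Taking q = q0 in [stuckP] shows that all positive entries equal s in F, and two of them give s =
    c. Moving a unit to a positive entry that is not maximal unsticks the exponent, since s + 1
    differs from s. If all positive entries are maximal then s = c = -1, and moving a unit to q0
    unsticks it because 2 is invertible. *)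
Lemma PX_stuck_zero i1 i2 q0 : i1 != i2 -> (0 < al i1)%N -> (0 < al i2)%N -> al q0 = 0%N ->
  P (M al set0).
Proof.
move=> i12 a1 a2 q00.
have sup j : (0 < al j)%N -> a j = s.
  move=> aj; have qj : q0 != j by apply: contraTneq aj => <-; rewrite q00.
  by have := stuckP hs aj qj; rewrite q00 mulr0 => /eqP; rewrite subr_eq0 => /eqP.
have s0 : s != 0.
  apply: contraNneq two0 => h; have : (\sum_i al i)%:R = 0 :> F.
    rewrite natr_sum big1 // => i _; case: (posnP (al i)) => [->//|ai].
    by rewrite sup.
  by move=> h2; move: h; rewrite h2 sub0r => /eqP; rewrite oppr_eq0.
have sc : s = c.
  have := stuckP hs a1 (q := i2); rewrite eq_sym i12 => /(_ isT).
  rewrite !sup // subrr => /esym/eqP; rewrite mulf_eq0 (negPf s0) orbF subr_eq0.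
  by move/eqP.
have i1q : i1 != q0 by apply: contraTneq a1 => ->; rewrite q00.
have i2q : i2 != q0 by apply: contraTneq a2 => ->; rewrite q00.
have [/existsP[j /andP[aj ljt]]|] := boolP [exists j, (0 < al j)%N && (al j < pim j)%N].
  have [i ij ai] : exists2 i, i != j & (0 < al i)%N.
    by have [<-|] := eqVneq i1 j; [exists i2; rewrite // eq_sym | exists i1].
  apply: (PX_move ral IH ij) => //; first by rewrite sup.
  apply/negP => hs'; have jq : q0 != j by apply: contraTneq aj => <-; rewrite q00.
  have iq : q0 != i by apply: contraTneq ai => <-; rewrite q00.
  have ji : j != i by rewrite eq_sym.
  have := stuckP hs' (j := j) (q := q0); rewrite sum_move // !(subk_neq _ _ ji) (subk_neq _ _ iq) addk_eq (addk_neq _ _ jq) q00 mulr0.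
  rewrite jq => /(_ (ltn_addr _ aj) isT) /eqP.
  rewrite natrD sup // [X in X == _](_ : _ = -1); last by ring.
  by rewrite oppr_eq0 oner_eq0.
move=> hall; have full j : (0 < al j)%N -> al j = pim j.
  move=> aj; apply/eqP; apply: contraNT hall => h; apply/existsP; exists j.
  by rewrite aj lt_pim.
have sm1 : s = -1 by rewrite -(sup i1 a1) full // pim_natr.
apply: (PX_move ral IH i1q) => //; first by rewrite sup.
  by rewrite q00 /pim -subn1 subn_gt0 (pN_gt1 charFp t_gt0).
apply/negP => hs'; have qi : q0 != i1 by rewrite eq_sym.
have := stuckP hs' (j := q0) (q := i1); rewrite sum_move // (subk_neq _ _ qi) addk_eq subk_eq (addk_neq _ _ i1q).
rewrite q00 i1q => /(_ isT isT); rewrite pred_natr // (sup i1 a1) -sc sm1 add0n.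
move=> /eqP; rewrite -subr_eq0 (_ : _ - _ = 2%:R); last by ring.
by rewrite (negPf two0).
Qed.

(** If all entries equal x in F, then x is nonzero, and the exponent with entries x + 1, x - 1, x at
    three indices is not stuck: otherwise c = x + 1, which forces x = 0. If two entries differ, a
    third index gives s = c; then all entries but one are -1, so c = -1, and one adds a single
    factor x_j in place of the whole power. *)
Lemma PX_stuck_full : (forall i, (0 < al i)%N) -> P (M al set0).
Proof.
move=> pos; have st j q : q != j -> s - a j = (a j - c) * a q by move=> qj; apply: stuckP.
have [/forallP eqa|] := boolP [forall i, forall j, a i == a j].
  have ea i j : a i = a j by apply/eqP; have /forallP := eqa i; apply.
  have [j0 /eqP hj0] := al_nf.
  have [i [ij _ ji _]] := pick_neq2 j0 j0; have [l [li lj il jl]] := pick_neq2 i j0.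
  have an0 : a i != 0.
    apply: contraNneq two0 => h; have := st i j0 ji; rewrite (ea j0 i) h mulr0 subr0.
    rewrite natr_sum big1 => [|k _]; last by rewrite (ea k i).
    by move/eqP; rewrite sub0r oppr_eq0.
  apply: (@PX_move al i j0) => //; first by rewrite lt_pim //; apply/eqP.
  apply/negP => hs'.
  have e1 := stuckP hs' (j := j0) (q := i); have e2 := stuckP hs' (j := j0) (q := l).
  have e3 := stuckP hs' (j := l) (q := i).
  move: e1 e2 e3; rewrite sum_move // !(subk_neq _ _ ji) !(subk_neq _ _ li) !subk_eq.
  rewrite addk_eq !(addk_neq _ _ ij) !(addk_neq _ _ lj) pos ij il lj.
  have j0p : (0 < al j0 + 1)%N by rewrite addn1.
  move=> /(_ j0p isT) e1 /(_ j0p isT) e2 /(_ isT isT) e3.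
  move: e1 e2 e3; rewrite pred_natr // natrD (ea j0 i) (ea l i); set x := a i.
  move=> e1 e2 e3.
  have ec : x + 1 - c = 0.
    have : (x + 1 - c) * x - (x + 1 - c) * (x - 1) = 0 by rewrite -e1 -e2 subrr.
    by move=> <-; ring.
  have e4 : s - x = 1.
    by rewrite (_ : s - x = s - (x + 1) + 1); [rewrite e2 ec mul0r add0r | ring].
  move: e3; rewrite e4 (_ : x - c = -1).
    by rewrite mulN1r opprB => /eqP; rewrite -subr_eq0 opprB addrCA subrr addr0 (negPf an0).
  by rewrite -[RHS]add0r -ec; ring.
rewrite negb_forall => /existsP[j1]; rewrite negb_forall => /existsP[j2 a12].
have j12 : j1 != j2 by apply: contraNneq a12 => ->.
have [l [l1 l2 _ _]] := pick_neq2 j1 j2.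
have alc : a l = c.
  have := st l j1; have := st l j2; rewrite !(eq_sym _ l) => /(_ l2) h2 /(_ l1) h1.
  have /eqP : (a l - c) * (a j1 - a j2) = 0 by rewrite mulrBr -h1 -h2 subrr.
  by rewrite mulf_eq0 [X in _ || X]subr_eq0 (negPf a12) orbF subr_eq0 => /eqP.
have sc : s = c.
  have := st l j1; rewrite eq_sym => /(_ l1); rewrite alc subrr mul0r => /eqP.
  by rewrite subr_eq0 => /eqP.
have [i0 ai0c] : exists i0, a i0 != c.
  by have [e|] := eqVneq (a j1) c; [exists j2; rewrite -e eq_sym | exists j1].
have am1 q : q != i0 -> a q = -1.
  move=> qi; have := st i0 q qi; rewrite sc => h.
  have /eqP : (a i0 - c) * (a q + 1) = 0 by rewrite mulrDr -h mulr1; ring.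
  by rewrite mulf_eq0 subr_eq0 (negPf ai0c) /= addr_eq0 => /eqP.
have cm1 : c = -1.
  by rewrite -alc am1 //; apply: contraNneq ai0c => <-; rewrite alc.
have [j [ji _ ij _]] := pick_neq2 i0 i0.
rewrite -(Meq _ (@subkK al 1 j (pos j))); apply: (@PR2 _ _ _ i0) => //.
- exact: (pN_gt1 charFp t_gt0).
(* With s = c = -1 the obstruction for k = 1 is s - 1 - (1 - c) a_i0 = - 2 (a_i0 + 1), nonzero as
   a_i0 is not c. *)
- rewrite subk_neq // (_ : _ - _ = - 2%:R * (a i0 - c)).
    by rewrite mulf_neq0 ?oppr_eq0 ?subr_eq0.
  have -> : (\sum_i subk al 1 j i)%:R = s + 1.
    rewrite -(@sum_subk al 1 j (pos j)) natrD; ring.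
  by rewrite sc cm1; ring.
- by rewrite subk_eq subnK // bin1 am1 // oppr_eq0 oner_eq0.
apply: IH; first exact: rg_subk.
  by rewrite -(@sum_subk al 1 j (pos j)) addn1.
exact: subk_not_full.
Qed.

End Stuck.

(** Strong induction on the degree. A stuck exponent with at most one positive entry is covered by
    [PX]; otherwise it either has a zero entry or none. *)
Lemma PX_all al : rg al -> (exists i, al i != pim i) -> P (M al set0).
Proof.
have [s] := ubnP (\sum_i al i)%N; elim: s al => // s IHs al; rewrite ltnS => les ral nf.
have IH : below_ok (\sum_i al i).
  by move=> be rbe lt nfb; apply: IHs => //; apply: leq_trans lt les.
have [hs|] := boolP (stuck al); last exact: PX_unstuck.
have [/existsP[i1 a1]|] := boolP [exists i, (0 < al i)%N]; last first.
  rewrite negb_exists => /forallP h; rewrite (Meq _ (_ : al =1 z0)) -?one_X //.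
  by move=> i; apply/eqP; rewrite -leqn0 leqNgt.
have [/existsP[i2 /andP[i12 a2]]|] := boolP [exists i, (i1 != i) && (0 < al i)%N]; last first.
  rewrite negb_exists => /forallP h; rewrite (Meq _ (_ : al =1 kp (al i1) i1)).
    by apply: PX; apply: rg_lt.
  move=> i; have [->|ii] := eqVneq i i1; first by rewrite kp_eq.
  by rewrite kp_neq //; apply/eqP; rewrite -leqn0 leqNgt; have := h i; rewrite eq_sym ii.
have [/existsP[q0 /eqP q00]|] := boolP [exists i, al i == 0%N].
  exact: (PX_stuck_zero ral IH hs i12 a1 a2 q00).
rewrite negb_exists => /forallP h; apply: PX_stuck_full => // i.
by rewrite lt0n.
Qed.

(** * The odd monomials xi^u *)

Lemma natF_neq1 : 1 - 2%:R != 0 :> F.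
Proof. by rewrite (_ : 1 - 2%:R = -1) ?oppr_eq0 ?oner_eq0 //; ring. Qed.

Lemma disjC1 j u : [disjoint u & [set j]] = (j \notin u).
Proof. by rewrite disjoint_sym disjoints1. Qed.

Lemma setUD1 j u : j \in u -> u :\ j :|: [set j] = u.
Proof. by move=> ju; rewrite setUC setD1K. Qed.

Lemma pN_gt3 i : (3 < p ^ t i)%N.
Proof.
have p3 : (3 < p)%N.
  have := p_gt1 charFp; case: p (charFp) => [|[|[|[|//]]]] // h _.
    by move: two0; rewrite (pcharf0 h) eqxx.
  by move: three0; rewrite (pcharf0 h) eqxx.
by apply: leq_trans p3 _; rewrite -{1}(expn1 p) leq_exp2l ?(p_gt1 charFp) ?t_gt0.
Qed.

(** Normally one multiplies by the last xi_j, which fails when #|u| - 1 is 2 in F. Then two factors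
    xi_a, xi_j are left out, x_i^(2) is multiplied on for some i outside [u], and brackets with xi_a
    xi_i and xi_j xi_i trade each x_i for one missing factor. *)
Lemma Pxi_all u : u != setT -> P (M z0 u).
Proof.
have [s] := ubnP #|u|; elim: s u => // s IHs u; rewrite ltnS => les hu.
have [->|[j ju]] := set_0Vmem u; first by rewrite -one_X.
have uj : (#|u :\ j| < s)%N by rewrite (leq_trans _ les) // [in X in (_ < X)%N](cardsD1 j) ju.
have nT v : (#|v| < #|u|)%N -> v != setT.
  by move=> h; apply: contraTneq h => ->; rewrite cardsT card_ord -leqNgt -[X in (_ <= X)%N](card_ord n) max_card.
have ujT : u :\ j != setT by apply: nT; rewrite [X in (_ < X)%N](cardsD1 j) ju.
have hP := IHs _ uj ujT.
have [q qu] := pick_notin hu.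
have [z|] := eqVneq ((#|u :\ j|)%:R - 2%:R : F) 0; last first.
  move=> nz; have h : P (M z0 (u :\ j) ** xi j).
    apply: (@Pmulxi _ _ _ q) => //.
    - by apply: contraNneq qu => ->.
    - by rewrite !inE (negPf qu) andbF.
    by rewrite zd_0.
  apply: Psim h; apply: sim_Mmul => //; last exact: setUD1.
    by rewrite disjC1 setD11.
  by rewrite prod_bin1 ?oner_eq0 // => i; left.
have [e|[a]] := set_0Vmem (u :\ j).
  by move: z; rewrite e cards0 sub0r => /eqP; rewrite oppr_eq0 (negPf two0).
move=> auj; move: (auj); rewrite !inE => /andP[aj au].
have [i iu] := pick_notin hu.
have iw (b : 'I_n) : b \in u -> i != b by move=> h; apply: contraNneq iu => ->.
set w0 := u :\ j :\ a.
have cw : #|u :\ j| = #|w0|.+1 by rewrite (cardsD1 a) auj.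
(* [z] excludes #|u| = 2, since 1 and 2 differ in F; so the pairs in [P2] are covered by
   induction. *)
have card2 : (2 < #|u|)%N.
  have cu : #|u| = #|u :\ j|.+1 by rewrite (cardsD1 j) ju.
  rewrite cu ltnS cw ltnS lt0n cards_eq0; apply/eqP => h.
  by move/eqP: z; rewrite cw h cards0 (negPf natF_neq1).
have h1 : P (M (kp 2 i) w0).
  have hw : P (M z0 w0).
    apply: IHs; first by apply: leq_trans uj; rewrite cw ltnS.
    by apply: nT; rewrite [X in (_ < X)%N](cardsD1 j) ju cw ltnS ltnW.
  have h : P (M z0 w0 ** M (kp 2 i) set0).
    apply: (@PmulX _ _ _ _ a) => //.
    - exact: ltnW (pN_gt3 i).
    - by rewrite eq_sym iw.
    - by rewrite !inE eqxx.
    - move=> l; rewrite !inE => /andP[_ /andP[_ lu]]; rewrite kp_neq // eq_sym iw //.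
    rewrite zd_0; have : (#|w0|)%:R + 1 - 2%:R = 0 :> F by rewrite natr1 -cw.
    move=> e; apply: contraNneq (oner_neq0 F) => e2; apply/eqP.
    by rewrite -[1]addr0 -[X in _ + X]e2 addrA [1 + _]addrC.
  apply: Psim h; apply: sim_Mmul; rewrite ?setU0 //.
    by rewrite -setI_eq0 setI0.
  by rewrite prod_bin1 ?oner_eq0 // => l; left.
have P2 (b : 'I_n) : b \in u -> P (M z0 [set b; i]).
  move=> bu; have c2 : #|[set b; i]| = 2 by rewrite cards2 eq_sym iw.
  by apply: IHs; rewrite ?nT ?c2 // (leq_trans card2).
have step (b : 'I_n) k v v' : b \in u -> b \notin v -> v' = b |: v -> i \notin v -> (k.+1 < p ^ t i)%N ->
    P (M (kp k.+1 i) v) -> P (M (kp k i) v').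
  move=> bu bv -> iv hk hPv; have := PBtf (tfM _ _ _ _ _) (tfM _ _ _ _ _) (P2 b bu) hPv.
  apply: Psim; apply: (@sim_trans _ _ _ _ (lap (M (kp k.+1 i) ([set b; i] :|: v)))).
    apply: sim_lap; apply: sim_Mmul => //.
      by rewrite -setI_eq0 setIUl setU_eq0 !setI_eq0 !disjoints1 bv iv.
    by rewrite prod_bin1 ?oner_eq0 // => l; left.
  apply: (@sim_lapM1 _ _ _ _ i) => //.
  - by apply: (rg_kp charFp t_gt0 hk).
  - by rewrite !inE eqxx orbT.
  - by rewrite kp_eq.
  - by move=> l _; exact: kp_neq.
  - move=> l; have [->|li] := eqVneq l i; first by rewrite subk_eq !kp_eq subn1.
    by rewrite subk_neq // !kp_neq.
  apply/setP=> l; rewrite !inE; have [->|li] := eqVneq l i; last by rewrite orbF.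
  by rewrite /= (negPf iv) orbF; apply/esym/negbTE; exact: iw.
have h2 : P (M (kp 1 i) (u :\ j)).
  apply: (step a 1%N w0) => //.
  - by rewrite setD11.
  - by rewrite setD1K.
  - by rewrite !inE (negPf iu) !andbF.
  exact: ltnW (pN_gt3 i).
rewrite (Meq _ (_ : z0 =1 kp 0 i)); last by move=> l; rewrite /kp.
apply: (step j 0%N (u :\ j)) => //.
- by rewrite setD11.
- by rewrite setD1K.
- by rewrite !inE (negPf iu) !andbF.
exact: (pN_gt1 charFp t_gt0).
Qed.

(** * Laplacians of monomials other than the top one *)

Lemma mul_lap1 i f m : (forall j, j != i -> f ** 'd_j ('x_j m) = 0) ->
  f ** lap m = f ** 'd_i ('x_i m).
Proof. by move=> h; rewrite laplaceE mul_sumr (bigD1 i) //= big1 ?addr0. Qed.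

Lemma tf_lapM al u : tf (lap (M al u)).
Proof. by apply: tf_lap => //; apply: tfM. Qed.

Lemma Plap_generic al u : rg al -> (exists i, al i != pim i) -> u != setT ->
  P (lap (M al u)).
Proof.
move=> ral nf hu; have := PBtf (tfM _ _ _ _ _) (tfM _ _ _ _ _) (PX_all ral nf) (Pxi_all hu).
apply: Psim; apply: sim_lap; apply: sim_Mmul.
- by rewrite -setI_eq0 set0I.
- by rewrite prod_bin1 ?oner_eq0 // => l; right.
- by move=> l; rewrite addn0.
exact: set0U.
Qed.

Lemma set2_neqT i j : [set i; j] != setT.
Proof.
have [q [qi qj _ _]] := pick_neq2 i j; apply: contraTneq (in_setT q) => <-.
by rewrite !inE negb_or qi qj.
Qed.

Lemma disjM0 al be u v l : l \in u -> l \in v -> M al u ** M be v = 0.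
Proof.
move=> lu lv; rewrite Mmul ifF //; apply/negbTE; rewrite -setI_eq0.
by apply/set0Pn; exists l; rewrite inE lu lv.
Qed.

Lemma Plap_top_odd_gen al l : rg al -> (al l < pim l)%N ->
  (exists i, addk al 1 l i != pim i) -> P (lap (M al setT)).
Proof.
move=> ral al_l nf; have [j [jl _ lj _]] := pick_neq2 l l.
have Tj : ~: [set j] != setT.
  by apply/eqP => /setP/(_ j); rewrite !inE eqxx.
have ra : rg (addk al 1 l).
  by apply: rg_addk => //; move: al_l; rewrite /pim; have := pN_gt1 charFp t_gt0 l; move: (p ^ t l)%N (al l); lia.
have := PBtf (tfM _ _ _ _ _) (tf_lapM _ _) (Pxi_all Tj) (Plap_generic ra nf (set2_neqT l j)).
apply: Psim; apply: sim_lap.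
rewrite (mul_lap1 (i := l)) => [|i il]; last first.
  rewrite xM !inE (negPf il); case: eqVneq => [ij|_]; last by rewrite epartial0 mulx0.
  rewrite epartialZ mulZr dM //; case: ifP => _; last by rewrite mulx0 scaler0.
  by rewrite (@disjM0 _ _ _ _ l) ?scaler0 ?inE ?eqxx ?lj // eq_sym il.
apply: sim_trans (sim_mull _ (sim_dxM _ _ _ _)) _ => //.
- by rewrite !inE eqxx.
- by rewrite addk_eq addn1.
have -> : [set l; j] :\ l = [set j].
  by apply/setP=> i; rewrite !inE; case: eqVneq => // ->; rewrite (negPf lj).
apply: sim_Mmul.
- by rewrite disjC1 !inE eqxx.
- by rewrite prod_bin1 ?oner_eq0 // => i; left.
- move=> i; rewrite add0n; have [->|il] := eqVneq i l; first by rewrite subk_eq addk_eq addnK.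
  by rewrite subk_neq // addk_neq.
by rewrite setUC setUCr.
Qed.

Lemma rg_pim' : rg pim. Proof. exact: (rg_pim charFp t_gt0). Qed.

Lemma pim_ge3 i : (2 < pim i)%N.
Proof. by have := pN_gt3 i; rewrite /pim; move: (p ^ t i)%N; lia. Qed.

(** The case left over is al = pi - e_b. There x_a^(2) xi_b is bracketed with the Laplacian of x^(pi
    - 2 e_a) times the full odd monomial; only the b-th term, which lost xi_b, survives. *)
Lemma Plap_odd_full al : rg al -> (exists i, al i != pim i) -> P (lap (M al setT)).
Proof.
move=> ral [b hb]; have bl : (al b < pim b)%N by rewrite lt_pim.
have [/existsP[i hi]|] := boolP [exists i, addk al 1 b i != pim i].
  by apply: (Plap_top_odd_gen ral bl); exists i.
rewrite negb_exists => /forallP hall.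
have alE : al =1 subk pim 1 b.
  move=> i; have := hall i; rewrite negbK => /eqP; have [->|ib] := eqVneq i b.
    by rewrite addk_eq subk_eq => <-; rewrite addnK.
  by rewrite addk_neq // subk_neq.
rewrite (Meq _ alE); have [a [ab _ ba _]] := pick_neq2 b b.
have h2 : P (lap (M (subk pim 2 a) setT)).
  have ltp : (pim a - 2 + 1 < pim a)%N by have := pim_ge3 a; lia.
  apply: (@Plap_top_odd_gen _ a).
  - exact: rg_subk rg_pim'.
  - by rewrite subk_eq; move: ltp; lia.
  by exists a; rewrite addk_eq subk_eq neq_ltn ltp.
have := PBtf (tfM _ _ _ _ _) (tf_lapM _ _) (PXxi (ltnW (pN_gt3 a)) ab) h2.
apply: Psim; apply: sim_lap.
have rs : rg (subk pim 2 a) := rg_subk 2 a rg_pim'.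
rewrite (mul_lap1 (i := b)) => [|i ib]; last first.
  rewrite xM inE epartialZ mulZr dM //; case: ifP => _; last by rewrite mulx0 scaler0.
  by rewrite (@disjM0 _ _ _ _ b) ?scaler0 ?inE ?eqxx // eq_sym ib.
apply: sim_trans (sim_mull _ (sim_dxM _ _ _ _)) _ => //.
- by rewrite inE.
- by rewrite subk_neq //; apply: leq_trans (pim_ge3 b).
apply: sim_Mmul.
- by rewrite disjoint_sym disjC1 setD11.
- rewrite (prod_bin_at (j := a)) => [|i ia]; last by left; exact: kp_neq.
  rewrite kp_eq (subk_neq _ _ ab) subk_eq subnKC; last exact: ltnW (pim_ge3 a).
  by rewrite bin_pred_pchar ?signr_eq0 //; apply: ltnW (pN_gt3 a).
- move=> i; have [->|ia] := eqVneq i a.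
    rewrite kp_eq !(subk_neq _ _ ab) subk_eq subnKC //; exact: ltnW (pim_ge3 a).
  rewrite kp_neq // add0n; have [->|ib] := eqVneq i b; first by rewrite !subk_eq subk_neq.
  by rewrite !subk_neq.
by rewrite setD1K.
Qed.

(** For l outside [u], bracket x^(pi - e_j) with the Laplacian of x_j x_l xi_l xi^u. The l-th term
    restores x^(pi) with coefficient pi_j = -1 up to sign; the j-th keeps x_l, which leaves the
    range. *)
Lemma Plap_even_full u : u != setT -> P (lap (M pim u)).
Proof.
move=> hu; have [l lu] := pick_notin hu; have [j [jl _ lj _]] := pick_neq2 l l.
have hf : P (M (subk pim 1 j) set0).
  apply: PX_all; first exact: rg_subk rg_pim'.
  exists j; rewrite subk_eq neq_ltn; apply/orP; left; have := pim_ge3 j; lia.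
set be := addk (eps j) 1 l.
have bel : be l = 1%N by rewrite /be addk_eq /eps (negPf lj).
have bej : be j = 1%N by rewrite /be addk_neq // /eps eqxx.
have be0 i : i != l -> i != j -> be i = 0%N by move=> il ij; rewrite /be addk_neq // /eps (negPf ij).
have rbe : rg be.
  apply/forallP=> i; have := pN_gt3 i.
  have [->|il] := eqVneq i l; first by rewrite bel; lia.
  have [->|ij] := eqVneq i j; first by rewrite bej; lia.
  by rewrite be0 //; lia.
have nbe : exists i, be i != pim i.
  by exists l; rewrite bel; have := pim_ge3 l; lia.
have h2 : P (lap (M be (l |: u))).
  by have [->|hT] := eqVneq (l |: u) setT; [apply: Plap_odd_full | apply: Plap_generic].
have := PBtf (tfM _ _ _ _ _) (tf_lapM _ _) hf h2.
apply: Psim; apply: sim_lap.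
rewrite (mul_lap1 (i := l)) => [|i il]; last first.
  have [ij|ij] := eqVneq i j; last by rewrite dxM0 ?mulx0 // => _; apply: be0.
  rewrite xM; case: ifP => _; last by rewrite epartial0 mulx0.
  rewrite epartialZ mulZr dM // ij bej /= Mmul0l Mout ?scaler0 //.
  apply/forallPn; exists l; rewrite subk_neq // subk_neq // bel addn1 /pim prednK -?leqNgt //.
  exact: ltnW (pN_gt1 charFp t_gt0 l).
apply: sim_trans (sim_mull _ (sim_dxM _ _ _ _)) _ => //.
- by rewrite !inE eqxx.
- by rewrite bel.
apply: sim_Mmul.
- by rewrite -setI_eq0 set0I.
- rewrite (prod_bin_at (j := j)) => [|i ij].
    rewrite subk_eq subk_neq // bej subnK; last by have := pim_ge3 j; lia.
    rewrite -bin_sub ?leq_subr // subKn; last by have := pim_ge3 j; lia.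
    by rewrite bin1 pim_natr oppr_eq0 oner_eq0.
  right; have [->|il] := eqVneq i l; first by rewrite subk_eq bel.
  by rewrite subk_neq // be0.
- move=> i; have [->|ij] := eqVneq i j.
    rewrite subk_eq subk_neq // bej subnK //; have := pim_ge3 j; lia.
  rewrite subk_neq //; have [->|il] := eqVneq i l; first by rewrite subk_eq bel addn0.
  by rewrite subk_neq // be0 // addn0.
by rewrite set0U setU1K.
Qed.

Definition is_top al u : bool := [forall i, al i == pim i] && (u == setT).

Lemma PlapM al u : rg al -> ~~ is_top al u -> P (lap (M al u)).
Proof.
move=> ral; rewrite /is_top negb_and negb_forall.
have [->|hu] := eqVneq u setT; first by rewrite orbF => /existsP; apply: Plap_odd_full.
move=> _; have [/forallP h|] := boolP [forall i, al i == pim i].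
  by rewrite (Meq _ (_ : al =1 pim)); [apply: Plap_even_full | move=> i; apply/eqP/h].
by rewrite negb_forall => /existsP h; apply: Plap_generic.
Qed.

(** * The elements [Q m] and the top monomial *)

Lemma tf_ev j : tf (ev j). Proof. exact: tfM. Qed.
Lemma tf_xi j : tf (xi j). Proof. exact: tfM. Qed.

Lemma lap_mul_xi y j : lap (y ** xi j) = lap y ** xi j + sg ('d_j y).
Proof.
have := laplace_mul charFp (sg y) (xi j); rewrite sgnpK => ->; rewrite lap_xi mulx0 addr0.
congr (_ + _); rewrite (bigD1 j) //= big1 ?addr0 => [|i ij].
  rewrite d_xi mulx0 add0r /xi xM inE eqxx cnt1 expr0 scale1r setDv -one_X mulx1 //.
  by rewrite sgnp_epartial.
by rewrite d_xi x_xi // !mulx0 addr0.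
Qed.

Lemma lap_mul_ev y j : lap (y ** ev j) = lap y ** ev j + 'x_j y.
Proof.
have := laplace_mul charFp (sg y) (ev j); rewrite sgnpK => ->; rewrite lapX mulx0 addr0.
congr (_ + _); rewrite (bigD1 j) //= big1 ?addr0 => [|i ij].
  by rewrite d_ev // eqxx xX mulx0 addr0 mulx1.
by rewrite d_ev // (negPf ij) xX !mulx0 addr0.
Qed.

Lemma euler_xixx j q : euler (xi j ** xx q) = 3%:R *: (xi j ** xx q).
Proof.
rewrite euler_mul // euler_xx eulerM zd_0 cards1 mulZl mulZr -scalerDl; congr (_ *: _); ring.
Qed.

Lemma euler_evxx j q : euler (ev j ** xx q) = 3%:R *: (ev j ** xx q).
Proof.
rewrite euler_mul // euler_xx /ev eulerM (_ : zd _ _ = 1%N).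
  rewrite mulZl mulZr -scalerDl; congr (_ *: _); ring.
have := zd_kp 1 j; rewrite !zdX => <-; apply: eq_bigr => i _.
by rewrite /kp mul1n.
Qed.

(* Modulo the image of the Laplacian, bracketing lap y with the elements
   Q (xi_j x_q xi_q) and Q (x_j x_q xi_q) of degree one differentiates y. *)
Lemma Q_epartial y j q : tf y -> q != j ->
  Q (sg ('d_j y)) = Del (c + 2%:R) (lap y ** Q (xi j ** xx q)) + Q (lap (y ** xi j))
    - (1 - c) *: lap (lap y ** sg (xi j ** xx q)).
Proof.
move=> ty qj; have tm : tf (xi j ** xx q) by apply: tf_mul; rewrite ?tfM //; exact: tfM.
rewrite (Del_mulQ (tf_lap ty) tm (euler_xixx j q)).
have -> : lap (xi j ** xx q) = - xi j.
  by rewrite lap_mul_xx0 ?lap_xi ?x_xi ?d_xi // /xi sgM cards1 expr1 scaleN1r.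
rewrite mulNr QN lap_mul_xi QD (_ : 3%:R - c - 2%:R = 1 - c); last by ring.
by rewrite addrAC addrK addrA addNr add0r.
Qed.

Lemma Q_opartial y j q : tf y -> q != j ->
  Q ('x_j y) = Q (lap (y ** ev j)) - Del (c + 2%:R) (lap y ** Q (ev j ** xx q))
    + (1 - c) *: lap (lap y ** sg (ev j ** xx q)).
Proof.
move=> ty qj; have tm : tf (ev j ** xx q) by apply: tf_mul; rewrite ?tfM //; exact: tfM.
rewrite (Del_mulQ (tf_lap ty) tm (euler_evxx j q)).
have -> : lap (ev j ** xx q) = ev j.
  by rewrite lap_mul_xx0 ?lapX ?xX ?d_ev ?(negPf qj) // /ev sgX.
rewrite lap_mul_ev QD (_ : 3%:R - c - 2%:R = 1 - c); last by ring.
by rewrite opprD !addrA subrK addrAC subrr add0r.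
Qed.

Lemma Q0 : Q 0 = 0. Proof. by rewrite /Q mul0x Del0. Qed.

Lemma zd_top : (zd pim setT)%:R = 0 :> F.
Proof.
rewrite /zd cardsT card_ord natrD natr_sum (eq_bigr (fun=> -1)) => [|i _]; last exact: pim_natr.
by rewrite sumr_const card_ord mulNrn addNr.
Qed.

Lemma lap_topl_mul0 al be j q : q != j -> j != q -> rg al ->
  lap (M al setT) ** M be [set j; q] = 0.
Proof.
move=> qj jq ral; rewrite laplaceE mul_suml big1 // => i _.
rewrite xM inE epartialZ mulZl dM //; case: ifP => _; last by rewrite mul0x scaler0.
have [ij|ij] := eqVneq i j.
  by rewrite (@disjM0 _ _ _ _ q) ?scaler0 ?inE ?eqxx ?orbT // ij qj.
by rewrite (@disjM0 _ _ _ _ j) ?scaler0 ?inE ?eqxx ?orbT // eq_sym ij.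
Qed.

Lemma xixxE j q : exists x, sg (xi j ** xx q) = x *: M (eps q) [set j; q].
Proof.
rewrite /xi /xx Mmul; case: ifP => _; last by exists 0; rewrite sgnp_zero scale0r.
rewrite sgnpZ sgM scalerA; eexists; congr (_ *: _); exact: Meq.
Qed.

(** With all odd variables present, both corrections in [Q_epartial] vanish: xi_j kills [y], and
    each term of [lap y] lacks only one xi, so xi_j xi_q kills it. Thus the Laplacian of the top
    monomial is not yet required. *)
Lemma PQ_top_sub j (b : nat) : (b.+2 <= pim j)%N -> P (Q (M (subk pim b.+2 j) setT)).
Proof.
move=> hb; have [q [qj _ jq _]] := pick_neq2 j j.
set y := M (subk pim b.+1 j) setT.
have ry : rg (subk pim b.+1 j) := rg_subk _ _ rg_pim'.
have hlap : P (lap y).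
  apply: PlapM => //; rewrite /is_top negb_and negb_forall; apply/orP; left.
  by apply/existsP; exists j; rewrite subk_eq neq_ltn; apply/orP; left; lia.
have := Q_epartial (tfM F p t (subk pim b.+1 j) setT) qj; rewrite -/y.
have -> : y ** xi j = 0 by rewrite (@disjM0 _ _ _ _ j) // !inE.
have [x ->] := xixxE j q; rewrite mulZr (lap_topl_mul0 _ qj jq ry) scaler0.
rewrite laplace0 Q0 scaler0 subr0 addr0 => e.
have : P (Q (sg ('d_j y))) by rewrite e; apply: PB => //; apply: PS.
rewrite /y dM // subk_eq subn_gt0 hb; apply: PQsim.
apply: (sim_trans (@sim_sgM _ _ _ _ _ _)).
rewrite (Meq _ (_ : subk (subk pim b.+1 j) 1 j =1 subk pim b.+2 j)).
  exact: sim_refl.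
move=> i; have [->|ij] := eqVneq i j; first by rewrite !subk_eq; lia.
by rewrite !subk_neq.
Qed.

Lemma lap_sg y : lap (sg y) = - sg (lap y).
Proof. by rewrite sgnp_laplace expr1 scaleN1r opprK. Qed.

(** [f ** m] is the top monomial up to sign; its degree is 0 in F, so its Laplacian has degree -2.
    This Laplacian occurs with - c - 4 from [Q] and with b + c + 2 from the last term: c cancels and
    b - 2 remains. *)
Lemma top_bracket j (b : nat) : (0 < b <= pim j)%N ->
  let f := M (kp b j) set0 in let m := M (subk pim b j) setT in
  Q (f ** lap m) + (- b%:R - c - 2%:R) *: lap (f ** sg m) =
  ((-1) ^+ b * (b%:R - 2%:R)) *: sg (lap (M pim setT))
    - Q (M (kp (b - 1) j) set0 ** 'x_j m).
Proof.
move=> /andP[b0 bp] f m.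
have rf : rg (kp b j).
  apply: (rg_kp charFp t_gt0); move: bp; rewrite /pim.
  by have := pN_gt1 charFp t_gt0 j; move: (p ^ t j)%N; lia.
have tt : tf (lap (M pim setT)) by exact: tf_lapM.
have fm : f ** m = (-1) ^+ b *: M pim setT.
  rewrite /f /m Mmul0l (prod_bin_at (j := j)) => [|i ij]; last by left; exact: kp_neq.
  rewrite kp_eq subk_eq subnKC // bin_pred_pchar //; last first.
    by rewrite -(kp_eq b j); exact: rg_lt.
  congr (_ *: _); apply: Meq => i; have [->|ij] := eqVneq i j.
    by rewrite kp_eq subk_eq subnKC.
  by rewrite kp_neq // subk_neq.
have fsm : f ** sg m = (-1) ^+ b *: sg (M pim setT).
  by rewrite -[f]sgX -sgnp_mul fm sgnpZ.
have -> : f ** lap m = (-1) ^+ b *: lap (M pim setT) - M (kp (b - 1) j) set0 ** 'x_j m.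
  rewrite -laplaceZ -fm -[f in RHS]sgX (laplace_mul charFp f m) sgX lapX mul0x add0r.
  rewrite (bigD1 j) //= big1 ?addr0 => [|i ij].
    rewrite xX mul0x add0r /f dM // kp_eq b0.
    rewrite (Meq _ (_ : subk (kp b j) 1 j =1 kp (b - 1) j)).
      by rewrite addrAC subrr add0r.
    move=> i; have [->|ij] := eqVneq i j; first by rewrite subk_eq !kp_eq.
    by rewrite subk_neq // !kp_neq.
  by rewrite xX mul0x add0r dM0 ?mul0x // kp_neq.
rewrite QD QN QZ (@Qker _ (- 2%:R)) ?laplace_laplace //; last first.
  have := laplace_euler (M pim setT); rewrite eulerM zd_top scale0r laplace0 => /esym/eqP.
  by rewrite addr_eq0 => /eqP ->; rewrite -scaler_nat scaleNr.
rewrite fsm laplaceZ lap_sg.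
by apply/ffunP=> k; rewrite !ffunE /GRing.scale /=; ring.
Qed.

Lemma Ptop_bracket j (b : nat) : (1 < b <= pim j)%N ->
  P (((-1) ^+ b * (b%:R - 2%:R)) *: sg (lap (M pim setT))
    - Q (M (kp (b - 1) j) set0 ** 'x_j (M (subk pim b j) setT))).
Proof.
move=> /andP[b1 bp]; rewrite -top_bracket ?(ltnW b1) //.
apply: PRA.
- exact: tfM.
- exact: tfM.
- by apply: PX; move: bp; rewrite /pim; have := pN_gt1 charFp t_gt0 j; move: (p ^ t j)%N; lia.
- by case: b b1 bp => [|[|b]] // _ bp; apply: PQ_top_sub.
rewrite eulerM; congr (_ *: _).
have e : (zd (subk pim b j) setT + b = zd pim setT)%N.
  by rewrite /zd addnAC sum_subk.
by apply: (@addIr _ b%:R); rewrite -natrD e zd_top addNr.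
Qed.

Lemma top_dx j (b : nat) : (0 < b <= pim j)%N ->
  exists x, M (kp (b - 1) j) set0 ** 'x_j (M (subk pim b j) setT) =
   (x * 'C((pim j).-1, b - 1)%:R) *: M (subk pim 1 j) (setT :\ j) /\ x != 0.
Proof.
move=> /andP[b0 bp]; exists ((-1) ^+ cnt j setT); split; last by rewrite signr_eq0.
rewrite xM inE mulZr Mmul0l scalerA (prod_bin_at (j := j)) => [|i ij]; last by left; exact: kp_neq.
rewrite kp_eq subk_eq; congr (_ * 'C(_, _)%:R *: _); first by lia.
apply: Meq => i; have [->|ij] := eqVneq i j; first by rewrite kp_eq !subk_eq; lia.
by rewrite kp_neq // !subk_neq.
Qed.

(* In Ptop_bracket the Laplacian of the top monomial disappears for b = 2, which
   leaves Q of a monomial; b = 3 then yields that Laplacian. *)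
Lemma Plap_top : P (lap (M pim setT)).
Proof.
pose j : 'I_n := Ordinal (ltn_trans (isT : (0 < 2)%N) n_ge3).
have p3 := pim_ge3 j.
have htj : P (Q (M (subk pim 1 j) (setT :\ j))).
  have := @Ptop_bracket j 2; rewrite (ltnW p3) subrr mulr0 scale0r sub0r => /(_ isT).
  have [|x [-> x0]] := @top_dx j 2; first by rewrite (ltnW p3).
  (* The binomial coefficient is pi_j - 1 = -2 in F. *)
  move/PN; rewrite opprK QZ; apply: PZ'; rewrite mulf_neq0 // bin1 -subn1 natrB ?(ltn_trans _ p3) //.
  by rewrite pim_natr -opprD oppr_eq0 -mulr2n.
have := @Ptop_bracket j 3; rewrite p3 => /(_ isT).
have [|x [-> _]] := @top_dx j 3; first by rewrite p3.
rewrite QZ => h; apply: Psg'.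
have : P (((-1) ^+ 3 * (3%:R - 2%:R)) *: sg (lap (M pim setT))).
  by rewrite -[_ *: sg _](subrK ((x * 'C((pim j).-1, 3 - 1)%:R) *: Q (M (subk pim 1 j) (setT :\ j)))); apply: PD => //; apply: PZ.
apply: PZ'; rewrite (_ : 3%:R - 2%:R = 1 :> F) ?mulr1 ?signr_eq0 //; ring.
Qed.

Lemma PlapM_all al u : P (lap (M al u)).
Proof.
have [ral|ral] := boolP (rg al); last by rewrite Mout // laplace0; exact: P0.
have [|] := boolP (is_top al u); last exact: PlapM.
move=> /andP[/forallP h /eqP ->]; rewrite (Meq _ (_ : al =1 pim)); first exact: Plap_top.
by move=> i; apply/eqP/h.
Qed.

Lemma Plap_tf y : tf y -> P (lap y).
Proof.
move: y; apply: tf_ind => [|x a b ha hb|al u]; first by rewrite laplace0; exact: P0.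
  by rewrite laplaceD laplaceZ; apply: PD => //; apply: PZ.
exact: PlapM_all.
Qed.

Lemma PQlap_tf y : tf y -> P (Q (lap y)).
Proof.
move: y; apply: tf_ind => [|x a b ha hb|al u]; first by rewrite laplace0 Q0; exact: P0.
  by rewrite laplaceD laplaceZ QD QZ; apply: PD => //; apply: PZ.
rewrite (@Qker _ ((zd al u)%:R - 2%:R)) ?laplace_laplace //.
- by apply: PZ; apply: Psg; apply: PlapM_all.
- exact: tf_lapM.
have := laplace_euler (M al u); rewrite eulerM laplaceZ => e.
by rewrite scalerBl e scaler_nat addrK.
Qed.

Lemma PQ_epartial y j : tf y -> P (Q ('d_j y)).
Proof.
move=> ty; have [q [qj _ jq _]] := pick_neq2 j j.
rewrite -[y](sgnpK 1) -sgnp_epartial; have ts := tf_sg ty.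
rewrite (Q_epartial ts qj); apply: PBB; first apply: PD.
- by apply: PB; [apply: Plap_tf | apply: PS].
- by apply: PQlap_tf; apply: tf_mul => //; apply: tf_xi.
apply: PZ; apply: Plap_tf; apply: tf_mul; first exact: tf_lap.
by apply: tf_sg; apply: tf_mul; [exact: tf_xi | exact: tf_xx].
Qed.

Lemma PTev j q : j != q -> P (Q (ev j ** xx q)).
Proof.
move=> jq; have := PT (pN_gt1 charFp t_gt0 j) jq; rewrite (Meq _ (_ : kp 1 j =1 eps j)) //.
by move=> i; rewrite /kp mul1n.
Qed.

Lemma PQ_opartial y j : tf y -> P (Q ('x_j y)).
Proof.
move=> ty; have [q [qj _ jq _]] := pick_neq2 j j.
rewrite (Q_opartial ty qj); apply: PD; first apply: PBB.
- by apply: PQlap_tf; apply: tf_mul => //; apply: tf_ev.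
- by apply: PB; [apply: Plap_tf | apply: PTev].
apply: PZ; apply: Plap_tf; apply: tf_mul; first exact: tf_lap.
by apply: tf_sg; apply: tf_mul; [exact: tf_ev | exact: tf_xx].
Qed.

(** Every monomial but the top one is a derivative up to sign: raise an exponent below pi_j, or
    adjoin a missing xi_j. *)
Lemma PQM al u : ~~ is_top al u -> P (Q (M al u)).
Proof.
move=> nt; have [ral|ral] := boolP (rg al); last by rewrite Mout // Q0; exact: P0.
have [/existsP[j hj]|] := boolP [exists j, al j != pim j].
  have ra : rg (addk al 1 j).
    apply: rg_addk => //; move: hj; rewrite -lt_pim // /pim.
    by have := pN_gt1 charFp t_gt0 j; move: (p ^ t j)%N (al j); lia.
  have := PQ_epartial j (tfM F p t (addk al 1 j) u); rewrite dM // addk_eq addn1 /=.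
  rewrite (Meq _ (_ : _ =1 al)) // => i; have [->|ij] := eqVneq i j.
    by rewrite subk_eq addk_eq addnK.
  by rewrite subk_neq // addk_neq.
rewrite negb_exists => /forallP h; have [uT|/pick_notin[j ju]] := eqVneq u setT.
  by move: nt; rewrite /is_top uT eqxx andbT => /forallPn[i]; have := h i; rewrite negbK => ->.
have := PQ_opartial j (tfM F p t al (j |: u)); rewrite xM !inE eqxx /= setU1K //.
by rewrite QZ; apply: PZ'; rewrite signr_eq0.
Qed.

Lemma tau_mul f : tau ** f = sg f ** tau.
Proof.
have h : par true tau by rewrite /par sg_tau expr1 scaleN1r.
by rewrite (supercomm two0 f h).
Qed.

Lemma tau_tau : tau ** tau = 0.
Proof. by rewrite mul_mon disjoints1 inE eqxx. Qed.

Lemma Del_QQ m m' d d' : tf m -> tf m' -> euler m = d *: m -> euler m' = d' *: m' ->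
  Del (c + 2%:R) (Q m ** Q m') =
    Q ((d' - (c + 2%:R)) *: (lap m ** m') + (d - (c + 2%:R)) *: (sg m ** lap m'))
    + ((d - (c + 2%:R)) * (d' - (c + 2%:R))) *: lap (sg m ** sg m').
Proof.
move=> tm tm' em em'; rewrite (QE tm) (QE tm') -!sgnp_euler em em' !sgnpZ -!scalerBl.
set k := d - _; set k' := d' - _.
rewrite mulDl !mulDr -mulA [tau ** (_ ** tau)]mulA tau_mul -mulA tau_tau !mulx0 add0r.
rewrite !(mulZl, mulZr) -[lap m ** tau ** _]mulA tau_mul sgnpK !mulA.
rewrite scalerA [X in Del _ X]addrA DelD /Q [in RHS]mulDl !mulZl; congr (_ + _).
have ts : tf (sg m ** sg m') by apply: tf_mul; apply: tf_sg.
by rewrite (Del_tf _ (tfZ _ ts)) laplaceZ.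
Qed.

(** The top monomial is no derivative, so two [Q] elements are bracketed. The monomials have degrees
    3 and -1 in F, and both products in [Del_QQ] equal minus the top monomial; the coefficients add
    up to 2 (c + 1). *)
Lemma PQ_top : c + 1 != 0 -> P (Q (M pim setT)).
Proof.
move=> c1; pose j : 'I_n := Ordinal (ltn_trans (isT : (0 < 2)%N) n_ge3).
have p3 := pim_ge3 j; have p0 : (0 < pim j)%N := ltn_trans (isT : (0 < 2)%N) p3.
pose m := M (kp 2 j) [set j]; pose m' := M (subk pim 1 j) setT.
have rm : rg (kp 2 j) by apply: (rg_kp charFp t_gt0); apply: ltnW (pN_gt3 j).
have rm' : rg (subk pim 1 j) := rg_subk 1 j rg_pim'.
have ntm : ~~ is_top (kp 2 j) [set j].
  by rewrite /is_top negb_and -[[set j]]setUid set2_neqT orbT.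
have ntm' : ~~ is_top (subk pim 1 j) setT.
  by rewrite /is_top eqxx andbT negb_forall; apply/existsP; exists j; rewrite subk_eq neq_ltn; apply/orP; left; lia.
have em : euler m = 3%:R *: m.
  by rewrite eulerM /zd cards1 -zdX zd_kp.
have em' : euler m' = (- 1) *: m'.
  rewrite eulerM; congr (_ *: _); apply: (@addIr _ 1%:R); rewrite -natrD addNr -zd_top.
  by rewrite /zd addnAC sum_subk.
have h := Del_QQ (tfM F p t (kp 2 j) [set j]) (tfM F p t (subk pim 1 j) setT) em em'.
have hP := PB (PQM ntm) (PQM ntm').
have e1 : lap m ** m' = - M pim setT.
  have -> : lap m = M (kp 1 j) set0.
    rewrite laplaceE (bigD1 j) //= big1 ?addr0 => [|i ij].
      rewrite xM inE eqxx cnt1 expr0 scale1r setDv dM // kp_eq /=.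
      apply: Meq => i; have [->|ij] := eqVneq i j; first by rewrite subk_eq !kp_eq.
      by rewrite subk_neq // !kp_neq.
    by rewrite dxM0 // inE (negPf ij).
  rewrite Mmul0l (prod_bin_at (j := j)) => [|i ij]; last by left; exact: kp_neq.
  rewrite kp_eq subk_eq subnKC // bin1 pim_natr scaleN1r; congr (- _).
  apply: Meq => i; have [->|ij] := eqVneq i j; first by rewrite kp_eq subk_eq subnKC.
  by rewrite kp_neq // subk_neq.
have e2 : sg m ** lap m' = - M pim setT.
  rewrite sgM cards1 expr1 scaleN1r mulNl; congr (- _).
  rewrite (mul_lap1 (i := j)) => [|i ij]; last first.
    rewrite xM inE epartialZ mulZr dM //; case: ifP => _; last by rewrite mulx0 scaler0.
    by rewrite (@disjM0 _ _ _ _ j) ?scaler0 ?inE ?eqxx // eq_sym ij.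
  have aj : (0 < subk pim 1 j j)%N by rewrite subk_eq; lia.
  rewrite xM inE epartialZ mulZr dM // aj Mmul disjoints1 setD11 /= setD1K ?inE //.
  rewrite imset_set1 inversions1l -imset_odd_D1 (prod_bin_at (j := j)) => [|i ij]; last by left; exact: kp_neq.
  rewrite kp_eq !subk_eq -subnDA subnKC ?(ltnW p3) // bin_pred_pchar ?(ltnW (pN_gt3 j)) //.
  rewrite scalerA mulrA (_ : #|_| = cnt j setT); last first.
    apply: eq_card => k; rewrite !inE; case: eqVneq => // ->; by rewrite ltnn !andbF.
  rewrite -expr2 sqrr_sign mul1r expr2 mulrNN mulr1 scale1r.
  apply: Meq => i; have [->|ij] := eqVneq i j; first by rewrite kp_eq !subk_eq; lia.
  by rewrite kp_neq // !subk_neq.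
have : P (Q ((- 1 - (c + 2%:R)) *: (lap m ** m') + (3%:R - (c + 2%:R)) *: (sg m ** lap m'))).
  rewrite -[Q _](addrK (((3%:R - (c + 2%:R)) * (- 1 - (c + 2%:R))) *: lap (sg m ** sg m'))) -h.
  by apply: PBB hP _; apply: PZ; apply: Plap_tf; apply: tf_mul; apply: tf_sg; apply: tfM.
rewrite e1 e2 -scalerDl QZ QN scalerN => /PN; rewrite opprK; apply: PZ'.
rewrite (_ : _ + _ = - (2%:R * (c + 1))); last by ring.
by rewrite oppr_eq0 mulf_neq0.
Qed.

(* The coefficient of x^(pi) xi_1 ... xi_n tau, i.e. the Berezin integral. *)
Definition top_coef (A : O) : F :=
  \sum_(m : basis | [forall i, m.1 i == pim i :> nat] && (m.2 == setT)) A m.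

Theorem generation A : c + 1 != 0 \/ top_coef A = 0 -> P (Del (c + 2%:R) A).
Proof.
move=> hA.
have hb (m : basis) : ~~ [forall i, m.1 i == pim i :> nat] || (m.2 != setT) || (c + 1 != 0) ->
    P (Del (c + 2%:R) (bmon F m)).
  move=> hm; have [mx|mx] := boolP (ord_max \in m.2).
    rewrite bmon_Mtau // -/(Q _).
    have [/andP[/forallP h1 /eqP h2]|] := boolP (is_top (fun i => m.1 i) (unodd m.2)); last exact: PQM.
    rewrite (Meq _ (_ : _ =1 pim)) => [|i]; last exact/eqP/h1.
    rewrite h2; apply: PQ_top; move: hm; rewrite -negb_and (_ : _ && _) //.
    apply/andP; split; first exact/forallP.
    apply/eqP/setP=> k; rewrite inE; have [->//|kx] := eqVneq k ord_max.
    by have [j ->] := odd_of_surj kx; have := in_setT j; rewrite -h2 inE.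
  by rewrite bmon_M // Del_tf; [apply: PlapM_all | apply: tfM].
have Psum (R : pred basis) : (forall m : basis, R m -> P (A m *: Del (c + 2%:R) (bmon F m))) ->
    P (\sum_(m : basis | R m) A m *: Del (c + 2%:R) (bmon F m)).
  by move=> h; elim/big_rec: _ => [|m a hm ha]; [exact: P0 | apply: PD => //; apply: h].
have -> : Del (c + 2%:R) A = \sum_(m : basis) A m *: Del (c + 2%:R) (bmon F m).
  rewrite {1}(O_expand A); elim: (index_enum _) => [|m r IH].
    by rewrite !big_nil Del0.
  by rewrite !big_cons DelD DelZ IH.
apply: (Psum xpredT) => m _.
have [hm|] := boolP (~~ [forall i, m.1 i == pim i :> nat] || (m.2 != setT) || (c + 1 != 0)).
  by apply: PZ; apply: hb.
rewrite !negb_or !negbK => /andP[/andP[h1 h2] h3].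
case: hA => [|hA]; first by rewrite h3.
suff -> : A m = 0 by rewrite scale0r; exact: P0.
rewrite -hA /top_coef (big_pred1 m) // => k /=; apply/andP/eqP => [[e1 e2]|->//].
case: k m e1 e2 h1 h2 => [k1 k2] [m1 m2] /= /forallP e1 /eqP -> /forallP e2 /eqP ->.
congr pair; apply/ffunP=> i; apply/val_inj => /=.
by rewrite (eqP (e1 i)) (eqP (e2 i)).
Qed.

End Generation.

(** * The top coefficient and the derived algebras *)

Section Integral.
Variables (F : fieldType) (p n : nat) (t : 'I_n -> nat).
Hypothesis charFp : p \in [pchar F].
Hypothesis two0 : 2%:R != 0 :> F.
Hypothesis t_gt0 : forall i, (0 < t i)%N.
Local Notation basis := (basis p t).
Local Notation O := {ffun basis -> F^o}.
Local Notation "a ** b" := (@mul F p n t a b) (at level 40, left associativity).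
Local Notation "'d_ j" := (epartial j) (at level 10, j at level 8, format "''d_' j").
Local Notation "'x_ j" := (opartial (odd_of j)) (at level 10, j at level 8, format "''x_' j").
Local Notation dl := (@dlast F p n t).
Local Notation sg := (@sgnp F p n t 1).
Local Notation lap := (@laplace F p n t).
Local Notation Del := (@Del F p n t).
Local Notation pim := (@pim p n t).
Local Notation I := (@top_coef F p n t).
Implicit Types (a b A X : O) (w x : F) (r : 'I_n).

Lemma top_coefD a b : I (a + b) = I a + I b.
Proof. by rewrite /top_coef -big_split; apply: eq_bigr => m _; rewrite ffunE. Qed.
Lemma top_coefZ x a : I (x *: a) = x * I a.
Proof. by rewrite /top_coef mulr_sumr; apply: eq_bigr => m _; rewrite ffunE. Qed.
Lemma top_coef0 : I 0 = 0.
Proof. by rewrite -(scale0r (0 : O)) top_coefZ mul0r. Qed.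
Lemma top_coefN a : I (- a) = - I a.
Proof. by rewrite -scaleN1r top_coefZ mulN1r. Qed.
Lemma top_coef_sum J (s : seq J) (P : pred J) (f : J -> O) :
  I (\sum_(i <- s | P i) f i) = \sum_(i <- s | P i) I (f i).
Proof. by elim/big_rec2: _ => [|i x y _ <-]; rewrite ?top_coef0 ?top_coefD. Qed.

Lemma top_coef_mon al u : u != setT \/ (exists i, al i != pim i) -> I (mon F p t al u) = 0.
Proof.
move=> h; apply: big1 => m /andP[/forallP h1 /eqP h2]; rewrite ffunE.
case: andP => // -[/forallP e1 /eqP e2]; case: h => [|[i]].
  by rewrite -e2 h2 eqxx.
by rewrite -(eqP (e1 i)) h1.
Qed.

Lemma top_coef_opartial j X : I (opartial j X) = 0.
Proof.
elim/O_ind: X => [|x m X IH]; first by rewrite opartial0 top_coef0.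
rewrite opartialD opartialZ top_coefD top_coefZ IH addr0 /bmon opartial_mon.
case: ifP => _; last by rewrite top_coef0 mulr0.
rewrite top_coefZ top_coef_mon ?mulr0 //; left.
by apply/eqP => /setP/(_ j); rewrite !inE eqxx.
Qed.

Lemma top_coef_epartial r X : I ('d_r X) = 0.
Proof.
elim/O_ind: X => [|x m X IH]; first by rewrite epartial0 top_coef0.
rewrite epartialD epartialZ top_coefD top_coefZ IH addr0 /bmon epartial_mon ?in_range_basis //.
case: ifP => m0; last by rewrite top_coef0 mulr0.
rewrite top_coef_mon ?mulr0 //; right; exists r; rewrite eqxx /pim neq_ltn; apply/orP; left.
have := ltn_ord (m.1 r); move: (nat_of_ord (m.1 r)) m0 => y; case: (p ^ t r)%N => // N; lia.
Qed.

(** The top monomial has degree 0 in F, each pi_i being -1 and cancelling one odd variable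
    ([zd_top]). *)
Lemma top_coef_euler X : I (euler X) = 0.
Proof.
elim/O_ind: X => [|x m X IH]; first by rewrite euler0 top_coef0.
rewrite eulerD eulerZ top_coefD top_coefZ IH addr0 /bmon euler_mon top_coefZ.
have [h|h] := boolP ([forall i, m.1 i == pim i :> nat] && (m.2 == setT)); last first.
  rewrite top_coef_mon ?mulr0 //; move: h; rewrite negb_and.
  by case/orP => [/forallPn h|]; [right | left].
rewrite (_ : (deg _ _)%:R = 0) ?mul0r ?mulr0 //.
case/andP: h => /forallP h /eqP ->; rewrite -(zd_top charFp t_gt0) /zd /deg.
rewrite (eq_bigr pim) => [|i _]; last exact/eqP.
congr (_ + _)%:R; rewrite card_odd_of cardsT -sum1_card; apply: eq_bigr => j _.
by rewrite inE.
Qed.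

Lemma top_coef_laplace A b : I (lap A ** b) = I (sg A ** lap b).
Proof.
rewrite !laplaceE mul_suml mul_sumr !top_coef_sum; apply: eq_bigr => j _.
have := top_coef_epartial j ('x_j A ** b); rewrite epartial_mul // top_coefD => /eqP.
rewrite addr_eq0 => /eqP ->.
have := top_coef_opartial (odd_of j) (A ** 'd_j b); rewrite opartial_mul top_coefD => /eqP.
by rewrite addr_eq0 epartial_opartial => /eqP ->; rewrite opprK.
Qed.

Lemma top_coef_dlast A b : I (dl A ** b) = - I (sg A ** dl b).
Proof.
have := top_coef_opartial ord_max (A ** b); rewrite opartial_mul top_coefD => /eqP.
by rewrite addr_eq0 => /eqP.
Qed.

(** Integration by parts term by term. D passes to the other factor with a minus sign as
    [top_coef_euler] vanishes, which is why the weight is negated. *)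
Lemma top_coef_Del w A b : I (Del w A ** b) = I (sg A ** Del (- w) b).
Proof.
rewrite !DelE !(mulDl, mulDr, mulZl, mulZr, top_coefD, top_coefZ) opprK.
rewrite top_coef_laplace top_coef_dlast mulrNN; congr (_ + _ + _).
have := top_coef_euler (dl A ** b); rewrite euler_mul // top_coefD => /eqP.
rewrite addr_eq0 => /eqP ->; rewrite top_coef_dlast opprK.
by rewrite dlast_euler.
Qed.

Lemma top_coef_sg A : I (sg A) = (-1) ^+ n.+1 * I A.
Proof.
rewrite /top_coef mulr_sumr; apply: eq_bigr => m /andP[_ /eqP h].
by rewrite sgnpE h cardsT card_ord mul1n.
Qed.

Lemma top_coef_tf a : tf a -> I a = 0.
Proof.
by move=> h; apply: big1 => m /andP[_ /eqP hm]; rewrite (tf_coef h) // hm inE.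
Qed.

Lemma top_coef_Mtau al u : ~~ is_top p t al u -> I (xmon F p t al u ** lastvar F p t) = 0.
Proof.
move=> h; rewrite /xmon /lastvar mul_mon; case: ifP => _; last by rewrite top_coef0.
rewrite top_coefZ top_coef_mon ?mulr0 //.
have [/existsP[i hi]|] := boolP [exists i, al i != pim i].
  by right; exists i; rewrite addn0.
rewrite negb_exists => /forallP hal; left; apply: contra h => /eqP hu; apply/andP; split.
  by apply/forallP => i; have := hal i; rewrite negbK.
apply/eqP/setP => j; have := in_setT (odd_of j); rewrite -hu !inE.
by rewrite (negPf (odd_of_neq_max j)) orbF mem_imset //; exact: odd_of_inj.
Qed.

End Integral.

(** * The generators as brackets *)

Section Brackets.
Variables (F : fieldType) (p n : nat) (t : 'I_n -> nat).
Hypothesis charFp : p \in [pchar F].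
Hypothesis two0 : 2%:R != 0 :> F.
Hypothesis three0 : 3%:R != 0 :> F.
Hypothesis t_gt0 : forall i, (0 < t i)%N.
Hypothesis n_ge3 : (3 <= n)%N.
Local Notation basis := (basis p t).
Local Notation O := {ffun basis -> F^o}.
Local Notation "a ** b" := (@mul F p n t a b) (at level 40, left associativity).
Local Notation "'d_ j" := (epartial j) (at level 10, j at level 8, format "''d_' j").
Local Notation sg := (@sgnp F p n t 1).
Local Notation lap := (@laplace F p n t).
Local Notation Del := (@Del F p n t).
Local Notation M := (@xmon F p n t).
Local Notation rg := (in_range p t).
Local Notation one := (@one F p n t).
Local Notation tau := (@lastvar F p n t).
Local Notation z0 := (@zero_exp n).
Local Notation xx := (@xx F p n t).
Local Notation xi := (@xi F p n t).
Local Notation tf := (@tf F p n t).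
Local Notation pim := (@pim p n t).
Local Notation I := (@top_coef F p n t).
Implicit Types (a b y A : O) (i j q : 'I_n) (al : 'I_n -> nat) (u : {set 'I_n}).

Variable c : F.
Local Notation Q := (@Q F p n t c).

(* The functions of SKO: the image of Del (c + 2), without its top element
   Q (x^(pi) xi_1 ... xi_n) when c = -1. *)
Definition small a : Prop := exists2 A, a = Del (c + 2%:R) A & c + 1 != 0 \/ I A = 0.

Lemma small_lap y : tf y -> small (lap y).
Proof. by move=> ty; exists y; [rewrite Del_tf | right; exact: top_coef_tf]. Qed.

Lemma small_Q al u : ~~ is_top p t al u -> small (Q (M al u)).
Proof. by move=> h; exists (M al u ** tau) => //; right; apply: top_coef_Mtau. Qed.

Lemma smallZ (x : F) a : small a -> small (x *: a).
Proof.
move=> [A -> h]; exists (x *: A); first by rewrite DelZ.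
by case: h => [|h]; [left | right; rewrite top_coefZ h mulr0].
Qed.

Lemma small_sg a : small a -> small (sg a).
Proof.
move=> [A -> h]; exists (- sg A); first by rewrite sgnp_Del DelN.
by case: h => [|h]; [left | right; rewrite top_coefN top_coef_sg h mulr0 oppr0].
Qed.

Lemma small_ker a : small a -> Del c a = 0.
Proof. by move=> [A -> _]; rewrite DelDel. Qed.

Lemma small_sim a b : sim a b -> small a -> small b.
Proof. by move=> /sim_sym[x _ ->]; apply: smallZ. Qed.

(** [B] stands for the functions whose fields are sums of brackets of fields of [small] functions;
    nothing is assumed about brackets of elements of [B]. *)
Variable B : O -> Prop.
Hypothesis BZ : forall (x : F) a, B a -> B (x *: a).
Hypothesis BD : forall a b, B a -> B b -> B (a + b).
Hypothesis BB : forall a b, small a -> small b -> B (Del (c + 2%:R) (a ** b)).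

Let B0 : B 0.
Proof.
have h := BB (small_lap (tfM F p t z0 set0)) (small_lap (tfM F p t z0 set0)).
by have := BZ 0 h; rewrite scale0r.
Qed.

Let BN a : B a -> B (- a).
Proof. by rewrite -scaleN1r; apply: BZ. Qed.

Let Bsim a b : sim a b -> B a -> B b.
Proof. by move=> /sim_sym[x _ ->]; apply: BZ. Qed.

Lemma small_X al i : rg al -> (al i < pim i)%N -> small (M al set0).
Proof.
move=> ral hi; have ra : rg (addk al 1 i).
  apply: rg_addk => //; move: hi; rewrite /pim.
  by have := pN_gt1 charFp t_gt0 i; move: (p ^ t i)%N (al i); lia.
have := small_lap (tfM F p t (addk al 1 i) [set i]).
apply: small_sim; apply: (@sim_lapM1 _ _ _ _ i) => //.
- by rewrite inE.
- by rewrite addk_eq addn1.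
- by move=> j; rewrite inE => ->.
- move=> j; have [->|ij] := eqVneq j i; first by rewrite subk_eq addk_eq addnK.
  by rewrite subk_neq // addk_neq.
by rewrite setDv.
Qed.

Lemma small_xi u : u != setT -> small (M z0 u).
Proof.
move=> hu; have [q qu] := pick_notin hu.
have ty : tf (M z0 u ** xx q) by apply: tf_mul; exact: tfM.
have := small_lap ty; rewrite lap_mul_xx0 //.
- by apply: small_sim; exact: sim_sgM.
- exact: lapM0.
- by rewrite xM (negPf qu).
exact: dM0.
Qed.

Lemma B_lapM al u i : rg al -> (al i < pim i)%N -> u != setT -> B (lap (M al u)).
Proof.
move=> ral hi hu; have := BB (small_X ral hi) (small_xi hu).
rewrite Del_tf; last by apply: tf_mul; exact: tfM.
apply: Bsim; apply: sim_lap; apply: sim_Mmul.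
- by rewrite -setI_eq0 set0I.
- by rewrite prod_bin1 ?oner_eq0 // => l; right.
- by move=> l; rewrite addn0.
exact: set0U.
Qed.

Let set1_neqT i : [set i] != setT.
Proof. by rewrite -[[set i]]setUid set2_neqT. Qed.

Let eps_lt i : (eps i i < pim i)%N.
Proof. by rewrite /eps eqxx; apply: ltnW (pim_ge3 charFp two0 three0 t_gt0 n_ge3 i). Qed.

Lemma B_one : B one.
Proof.
pose j : 'I_n := Ordinal (ltn_trans (isT : (0 < 2)%N) n_ge3).
rewrite -(@lap_xx _ _ _ _ charFp t_gt0 j).
by apply: (@B_lapM _ _ j); [apply: (rg_eps charFp t_gt0) | apply: eps_lt | apply: set1_neqT].
Qed.

Let sg_lapM al u : B (lap (M al u)) -> B (sg (lap (M al u))).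
Proof.
move=> h; have e := lap_sg (M al u); rewrite sgM laplaceZ in e.
by rewrite -[sg _]opprK -e; apply: BN; apply: BZ.
Qed.

Let BQ_lapM al u : B (lap (M al u)) -> B (Q (lap (M al u))).
Proof.
move=> h; rewrite (@Qker _ _ _ _ charFp two0 t_gt0 _ _ ((zd al u)%:R - 2%:R)) ?laplace_laplace //.
- exact: BZ (sg_lapM h).
- by apply: tf_lap => //; apply: tfM.
have e := laplace_euler (M al u); rewrite eulerM laplaceZ in e.
by rewrite scalerBl e scaler_nat addrK.
Qed.

(** Meant for [Tset]. The monomial is integrated along the spare x_j and differentiated back by
    [Q_epartial]; the Laplacians that appear lie in [B] because the exponent of x_j is 1, below
    pi_j. *)
Lemma B_Q1 ga i j : rg ga -> j != i -> ga j = 0%N -> B (Q (M ga [set i])).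
Proof.
move=> rga ji gj; have [q [qj _ jq _]] := pick_neq2 n_ge3 j j.
have p3 := pim_ge3 charFp two0 three0 t_gt0 n_ge3 j.
set be := addk ga 1 j; have bej : be j = 1%N by rewrite /be addk_eq gj.
have rbe : rg be.
  apply: rg_addk => //; rewrite gj; exact: (pN_gt1 charFp t_gt0).
have belt : (be j < pim j)%N by rewrite bej ltnW.
have := Q_epartial charFp two0 t_gt0 c (tfM F p t be [set i]) qj.
have -> : sg ('d_j (M be [set i])) = - M ga [set i].
  rewrite dM // bej /= sgM cards1 expr1 scaleN1r; congr (- _); apply: M_eq => l.
  have [->|lj] := eqVneq l j; first by rewrite subk_eq bej gj.
  by rewrite subk_neq // /be addk_neq.
have Byxi : B (Q (lap (M be [set i] ** xi j))).
  rewrite /xi Mmul; case: ifP => _; last first.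
    by rewrite laplace0 /Q mul0x Del0; exact: B0.
  rewrite laplaceZ QZ; apply: BZ; apply: BQ_lapM.
  rewrite (@M_eq _ _ _ _ _ be) => [|l]; last exact: addn0.
  by apply: (B_lapM rbe belt); apply: set2_neqT.
have [x ->] : exists x : F, lap (lap (M be [set i]) ** sg (xi j ** xx q)) =
    x *: lap (M (fun l => subk be 1 i l + eps q l)%N [set j; q]).
  have [x ->] := @xixxE F p n t j q; rewrite mulZr laplaceZ.
  rewrite [lap (M be [set i])]laplaceE (bigD1 i) //= big1 ?addr0 => [|l li]; last first.
    by rewrite dxM0 // inE (negPf li).
  rewrite xM inE eqxx epartialZ mulZl laplaceZ scalerA setDv dM //.
  case: ifP => _; last by exists 0; rewrite mul0x laplace0 scaler0 scale0r.
  by rewrite Mmul0l laplaceZ scalerA; eexists.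
move=> e; rewrite -[Q _]opprK -QN e; apply: BN; apply: BD; first apply: BD => //.
  apply: BB; first by apply: small_lap; exact: tfM.
  have nt : ~~ is_top p t (fun l => z0 l + eps q l)%N ([set j] :|: [set q]).
    by rewrite /is_top negb_and set2_neqT ?orbT.
  have := small_Q nt; apply: small_sim; rewrite /xi /xx; apply: sim_sym.
  have : sim (M z0 [set j] ** M (eps q) [set q]) (M (fun l => z0 l + eps q l)%N ([set j] :|: [set q])).
    apply: sim_Mmul => //; first by rewrite disjoints1 inE.
    by rewrite prod_bin1 ?oner_eq0 // => l; left.
  by move=> [z z1 ->]; exists z; rewrite ?QZ.
apply: BN; apply: BZ; apply: BZ.
have [rl|rl] := boolP (rg (fun l => subk be 1 i l + eps q l)%N); last first.
  by rewrite Mout // laplace0; exact: B0.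
apply: (@B_lapM _ _ j) => //; last exact: set2_neqT.
by rewrite subk_neq // bej /eps (negPf jq) addn0 ltnW.
Qed.

(** Meant for [Sset]. The Laplacian of x_i x_q xi_i xi_q has this element as an eigenvector with
    nonzero eigenvalue, as repeated odd factors kill the corrections in [Q_epartial]. *)
Lemma B_Q2 q i : i != q -> B (Q (xi i ** xx q)).
Proof.
move=> iq; have qi : q != i by rewrite eq_sym.
set be := addk (eps q) 1 i.
have bei : be i = 1%N by rewrite /be addk_eq /eps (negPf iq).
have rbe : rg be.
  apply: rg_addk; first exact: (rg_eps charFp t_gt0).
  by rewrite /eps (negPf iq); exact: (pN_gt1 charFp t_gt0).
have := Q_epartial charFp two0 t_gt0 c (tfM F p t be [set i; q]) qi.
have -> : M be [set i; q] ** xi i = 0 by rewrite (@disjM0 _ _ _ _ _ _ _ _ i) ?inE ?eqxx.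
have [x ->] := @xixxE F p n t i q.
have -> : lap (M be [set i; q]) ** (x *: M (eps q) [set i; q]) = 0.
  rewrite mulZr laplaceE mul_suml big1 ?scaler0 // => l _.
  rewrite xM; case: ifP => hl; last by rewrite epartial0 mul0x.
  rewrite epartialZ mulZl dM //; case: ifP => _; last by rewrite mul0x scaler0.
  have [li|li] := eqVneq l i.
    by rewrite (@disjM0 _ _ _ _ _ _ _ _ q) ?scaler0 ?inE ?eqxx ?orbT // li qi.
  by rewrite (@disjM0 _ _ _ _ _ _ _ _ i) ?scaler0 ?inE ?eqxx // eq_sym li.
have Qz : Q 0 = 0 by rewrite /Q mul0x Del0.
rewrite !laplace0 Qz scaler0 addr0 subr0 => e.
have nt : ~~ is_top p t (eps q) [set i; q] by rewrite /is_top negb_and set2_neqT ?orbT.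
have sm : sim (xi i ** xx q) (M (eps q) [set i; q]).
  apply: sim_Mmul => //; first by rewrite disjoints1 inE.
  by rewrite prod_bin1 ?oner_eq0 // => l; left.
have simQ a b : sim a b -> sim (Q a) (Q b).
  by move=> [z z1 ->]; exists z; rewrite ?QZ.
have h : B (Q (sg ('d_i (M be [set i; q])))).
  rewrite e; apply: BB; first by apply: small_lap; exact: tfM.
  by have := small_Q nt; apply: small_sim; apply: sim_sym; apply: simQ.
apply: Bsim h; apply: sim_trans (simQ _ _ _) (simQ _ _ (sim_sym sm)).
rewrite dM // bei /=; apply: sim_trans (@sim_sgM _ _ _ _ _ _) _.
rewrite (@M_eq _ _ _ _ _ (eps q)); first exact: sim_refl.
move=> l; have [->|li] := eqVneq l i; first by rewrite subk_eq bei /eps (negPf iq).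
by rewrite subk_neq // /be addk_neq.
Qed.

End Brackets.

(** * Comparison of SKO with the generated subalgebra *)

Section Main.
Variables (F : fieldType) (p n : nat) (t : 'I_n -> nat) (lam : F).
Hypothesis charFp : p \in [pchar F].
Hypothesis two0 : 2%:R != 0 :> F.
Hypothesis three0 : 3%:R != 0 :> F.
Hypothesis t_gt0 : forall i, (0 < t i)%N.
Hypothesis n_ge3 : (3 <= n)%N.
Local Notation basis := (basis p t).
Local Notation O := {ffun basis -> F^o}.
Local Notation "a ** b" := (@mul F p n t a b) (at level 40, left associativity).
Local Notation sg := (@sgnp F p n t 1).
Local Notation lap := (@laplace F p n t).
Local Notation Del := (@Del F p n t).
Local Notation DKO := (@DKO F p n t).
Local Notation M := (@xmon F p n t).
Local Notation rg := (in_range p t).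
Local Notation one := (@one F p n t).
Local Notation z0 := (@zero_exp n).
Local Notation xx := (@xx F p n t).
Local Notation xi := (@xi F p n t).
Local Notation tf := (@tf F p n t).
Local Notation c := (n%:R * lam).
Local Notation Q := (@Q F p n t c).
Local Notation small := (@small F p n t c).
Local Notation X := (fun E : 'End(O) => Tset lam E \/ Sset lam E \/ E = DKO_one F p t).
Implicit Types (a b y A : O) (i j q : 'I_n) (al : 'I_n -> nat) (u : {set 'I_n}).
Implicit Types (D E : 'End(O)) (h U : {vspace 'End(O)}).

Lemma xi_var q : var F p t (prime_idx (inl q)) = xi q.
Proof. by rewrite /xi /xmon imset_set1. Qed.

Lemma nabla_set0 q al : nabla F p t q al set0 = M (addk al 1 q) [set q].
Proof.
rewrite /nabla xi_var -one_X mulx1 //.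
have -> : mon F p t (fun j => (al j + eps q j)%N) set0 = M (addk al 1 q) set0.
  by rewrite /xmon imset0; apply: eq_mon => i; rewrite /addk mul1n.
rewrite Mmul0l prod_bin1 ?scale1r => [|i]; last by right.
by apply: M_eq => i; rewrite addn0.
Qed.

Lemma Egen_set0 al q : rg (addk al 1 q) ->
  Egen p t lam al set0 q = DKO (Q (M (addk al 1 q) [set q])).
Proof.
move=> ra; rewrite /Egen nabla_set0; congr (Defs.DKO _).
have zE : zd (addk al 1 q) [set q] = (zd al set0 + 2)%N.
  by rewrite /zd cards1 cards0 sum_addk; lia.
rewrite QE // ?sgM; last exact: tfM.
have -> : lap (M (addk al 1 q) [set q]) = M al set0.
  rewrite laplaceE (bigD1 q) //= big1 ?addr0 => [|j jq]; last by rewrite dxM0 // inE (negPf jq).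
  rewrite xM inE eqxx cnt1 expr0 scale1r setDv dM // addk_eq addn1 /=; apply: M_eq => i.
  have [->|iq] := eqVneq i q; first by rewrite subk_eq addk_eq addnK.
  by rewrite subk_neq // addk_neq.
rewrite cards1 cards0 eulerZ eulerM zE natrD; congr (_ + _).
by apply/ffunP=> m; rewrite !ffunE /GRing.scale /=; ring.
Qed.

Lemma nabla_set1 q i : nabla F p t q z0 [set i] = xx q ** xi i.
Proof.
rewrite /nabla xi_var; congr (_ ** _).
have -> : mon F p t (fun j => (z0 j + eps q j)%N) set0 = M (eps q) set0.
  by rewrite /xmon imset0.
rewrite Mmul0l prod_bin1 ?scale1r => [|l]; last by right.
by apply: M_eq => l; rewrite addn0.
Qed.

Lemma Egen_set1 i q : q != i -> Egen p t lam z0 [set i] q = DKO (Q (xx q ** xi i)).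
Proof.
move=> qi; rewrite /Egen nabla_set1; congr (Defs.DKO _).
have ty : tf (xx q ** xi i) by apply: tf_mul; exact: tfM.
rewrite QE //.
have -> : lap (xx q ** xi i) = xi i.
  by rewrite lap_mul_xi // lap_xx // mul1x d_xx // eq_sym (negPf qi) sgnp_zero addr0.
have eN : euler (xx q ** xi i) = 3%:R *: (xx q ** xi i).
  rewrite euler_mul // euler_xx eulerM zd_0 cards1 mulZl mulZr -scalerDl.
  by congr (_ *: _); ring.
have -> : sg (xx q ** xi i) = xx q ** xi i.
  by rewrite sgnp_mul sg_xx /xi sgM cards1 expr1 scaleN1r mulNl mulNr opprK.
rewrite eN zd_0 !cards1; congr (_ + _).
by apply/ffunP=> m; rewrite !ffunE /GRing.scale /=; ring.
Qed.

Lemma M_neq0 al u : rg al -> M al u != 0.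
Proof.
move=> ral; rewrite /xmon; have [m [-> _ _]] := mon_bmon F ((@odd_of n) @: u) ral.
apply/eqP => /ffunP/(_ m); rewrite bmonE eqxx ffunE => /eqP.
by rewrite oner_eq0.
Qed.

Lemma XT k i q : (k < p ^ t i)%N -> i != q -> X (DKO (Q (M (kp k i) set0 ** xx q))).
Proof.
move=> hk iq; have qi : q != i by rewrite eq_sym.
have ra : rg (addk (kp k i) 1 q).
  apply: rg_addk; first exact: (rg_kp charFp t_gt0).
  by rewrite kp_neq // (pN_gt1 charFp t_gt0).
have -> : M (kp k i) set0 ** xx q = M (addk (kp k i) 1 q) [set q].
  rewrite /xx Mmul0l prod_bin1 ?scale1r => [|l].
    by apply: M_eq => l; rewrite /addk mul1n.
  by have [->|li] := eqVneq l i; [right; rewrite /eps (negPf iq) | left; rewrite kp_neq].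
left; exists i, k, q; split; first by move: hk; case: (p ^ t i)%N => // N; lia.
  by rewrite inE -/(kp k i) nabla_set0 M_neq0.
by rewrite -/(kp k i) Egen_set0.
Qed.

Lemma XS j q : j != q -> X (DKO (Q (xx q ** xi j))).
Proof.
move=> jq; have qj : q != j by rewrite eq_sym.
right; left; exists j, q; split; last by rewrite Egen_set1.
rewrite inE nabla_set1; apply/eqP => e.
have := lap_mul_xi charFp two0 (xx q) j.
rewrite e laplace0 lap_xx // mul1x d_xx // (negPf jq) sgnp_zero addr0 => /esym/eqP.
by apply/negP; apply: M_neq0; apply: (rg0 charFp t_gt0).
Qed.

(** Normal forms matching [B_one], [B_Q1] and [B_Q2]. Nonvanishing of [nabla] gives the range
    condition and i != q; the exponent vanishes at any j outside i and q. *)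
Lemma XE E : X E -> E = DKO one \/
  (exists i j (ga : 'I_n -> nat), [/\ rg ga, j != i, ga j = 0%N & E = DKO (Q (M ga [set i]))]) \/
  (exists2 i, True & exists2 q, i != q & E = DKO (Q (xx q ** xi i))).
Proof.
case=> [[i [k [q [hk hq ->]]]]|[[i [q [hq ->]]]|->]].
- right; left; have [j [ji jq _ _]] := pick_neq2 n_ge3 i q.
  exists q, j, (addk (kp k i) 1 q).
  have ra : rg (addk (kp k i) 1 q).
    move: hq; rewrite inE -/(kp k i) nabla_set0; apply: contraNT => h.
    by rewrite Mout.
  by split; rewrite ?addk_neq ?kp_neq // -/(kp k i) Egen_set0.
- right; right; exists i => //; exists q.
    apply: contraTneq hq => ->; rewrite inE nabla_set1 negbK; apply/eqP.
    by rewrite (@disjM0 _ _ _ _ _ _ _ _ q) // inE.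
  rewrite Egen_set1 //; apply: contraTneq hq => ->; rewrite inE nabla_set1 negbK; apply/eqP.
  by rewrite (@disjM0 _ _ _ _ _ _ _ _ i) // inE.
by left.
Qed.

Lemma xx_xi q j : xx q ** xi j = - (xi j ** xx q).
Proof.
have h : par true (xx q) by rewrite /par sg_xx expr1 scaleN1r.
by rewrite (supercomm two0 _ h) /xi sgM cards1 expr1 scaleN1r mulNl.
Qed.

(** Applied with [SKO2] to place the generators in [SKO1], and then with [SKO1] to place them in
    [SKO]. *)
Lemma X_brackets U : (forall a, small a -> DKO a \in U) -> forall E, X E -> E \in sbracketv U U.
Proof.
move=> hU E /XE hE.
pose B a := DKO a \in sbracketv U U.
have BZ (x : F) a : B a -> B (x *: a) by rewrite /B DKOZ; apply: memvZ.
have BD a b : B a -> B b -> B (a + b) by rewrite /B DKOD; apply: memvD.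
have BB a b : small a -> small b -> B (Del (c + 2%:R) (a ** b)).
  move=> ha hb; have hsa := small_sg ha.
  rewrite /B -[a](sgnpK 1) -brk_ker //; last 2 first.
  - exact: small_ker hsa.
  - exact: small_ker hb.
  by rewrite -sbracket_DKO // mem_sbracketv // hU.
case: hE => [->|[[i [j [ga [rga ji gj ->]]]]|[i _ [q iq ->]]]].
- exact: (B_one charFp two0 three0 t_gt0 n_ge3 BZ BB).
- exact: (B_Q1 charFp two0 three0 t_gt0 n_ge3 BZ BD BB rga ji gj).
have := B_Q2 charFp two0 t_gt0 n_ge3 BZ BB iq.
by move/(BZ (-1)); rewrite /B xx_xi scaleN1r QN.
Qed.

Lemma DKO_sg h b : graded h -> DKO b \in h -> DKO (sg b) \in h.
Proof.
move=> gh hb; have -> : sg b = opart false b + (-1) *: opart true b.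
  apply/ffunP=> m; rewrite !ffunE mul1n -signr_odd.
  by case: odd; rewrite /= ?scaler0 ?expr0 ?expr1 ?mul1r ?addr0 ?add0r.
rewrite DKOD DKOZ memvD ?memvZ //.
  by have := gh true _ hb; rewrite hpart_DKO.
by have := gh false _ hb; rewrite hpart_DKO.
Qed.

Lemma Del_sg0 w b : Del w b = 0 -> Del w (sg b) = 0.
Proof. by move=> h; rewrite -[Del w _]opprK -sgnp_Del h sgnp_zero oppr0. Qed.

Lemma small_mem h : is_subsuperalgebra h -> (forall E, X E -> E \in h) ->
  forall a, small a -> DKO a \in h.
Proof.
move=> [gh bh] hX a [A -> hA].
(* The first conjunct is carried along so that [brk_ker] can turn brackets in [h] into values of
   [Del]. *)
pose P a := Del c a = 0 /\ DKO a \in h.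
suff : P (Del (c + 2%:R) A) by case.
have DQ y : Del c (Q y) = 0 by rewrite DelDel.
apply: (generation charFp two0 three0 t_gt0 n_ge3) => //.
- by move=> x b [h1 h2]; split; rewrite ?DelZ ?h1 ?scaler0 // DKOZ memvZ.
- by move=> b b' [h1 h2] [h1' h2']; split; rewrite ?DelD ?h1 ?h1' ?addr0 // DKOD memvD.
- move=> b [h1 h2]; split.
    exact: Del_sg0.
  exact: DKO_sg.
- move=> b b' [h1 h2] [h1' h2']; split; first by rewrite DelDel.
  have hs := Del_sg0 h1.
  rewrite -[b](sgnpK 1) -brk_ker // -sbracket_DKO //; apply: bh => //.
  exact: DKO_sg.
- split; last by apply: hX; right; right.
  rewrite -(@lap_xx _ _ _ _ charFp t_gt0 (Ordinal (ltn_trans (isT : (0 < 2)%N) n_ge3))).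
  rewrite Del_tf ?laplace_laplace //; apply: tf_lap => //; exact: tfM.
- by move=> k i q hk iq; split => //; apply: hX; apply: XT.
move=> j q jq; split => //.
have := hX _ (XS jq); rewrite xx_xi QN -scaleN1r DKOZ => /(memvZ (-1)).
by rewrite scalerA mulrNN mulr1 scale1r.
Qed.

Lemma small_SKO1 a : small a -> DKO a \in SKO1 p t lam.
Proof.
apply: small_mem; first exact: SKO1_subsuper.
apply: X_brackets => b hb; apply/memSKO2 => //; exists b => //.
exact: small_ker hb.
Qed.

Lemma X_SKO E : X E -> E \in SKO p t lam.
Proof. by apply: X_brackets => b; apply: small_SKO1. Qed.

(** Linearity lets [SKO1_image] form the image of [Del] as a subspace. *)
HB.instance Definition _ w := GRing.isLinear.Build F O O _ (Del w)
  (fun x a b => etrans (DelD w (x *: a) b) (congr1 (+%R^~ _) (DelZ w x a))).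

Lemma SKO1_image D : D \in SKO1 p t lam ->
  exists2 a, D = DKO (Del (c + 2%:R) a) & Del c (Del (c + 2%:R) a) = 0.
Proof.
pose W : {vspace 'End(O)} := limg (linfun DKO \o linfun (Del (c + 2%:R)))%VF.
have : (SKO1 p t lam <= W)%VS.
  apply/sbracketvP => D1 D2 /memSKO2 [] // a ha -> /memSKO2 [] // b hb ->.
  rewrite sbracket_DKO // (brk_ker charFp ha hb); apply/memv_imgP.
  by exists (sg a ** b); rewrite ?memvf // comp_lfunE !lfunE.
move=> /subvP hW /hW /memv_imgP[a _ ->]; exists a; last by rewrite DelDel.
by rewrite comp_lfunE !lfunE.
Qed.

Lemma SKO_sub_generated h : is_subsuperalgebra h -> (forall E, X E -> E \in h) ->
  (SKO p t lam <= h)%VS.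
Proof.
move=> sh hX; apply/sbracketvP => D1 D2.
move=> /SKO1_image[a -> ka] /SKO1_image[b -> kb].
rewrite sbracket_DKO // (brk_ker charFp ka kb); apply: (small_mem sh hX).
exists (sg (Del (c + 2%:R) a) ** Del (c + 2%:R) b) => //.
have [c1|] := eqVneq (c + 1) 0; [right | by left].
(* For c = -1 integration by parts moves [Del (c + 2)] onto the second factor as [Del c], which
   kills it. *)
rewrite sgnp_Del mulNl top_coefN top_coef_Del // (_ : - (c + 2%:R) = c).
  by rewrite kb mulx0 top_coef0 oppr0.
by move/eqP: c1; rewrite addr_eq0 => /eqP ->; ring.
Qed.

End Main.

Theorem theorem2p8 (F : fieldType) (p n : nat) (t : 'I_n -> nat) (lam : F)
    (charFp : p \in [pchar F]) (p_gt3 : (3 < p)%N) (n_ge3 : (3 <= n)%N)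
    (t_gt0 : forall i : 'I_n, (0 < t i)%N) :
  forall D, D \in SKO p t lam <->
    lie_generated (fun E => Tset lam E \/ Sset lam E \/ E = DKO_one F p t) D.
Proof.
have natr_neq0 k : (0 < k < p)%N -> k%:R != 0 :> F.
  move=> /andP[k0 kp]; rewrite -(dvdn_pcharf charFp).
  by apply/negP => /(dvdn_leq k0); rewrite leqNgt kp.
have two0 : 2%:R != 0 :> F by apply: natr_neq0; rewrite (ltn_trans _ p_gt3).
have three0 : 3%:R != 0 :> F by apply: natr_neq0; rewrite p_gt3.
move=> D; split=> [hD h sh hX|gD].
  by apply: (subvP (SKO_sub_generated charFp two0 three0 t_gt0 n_ge3 sh hX)).
apply: gD => [|E hE]; first exact: SKO_subsuper.
exact: X_SKO.
Qed.
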